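(* Let $H$ and $E$ be separable Hilbert spaces, let $V$ be a Hilbert space compactly embedded into $H$, and let $S:H\times E\to H$ be a continuous mapping. Let $\{\eta_k\}_{k\ge1}$ be i.i.d. random variables in $E$ whose law $\ell$ has compact support $\mathcal K\subset E$, and let $X\subset H$ be a compact set such that $S(X\times\mathcal K)\subset X$. Consider the random dynamical system $u_k=S(u_{k-1},\eta_k)$, $k\ge1$, and assume the following. (H$_1$) The mapping $S$ is twice continuously differentiable from $H\times E$ to $V$, and its derivatives are bounded on bounded subsets. Moreover, for any fixed $u\in H$, the mapping $\eta\mapsto S(u,\eta)$ is analytic from $E$ to $H$, and all its derivatives $(D^j_\eta S)(u,\eta)$ are continuous functions of $(u,\eta)$ that are bounded on bounded subsets of $H\times E$. (H$_2$) There is $\hat u\in X$ such that for any $\varepsilon>0$ one can find an integer $m\ge1$ with the following property: for any $u\in X$ there are $\zeta_1,\dots,\zeta_m\in\mathcal K$ such that $\|S_m(u;\zeta_1,\dots,\zeta_m)-\hat u\|<\varepsilon$. (H$_3$) For any $u\in X$, the set $\mathcal K^u$ of those $\eta\in E$ for which the image of the derivative $(D_\eta S)(u,\eta):E\to H$ is dense in $H$ has full $\ell$-measure. (H$_4$) There exist an orthonormal basis $\{e_j\}$ in $E$, independent random variables $\xi_{jk}$, and real numbers $b_j$ such that $$\eta_k=\sum_{j=1}^\infty b_j\xi_{jk}e_j,\qquad \sum_{j=1}^\infty b_j^2<\infty .$$ Moreover, the laws of $\xi_{jk}$ have Lipschitz-continuous densities $\rho_j$ with respect to the Lebesgue measure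 on $\mathbb R$. Then the Markov process $(u_k,\mathbb P_u)$ on $X$ has a unique stationary measure $\mu\in\mathcal P(X)$, and there is a sequence of positive numbers $\{\gamma_k\}$ going to zero as $k\to\infty$ such that $$\|\mathfrak P_k^*\lambda-\mu\|_L^*\le\gamma_k\quad\text{for all }k\ge0\text{ and }\lambda\in\mathcal P(X).$$
   Context: $\|\cdot\|$ is the norm of $H$. For $u\in H$ and $\zeta_1,\dots,\zeta_m\in E$, $S_m(u;\zeta_1,\dots,\zeta_m)$ denotes $u_m$, where $u_0=u$ and $u_k=S(u_{k-1},\zeta_k)$ for $1\le k\le m$. $(u_k,\mathbb P_u)$ is the discrete-time Markov process formed by the trajectories of $u_k=S(u_{k-1},\eta_k)$ issued from points $u\in X$; $P_k(u,\cdot)$ is its transition function, and $\mathfrak P_k^*:\mathcal P(X)\to\mathcal P(X)$, $\mathfrak P_k^*\lambda(\Gamma)=\int_XP_k(u,\Gamma)\lambda(du)$, the corresponding Markov operator on the set $\mathcal P(X)$ of Borel probability measures. A measure $\mu$ is stationary if $\mathfrak P_1^*\mu=\mu$. The dual-Lipschitz metric is $\|\mu_1-\mu_2\|_L^*=\sup_{\|g\|_L\le1}|\int g\,d\mu_1-\int g\,d\mu_2|$, where, for continuous $g:X\to\mathbb R$, $\|g\|_L=\sup_X|g|+\sup_{0<\|u-v\|\le1}\frac{|g(u)-g(v)|}{\|u-v\|}$.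
   Formalization: All coefficients b_j in (H4) are assumed nonzero; with some b_j = 0 uniqueness can fail, since (H3) may then hold only through noise directions that are never excited (e.g. random-time steps along a minimal, non-uniquely ergodic flow). *)

(* Defs.v *)
From HB Require Import structures.
From mathcomp Require Import all_boot all_order all_algebra finmap.
From mathcomp Require Import all_classical all_reals all_analysis.
Set Implicit Arguments.
Unset Strict Implicit.
Unset Printing Implicit Defensive.
Import Order.TTheory GRing.Theory Num.Theory.
Import numFieldNormedType.Exports.
Local Open Scope classical_set_scope.
Local Open Scope ring_scope.

Definition separable (T : topologicalType) :=
  exists A : set T, countable A /\ dense A.

(* A real Hilbert space is a complete normed space [H] together with a dot
   product [ip] inducing its norm. *)
Definition induces_norm (R : realType) (H : normedModType R)
    (ip : {dot H for idfun}) :=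
  forall u : H, `|u| ^+ 2 = ip u u.

(* The basis is indexed by a set [J] of integers so that finite-dimensional
   spaces are covered as well; [J = setT] gives bases [e_0, e_1, ...]. *)
Definition orthonormal_basis (R : realType) (E : normedModType R)
    (ip : {dot E for idfun}) (J : set nat) (e : nat -> E) :=
  (forall i j, J i -> J j -> ip (e i) (e j) = (i == j)%:R) /\
  dense [set x : E | exists n (c : nat -> R),
           x = \sum_(j < n | (j : nat) \in J) c j *: e j].

(* [V] is seen as a subspace of [H] through the injection [iota]. *)
Definition compact_embedding (R : realType) (V H : normedModType R)
    (iota : {linear V -> H}) :=
  injective iota /\
  forall B : set V, bounded_set B -> precompact (iota @` B).

Section Multilinear.
Context {R : realType} {U W : normedModType R}.

Definition tuple_upd n (hs : n.-tuple U) (i : 'I_n) (x : U) : n.-tuple U :=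
  [tuple if k == i then x else tnth hs k | k < n].

Definition multilinear n (A : n.-tuple U -> W) :=
  forall (i : 'I_n) (hs : n.-tuple U) (a : R) (x y : U),
    A (tuple_upd hs i (a *: x + y)) =
    a *: A (tuple_upd hs i x) + A (tuple_upd hs i y).

Definition opnorm_le n (A : n.-tuple U -> W) (M : R) :=
  forall hs : n.-tuple U, `|A hs| <= M * \prod_(i < n) `|tnth hs i|.

(* Continuity and boundedness for the operator norm of a family of multilinear
   maps depending on a parameter in [Z]. *)
Definition opnorm_continuous (Z : topologicalType) n
    (A : Z -> n.-tuple U -> W) :=
  forall z (e : R), 0 < e ->
    \forall z' \near z, opnorm_le (fun hs => A z' hs - A z hs) e.

Definition opnorm_bounded_on_bounded (Z : normedModType R) n
    (A : Z -> n.-tuple U -> W) :=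
  forall B : set Z, bounded_set B ->
    exists M : R, forall z, B z -> opnorm_le (A z) M.

(* [D j x] is the j-th Frechet derivative of [f] at [x], for [j <= n], where
   D^{j+1} f (x) (h, h_1, ..., h_j) is the derivative at x in the direction h of
   y |-> D^j f (y) (h_1, ..., h_j); the limit defining the derivative is taken
   in the operator norm. *)
Definition frechet_derivatives (n : nat) (f : U -> W)
    (D : forall j, U -> j.-tuple U -> W) :=
  [/\ forall x, D 0%N x [tuple] = f x,
      forall j x, (j <= n)%N ->
        multilinear (D j x) /\ exists M, opnorm_le (D j x) M
    & forall j x, (j < n)%N -> forall e : R, 0 < e ->
        \forall h \near (0 : U),
          opnorm_le (fun hs => D j (x + h) hs - D j x hs
                               - D j.+1 x [tuple of h :: hs])
                    (e * `|h|)].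

(* Local expansion in a power series with positive radius of convergence. The
   coefficients may be symmetrized, so symmetry is not required. *)
Definition analytic (f : U -> W) :=
  forall x, exists (r : R) (A : forall j, j.-tuple U -> W) (M : nat -> R),
    [/\ 0 < r,
        forall j, [/\ multilinear (A j), 0 <= M j & opnorm_le (A j) (M j)],
        cvgn [series M j * r ^+ j]_j
      & forall h, `|h| < r ->
          [series A j [tuple of nseq j h]]_j @ \oo --> f (x + h)].

End Multilinear.

Section Regularity.
Context {R : realType} {H E V : normedModType R}.

Definition C2_bounded (F : H * E -> V) :=
  exists D, frechet_derivatives 2 F D /\
    forall j, (0 < j <= 2)%N ->
      opnorm_continuous (D j) /\ opnorm_bounded_on_bounded (D j).

Definition partially_analytic (S : H * E -> H) :=
  (forall u, analytic (fun z => S (u, z))) /\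
  exists D : H -> forall j, E -> j.-tuple E -> H,
    (forall u n, frechet_derivatives n (fun z => S (u, z)) (D u)) /\
    forall j, (0 < j)%N ->
      opnorm_continuous (fun p : H * E => D p.1 j p.2) /\
      opnorm_bounded_on_bounded (fun p : H * E => D p.1 j p.2).

End Regularity.

Definition borel (T : ptopologicalType) := g_sigma_algebraType (@open T).

Definition msupport (R : realType) (T : ptopologicalType)
    (l : set (borel T) -> \bar R) : set T :=
  [set x | forall U : set T, open U -> U x -> (0 < l U)%E].

Definition mutually_independent d d' (T : measurableType d)
    (T' : measurableType d') (R : realType) (P : probability T R)
    (I : choiceType) (D : set I) (X : I -> {mfun T >-> T'}) :=
  forall (s : {fset I}) (B : I -> set T'),
    (forall i, i \in s -> D i) -> (forall i, measurable (B i)) ->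
    P (\bigcap_(i in [set` s]) (X i @^-1` B i)) =
    (\prod_(i <- s) P (X i @^-1` B i))%E.

(* [traj S zeta u m] is S_m(u; zeta_1, ..., zeta_m), with zeta_{k+1} written
   [zeta k]. *)
Fixpoint traj (H E : Type) (S : H * E -> H) (zeta : nat -> E) (u : H) (m : nat)
    : H :=
  if m is k.+1 then S (traj S zeta u k, zeta k) else u.

(* A Borel probability measure on the compact set [X] is represented by a Borel
   probability measure on [H] giving mass 1 to [X]. *)
Section Markov.
Context {R : realType} {H E : completeNormedModType R}.
Context {d : measure_display} {Omega : measurableType d}.
Variables (P : probability Omega R) (S : H * E -> H) (eta : nat -> Omega -> E).
Variable X : set H.

Definition transition (k : nat) (u : H) (Gamma : set (borel H)) : \bar R :=
  P [set w | Gamma (traj S (eta ^~ w) u k)].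

Definition markov_op (k : nat) (lambda : set (borel H) -> \bar R)
    (Gamma : set (borel H)) : \bar R :=
  (\int[lambda]_(u in X) transition k u Gamma)%E.

Definition stationary (mu : set (borel H) -> \bar R) :=
  forall Gamma : set (borel H), measurable Gamma ->
    markov_op 1 mu Gamma = mu Gamma.

End Markov.

Section DualLipschitz.
Context {R : realType} {H : completeNormedModType R}.
Variable X : set H.
Local Open Scope ereal_scope.

(* The value 0 is added to the second set so that its supremum is 0, and not
   -oo, when no pair of distinct points of [X] is at distance at most 1. *)
Definition lip_norm (g : H -> R) : \bar R :=
  ereal_sup [set `|g u|%:E | u in X] +
  ereal_sup (0 |` [set q | exists u v,
    [/\ X u, X v, (0 < `|u - v| <= 1)%R
      & q = (`|g u - g v| / `|u - v|)%:E]]).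

Definition dual_lip_dist (mu1 mu2 : set (borel H) -> \bar R) : \bar R :=
  ereal_sup [set `| \int[mu1]_(u in X) (g u)%:E - \int[mu2]_(u in X) (g u)%:E |
    | g in [set g : H -> R | {within X, continuous g} /\ lip_norm g <= 1]].

End DualLipschitz.

(* Main.v *)
Require Import Defs.
From HB Require Import structures.
From mathcomp Require Import all_boot all_order all_algebra finmap.
From mathcomp Require Import all_classical all_reals all_analysis.
From mathcomp Require Import measurable_realfun ring lra.
Set Implicit Arguments.
Unset Strict Implicit.
Unset Printing Implicit Defensive.
Import Order.TTheory GRing.Theory Num.Theory.
Import numFieldNormedType.Exports.
Local Open Scope classical_set_scope.
Local Open Scope ring_scope.

(** The transition averages [transfer k f], which send a function [f] to the
    expectation of [f] at time [k] as a function of the initial state, become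
    constant on [X], uniformly over a class of Lipschitz functions. The constant,
    as a function of [f], is the integral of [f] against the stationary measure.

    The regularity of the averages comes from the noise. Near a pair [(u, eta)]
    where the partial derivative in the noise has dense image, the directions in
    which a change of state moves the image under [S] form a precompact set, since
    [S] takes values in a space compactly embedded in [H]; they are therefore
    followed, up to a small factor, by moving finitely many coordinates of the
    noise ([local_control]). Because the derivative is strict, the same translation
    of the noise serves all noises close to [eta]. The densities of the coordinates
    are Lipschitz and, the law of the noise being compactly supported, have bounded
    support, so that translating a coordinate changes expectations of bounded
    functions by an amount linear in the translation ([Ex_shift_coord]). Covering
    the law of the noise by countably many such neighbourhoods, of which finitely
    many carry almost all of the mass, gives the Lasota-Yorke inequality
    ([lasota_yorke]): the average over one step of a function bounded by [M] with
    Lipschitz constant [k] has Lipschitz constant at most [k / 2 + C * M] on [X].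

    Consequently the functions bounded by 1 with a large enough Lipschitz constant
    [Lstar] form a class stable under averaging. Controllability to [uhat] and
    compactness of [X] give a probability, bounded below uniformly in the initial
    state, of being close to [uhat] at some fixed time ([minorization]); functions
    of the class are almost constant there, so that at each such time the
    oscillation on [X] is multiplied by a factor less than 1, up to a small error
    ([osc_step]). Hence it tends to 0 uniformly over the class ([mixing]).

    The limits of the averages define a positive linear functional on bounded
    Lipschitz functions, represented by a probability measure on [X] through
    Daniell's construction and a compactness argument ([riesz]). Its stationarity,
    the uniqueness and the rate, which is the uniform oscillation at time [k], all
    follow from the distance between the averages and their limit
    ([equil_approx]); functions of dual-Lipschitz norm at most 1 extend from [X]
    to members of the class ([lip_norm_extend]). *)

(** * Expectations of bounded measurable functions *)

Lemma probm_setT {d} {T : measurableType d} {R : realType} (mu : probability T R) :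
  (mu : {measure set T -> \bar R}) setT = 1%E.
Proof. exact: probability_setT. Qed.

Section BoundedMeasurable.
Context {d : measure_display} {T : measurableType d} {R : realType}.

(** All expectations below are of bounded measurable functions, for which the
    real-valued integral against a probability is linear and monotone with no
    integrability side condition. *)
Definition bmfun (f : T -> R) :=
  measurable_fun setT f /\ exists M : R, forall x, `|f x| <= M.

Lemma bm_cst (c : R) : bmfun (fun=> c).
Proof. by split; [exact: measurable_cst | exists `|c|]. Qed.

Lemma bmD f g : bmfun f -> bmfun g -> bmfun (fun x => f x + g x).
Proof.
move=> [mf [M fM]] [mg [N gN]]; split; first exact: measurable_funD.
by exists (M + N) => x; rewrite (le_trans (ler_normD _ _))// lerD.
Qed.

Lemma bmM f g : bmfun f -> bmfun g -> bmfun (fun x => f x * g x).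
Proof.
move=> [mf [M fM]] [mg [N gN]]; split; first exact: measurable_funM.
by exists (M * N) => x; rewrite normrM ler_pM.
Qed.

Lemma bmN f : bmfun f -> bmfun (fun x => - f x).
Proof.
move=> [mf [M fM]]; split; first exact: measurableT_comp.
by exists M => x; rewrite normrN.
Qed.

Lemma bmB f g : bmfun f -> bmfun g -> bmfun (fun x => f x - g x).
Proof. by move=> bf bg; apply: bmD => //; exact: bmN. Qed.

Lemma bm_norm f : bmfun f -> bmfun (fun x => `|f x|).
Proof.
move=> [mf [M fM]]; split; first exact: measurableT_comp.
by exists M => x; rewrite normr_id.
Qed.

Lemma bm_indic (A : set T) : measurable A -> bmfun (\1_A : T -> R).
Proof.
move=> mA; split; first exact: measurable_indic.
by exists 1 => x; rewrite indicE ger0_norm// lern1 leq_b1.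
Qed.

Variable mu : probability T R.

Lemma bm_int f : bmfun f -> mu.-integrable setT (EFin \o f).
Proof.
move=> [mf [M fM]]; apply: measurable_bounded_integrable => //.
  by apply: (le_lt_trans (probability_le1 mu measurableT)); exact: ltry.
by exists M; split; [exact: num_real | move=> x Mx y _; exact: le_trans (ltW Mx)].
Qed.

Lemma Ex_fin f : bmfun f -> (\int[mu]_x (f x)%:E = (\int[mu]_x f x)%:E)%E.
Proof. by move=> /bm_int bf; rewrite fineK// integrable_fin_num. Qed.

Lemma ExD f g : bmfun f -> bmfun g ->
  \int[mu]_x (f x + g x) = \int[mu]_x f x + \int[mu]_x g x.
Proof. by move=> bf bg; rewrite RintegralD//; exact: bm_int. Qed.

Lemma ExB f g : bmfun f -> bmfun g ->
  \int[mu]_x (f x - g x) = \int[mu]_x f x - \int[mu]_x g x.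
Proof. by move=> bf bg; rewrite RintegralB//; exact: bm_int. Qed.

Lemma ExZ (c : R) f : bmfun f -> \int[mu]_x (c * f x) = c * \int[mu]_x f x.
Proof. by move=> bf; rewrite RintegralZl//; exact: bm_int. Qed.

Lemma Ex_cst (c : R) : \int[mu]_x c = c.
Proof. by rewrite Rintegral_cst// (probm_setT mu) mulr1. Qed.

Lemma Ex_le f g : bmfun f -> bmfun g -> (forall x, f x <= g x) ->
  \int[mu]_x f x <= \int[mu]_x g x.
Proof. by move=> bf bg fg; apply: le_Rintegral => //; exact: bm_int. Qed.

Lemma Ex_ae_eq f g : bmfun f -> bmfun g -> {ae mu, forall x, f x = g x} ->
  \int[mu]_x f x = \int[mu]_x g x.
Proof.
move=> [mf _] [mg _] fg; congr fine; apply: ae_eq_integral => //.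
- exact/measurable_EFinP.
- exact/measurable_EFinP.
- by apply: filterS fg => x fgx _ /=; rewrite fgx.
Qed.

Lemma Ex_ae_le f g : bmfun f -> bmfun g -> {ae mu, forall x, f x <= g x} ->
  \int[mu]_x f x <= \int[mu]_x g x.
Proof.
move=> bf bg fg.
have bm : bmfun (fun x => Num.min (f x) (g x)).
  split; first by apply: measurable_minr; [exact: bf.1|exact: bg.1].
  have [M fM] := bf.2; have [N gN] := bg.2.
  exists (Num.max M N) => x; rewrite minEle le_max.
  by case: ifP => _; rewrite ?fM ?gN ?orbT.
rewrite (@Ex_ae_eq f (fun x => Num.min (f x) (g x)))//; last first.
  by apply: filterS fg => x fgx; apply/esym/min_idPl.
by apply: Ex_le => // x; rewrite ge_min lexx orbT.
Qed.

Lemma Ex_ge0 (f : T -> R) : (forall x, 0 <= f x) -> 0 <= \int[mu]_x f x.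
Proof. by move=> f0; exact: Rintegral_ge0. Qed.

Lemma Ex_normle f : bmfun f -> `|\int[mu]_x f x| <= \int[mu]_x `|f x|.
Proof. by move=> bf; apply: le_normr_Rintegral => //; exact: bm_int. Qed.

Lemma Ex_bound (f : T -> R) (M : R) : measurable_fun setT f -> (forall x, `|f x| <= M) ->
  `|\int[mu]_x f x| <= M.
Proof.
move=> mf fM; have bf : bmfun f by split => //; exists M.
rewrite (le_trans (Ex_normle bf))// -[leRHS](Ex_cst M).
by apply: Ex_le => //; [exact: bm_norm | exact: bm_cst].
Qed.

Lemma Ex_indic (A : set T) : measurable A -> (\int[mu]_x \1_A x)%:E = mu A.
Proof.
by move=> mA; rewrite -Ex_fin; [rewrite integral_indic// setIT|exact: bm_indic].
Qed.

Lemma Ex_cvg (f_ : nat -> T -> R) (f : T -> R) (M : R) :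
  (forall n, measurable_fun setT (f_ n)) -> measurable_fun setT f ->
  (forall n x, `|f_ n x| <= M) ->
  {ae mu, forall x, f_ ^~ x @ \oo --> f x} ->
  (fun n => \int[mu]_x f_ n x) @ \oo --> \int[mu]_x f x.
Proof.
move=> mf_ mf fM cf.
have [] := @dominated_convergence _ _ _ mu _ measurableT
  (fun n x => (f_ n x)%:E) (fun x => (f x)%:E) (fun=> M%:E).
- by move=> n; exact/measurable_EFinP.
- exact/measurable_EFinP.
- by apply: filterS cf => x cx _; apply: cvg_EFin cx; exact: nearW.
- exact: (bm_int (bm_cst M)).
- by apply: nearW => x n _; rewrite /= lee_fin.
move=> intf _ cv; apply: fine_cvg; rewrite fineK//; exact: integrable_fin_num.
Qed.

End BoundedMeasurable.

Lemma bm_comp {d d'} {T : measurableType d} {T' : measurableType d'}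
    {R : realType} (f : T' -> R) (g : T -> T') :
  bmfun f -> measurable_fun setT g -> bmfun (fun x => f (g x)).
Proof.
move=> [mf [M fM]] mg; split; last by exists M.
exact: (measurableT_comp mf mg).
Qed.

Section Product.
Context {d d'} {T : measurableType d} {T' : measurableType d'} {R : realType}.
Variables (mu : probability T R) (nu : probability T' R).

Lemma Ex_pushforward (X : {mfun T >-> T'}) (f : T' -> R) : bmfun f ->
  \int[distribution mu X]_x f x = \int[mu]_x f (X x).
Proof.
move=> bf; congr fine.
rewrite integral_pushforward//; first exact/measurable_EFinP/bf.1.
rewrite preimage_setT; apply: (@bm_int _ _ _ mu (f \o X)); exact: bm_comp.
Qed.

(** Stated for any [m] that agrees with the product on rectangles, so that it
    also applies to the joint law of two independent variables. *)
Lemma Ex_prod (m : probability (T * T')%type R) (F : T * T' -> R) :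
  (forall A B, measurable A -> measurable B -> m (A `*` B) = (mu A * nu B)%E) ->
  bmfun F ->
  \int[m]_z F z = \int[mu]_x \int[nu]_y F (x, y).
Proof.
move=> mE bF.
have mX X : measurable X -> (mu \x nu)%E X = m X.
  by move=> mX; exact: product_measure_unique.
have bFx x : bmfun (fun y => F (x, y)).
  by apply: bm_comp => //; exact: measurable_pair1.
have intF : (mu \x nu)%E.-integrable setT (EFin \o F).
  apply: measurable_bounded_integrable => //.
  - apply: (@le_lt_trans _ _ (m setT)); last by rewrite probability_setT ltry.
    by rewrite -mX.
  - exact: bF.1.
  have [M FM] := bF.2.
  by exists M; split; [exact: num_real | move=> x Mx y _; exact: le_trans (ltW Mx)].
congr fine.
rewrite (@eq_measure_integral _ _ _ _ (mu \x nu)%E)//; last first.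
  by move=> A mA _; exact/esym/mX.
rewrite -(integral12_prod_meas1 intF).
by apply: eq_integral => x _; exact: (Ex_fin nu (bFx x)).
Qed.

Lemma bm_Ex (F : T * T' -> R) : bmfun F -> bmfun (fun x => \int[nu]_y F (x, y)).
Proof.
move=> bF; have [M FM] := bF.2.
have bFx x : bmfun (fun y => F (x, y)).
  by apply: bm_comp => //; exact: measurable_pair1.
split; last first.
  by exists M => x; apply: Ex_bound => //; exact: (bFx x).1.
have intF : (mu \x nu)%E.-integrable setT (EFin \o F).
  apply: measurable_bounded_integrable => //.
  - apply: (@le_lt_trans _ _ 1%E); last exact: ltry.
    by rewrite -setXTT [leLHS]product_measure1E// (probm_setT mu) (probm_setT nu) mule1.
  - exact: bF.1.
  by exists M; split; [exact: num_real | move=> x Mx y _; exact: le_trans (ltW Mx)].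
apply/measurable_EFinP.
rewrite (_ : _ \o _ = fun x => (\int[nu]_y (EFin \o F) (x, y))%E).
  exact: measurable_fubini_F intF.
by apply/funext => x; exact/esym/(Ex_fin nu (bFx x)).
Qed.

End Product.

(** * Borel sets and supports in separable spaces *)

Section Borel.
Context {R : realType}.

Lemma open_borel (T : ptopologicalType) (Op : set T) :
  open Op -> measurable (Op : set (borel T)).
Proof. exact: sub_sigma_algebra. Qed.

Lemma closed_borel (T : ptopologicalType) (Op : set T) :
  closed Op -> measurable (Op : set (borel T)).
Proof.
move=> cO; rewrite -(setCK Op); apply: (@measurableC _ (borel T)).
by apply: open_borel; exact: closed_openC.
Qed.

Lemma borel_funP {d} {Om : measurableType d} (T : ptopologicalType)
    (X : Om -> T) :
  (forall Op : set T, open Op -> measurable (X @^-1` Op)) ->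
  measurable_fun setT (X : Om -> borel T).
Proof.
move=> oX; apply: (@measurability _ _ _ (borel T) setT X (@open T)) => //.
by move=> _ [Op oO <-]; rewrite setTI; exact: oX.
Qed.

Lemma borel_realP {d} {Om : measurableType d} (X : Om -> R) :
  measurable_fun setT X <-> measurable_fun setT (X : Om -> borel R).
Proof.
split=> mX.
  apply: borel_funP => Op oO; rewrite -[_ @^-1` _]setTI; apply: mX => //.
  exact: open_measurable.
apply: (measurability _ (RGenOInfty.measurableE R)) => //.
move=> _ [_ [a ->] <-]; apply: (mX measurableT).
by apply: open_borel; exact: interval_open.
Qed.

Lemma continuous_borel (T T' : ptopologicalType) (f : T -> T') :
  continuous f -> measurable_fun setT (f : borel T -> borel T').
Proof.
move=> cf; apply: borel_funP => Op oO; apply: open_borel.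
by move: cf => /continuousP; apply.
Qed.

Lemma continuous_borelR (T : ptopologicalType) (f : T -> R) :
  continuous f -> measurable_fun setT (f : borel T -> R).
Proof. by move=> cf; apply/borel_realP; exact: continuous_borel. Qed.

(** The balls of rational radius about a dense sequence: the form in which
    separability is used below. *)
Lemma separable_balls (T : normedModType R) : separable T ->
  exists (a : nat -> T) (q : nat -> R), (forall n, 0 < q n) /\
    forall x e, 0 < e -> exists n, q n < e /\ `|x - a n| < q n.
Proof.
move=> [A [/countable_injP[f finj] Ad]].
pose c n : T := xget point [set x | A x /\ f x = n].
pose p (n : nat) : nat * nat := odflt (0%N, 0%N) (@choice.unpickle (nat * nat)%type n).
exists (fun n => c (p n).1), (fun n => (p n).2.+1%:R^-1); split=> [n|x e e0].
  by rewrite invr_gt0 ltr0n.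
have [k ke] : exists k : nat, k.+1%:R^-1 < e.
  have [k _ kP] := near_infty_natSinv_lt (PosNum e0).
  by exists k; exact: (kP k (leqnn k)).
have k0 : 0 < k.+1%:R^-1 :> R by rewrite invr_gt0 ltr0n.
have [y [yx Ay]] : ball x k.+1%:R^-1 `&` A !=set0.
  by apply: Ad; [exists x; exact: ballxx | exact: ball_open].
exists (choice.pickle (f y, k)); rewrite /p choice.pickleK /=; split=> //.
rewrite (_ : c (f y) = y); first by move: yx; rewrite -ball_normE.
rewrite /c; case: xgetP => [z -> [Az fz]|/(_ y)/not_andP[]//].
by apply: finj; rewrite ?inE.
Qed.

(** An open set of the product is a countable union of products of balls, by
    separability; this replaces the equality of the Borel sigma-algebra of a
    product with the product of the Borel sigma-algebras. *)
Lemma pair_borel {d} {Om : measurableType d} (U W : normedModType R)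
    (Z : ptopologicalType) (X : Om -> U) (Y : Om -> W) (F : U * W -> Z) :
  separable U -> separable W ->
  measurable_fun setT (X : Om -> borel U) ->
  measurable_fun setT (Y : Om -> borel W) -> continuous F ->
  measurable_fun setT ((fun w => F (X w, Y w)) : Om -> borel Z).
Proof.
move=> /separable_balls[a [q [q0 aq]]] /separable_balls[b [r [r0 br]]] mX mY cF.
apply: borel_funP => Op oO.
have {}oO : open (F @^-1` Op) by move: cF => /continuousP; apply.
pose G n m := [set w | ball (a n) (q n) (X w) /\ ball (b m) (r m) (Y w)].
have mG n m : measurable (G n m).
  have mXn := mX measurableT _ (open_borel (@ball_open R U (a n) (q n))).
  have mYm := mY measurableT _ (open_borel (@ball_open R W (b m) (r m))).
  by rewrite setTI in mXn; rewrite setTI in mYm; exact: measurableI.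
pose D n := [set m | ball (a n) (q n) `*` ball (b m) (r m) `<=` F @^-1` Op].
rewrite (_ : _ @^-1` _ = \bigcup_n \bigcup_(m in D n) G n m).
  by apply: bigcup_measurable => n _; apply: bigcup_measurable => m _.
apply/seteqP; split => [w /= Ow|w [n _ [m Dnm [Xw Yw]]]]; last first.
  exact: (Dnm (X w, Y w)).
have /nbhs_ballP[e /= e0 eO] : nbhs (X w, Y w) (F @^-1` Op).
  exact: open_nbhs_nbhs.
have e20 : 0 < e / 2 by rewrite divr_gt0.
have [n [qn an]] := aq (X w) _ e20.
have [m [rm bm]] := br (Y w) _ e20.
exists n => //; exists m.
  move=> [x y] [/= xn ym]; apply: eO; split => /=.
  - rewrite (splitr e); apply: (@ball_triangle _ _ (a n)).
      by rewrite -ball_normE /=; exact: lt_trans qn.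
    by apply: le_ball xn; exact: ltW.
  - rewrite (splitr e); apply: (@ball_triangle _ _ (b m)).
      by rewrite -ball_normE /=; exact: lt_trans rm.
    by apply: le_ball ym; exact: ltW.
by split; rewrite -ball_normE /= distrC.
Qed.

Lemma separable_real : separable R.
Proof.
exists (range (@ratr R)); split; last exact: dense_rat.
by apply: (@sub_countable _ _ _ (@setT rat)); [exact: card_image_le | exact: countableP].
Qed.

End Borel.

Section Support.
Context {R : realType} {E : completeNormedModType R}.
Hypothesis sepE : separable E.
Variable l : probability (borel E) R.

(** By the Lindelof property the complement of the support, being a union of
    null open sets, is null. *)
Lemma msupport_ae : {ae l, forall z : borel E, msupport l z}.
Proof.
have [a [q [q0 aq]]] := separable_balls sepE.
pose D := [set n | l (ball (a n) (q n) : set (borel E)) = 0%E].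
apply: (@negligibleS _ _ _ _ (\bigcup_(n in D) (ball (a n) (q n) : set (borel E)))).
  move=> x /existsNP[U /not_implyP[oU /not_implyP[Ux lU]]].
  have lU0 : l (U : set (borel E)) = 0%E.
    by apply/eqP; rewrite eq_le measure_ge0 andbT leNgt; apply/negP.
  have /nbhs_ballP[e /= e0 eU] : nbhs x U by exact: open_nbhs_nbhs.
  have e20 : 0 < e / 2 by rewrite divr_gt0.
  have [n [qn an]] := aq x _ e20.
  exists n; last by rewrite -ball_normE /= distrC.
  apply/eqP; rewrite eq_le measure_ge0 andbT -lU0.
  apply: le_measure; rewrite ?inE.
  - exact: (open_borel (@ball_open R E (a n) (q n))).
  - exact: open_borel.
  move=> y yn; apply: eU; rewrite (splitr e); apply: (@ball_triangle _ _ (a n)).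
    by rewrite -ball_normE /=; exact: lt_trans qn.
  by apply: le_ball yn; exact: ltW.
rewrite bigcup_mkcond; apply: negligible_bigcup => n.
case: ifPn => [/set_mem Dn|_]; last exact: negligible_set0.
by apply/negligibleP => //; exact: (open_borel (@ball_open R E (a n) (q n))).
Qed.

End Support.

(** * Lipschitz functions and cutoffs *)

Section Lipschitz.
Context {R : realType}.

(** The constant [k] is explicit and possibly negative, which spares the sign
    conditions when constants are computed. *)
Definition klip (T : normedModType R) (k : R) (f : T -> R) :=
  forall x y, `|f x - f y| <= k * `|x - y|.

Lemma klip_continuous (T : normedModType R) k (f : T -> R) :
  klip k f -> continuous f.
Proof.
move=> fk x; apply/cvgrPdist_lt => e e0.
have K1 : 0 < `|k| + 1 by rewrite ltr_wpDl.
have r0 : 0 < e / (`|k| + 1) by rewrite divr_gt0.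
apply: filterS (nbhsx_ballx x _ r0) => y; rewrite -ball_normE /= => xy.
rewrite (le_lt_trans (fk _ _))//.
apply: (@le_lt_trans _ _ ((`|k| + 1) * `|x - y|)).
  by rewrite ler_wpM2r// (le_trans (ler_norm k))// lerDl.
by rewrite mulrC -ltr_pdivlMr.
Qed.

Lemma klip_le (T : normedModType R) k k' (f : T -> R) :
  k <= k' -> klip k f -> klip k' f.
Proof. by move=> kk' fk x y; rewrite (le_trans (fk x y))// ler_wpM2r. Qed.

Lemma klip_cst (T : normedModType R) (c : R) : klip 0 (fun _ : T => c).
Proof. by move=> x y; rewrite subrr normr0 mul0r. Qed.

Lemma klipD (T : normedModType R) k k' (f g : T -> R) :
  klip k f -> klip k' g -> klip (k + k') (fun x => f x + g x).
Proof.
move=> fk gk x y; rewrite opprD addrACA (le_trans (ler_normD _ _))//.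
by rewrite mulrDl lerD.
Qed.

Lemma klipZ (T : normedModType R) c k (f : T -> R) :
  klip k f -> klip (`|c| * k) (fun x => c * f x).
Proof. by move=> fk x y; rewrite -mulrBr normrM -mulrA ler_wpM2l. Qed.

Lemma klipB (T : normedModType R) k k' (f g : T -> R) :
  klip k f -> klip k' g -> klip (k + k') (fun x => f x - g x).
Proof.
move=> fk gk; apply: klipD => // x y.
by rewrite -opprD normrN; exact: gk.
Qed.

Lemma klipM (T : normedModType R) k k' M M' (f g : T -> R) :
  0 <= M -> 0 <= M' -> (forall x, `|f x| <= M) -> (forall x, `|g x| <= M') ->
  klip k f -> klip k' g -> klip (k * M' + M * k') (fun x => f x * g x).
Proof.
move=> M0 M'0 fM gM fk gk x y.
have -> : f x * g x - f y * g y = (f x - f y) * g x + f y * (g x - g y) by ring.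
rewrite (le_trans (ler_normD _ _))// !normrM mulrDl; apply: lerD.
  by rewrite mulrAC ler_pM.
by rewrite -mulrA ler_pM.
Qed.

Definition test_bound (T : normedModType R) (f : T -> R) (M k : R) :=
  (forall x, `|f x| <= M) /\ klip k f.

Definition clamp (t : R) : R := Num.max 0 (Num.min 1 t).

Lemma clamp_ge0 t : 0 <= clamp t.
Proof. by rewrite /clamp le_max lexx. Qed.

Lemma clamp_le1 t : clamp t <= 1.
Proof. by rewrite /clamp ge_max ler01 ge_min lexx. Qed.

Lemma clamp_norm t : `|clamp t| <= 1.
Proof. by rewrite ger0_norm ?clamp_ge0 ?clamp_le1. Qed.

Lemma clamp1 t : 1 <= t -> clamp t = 1.
Proof. by move=> t1; rewrite /clamp; case: (leP 1 t) t1 => // _ _; apply/max_idPr. Qed.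

Lemma clamp0 t : t <= 0 -> clamp t = 0.
Proof. by move=> t0; rewrite /clamp; apply/max_idPl; rewrite ge_min t0 orbT. Qed.

Lemma clamp_id t : 0 <= t -> t <= 1 -> clamp t = t.
Proof. by move=> t0 t1; rewrite /clamp (min_idPr t1) (max_idPr t0). Qed.

(** Truncation does not increase distances, so it preserves Lipschitz
    constants. *)
Lemma clamp_dist s t : `|clamp s - clamp t| <= `|s - t|.
Proof.
wlog st : s t / s <= t.
  by move=> H; case: (leP s t) => [/H//|/ltW/H]; rewrite distrC (distrC t).
rewrite (distrC s) (ger0_norm (x := t - s)) ?subr_ge0// distrC.
have [t0|t0] := leP t 0.
  by rewrite !clamp0 ?(le_trans st)// subrr normr0 subr_ge0.
have [s1|s1] := leP 1 s.
  by rewrite !clamp1 ?(le_trans s1)// subrr normr0 subr_ge0.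
have [s0|s0] := leP s 0.
  rewrite (clamp0 s0) subr0 ger0_norm ?clamp_ge0//.
  have [t1|/ltW t1] := leP 1 t; first by rewrite clamp1//; lra.
  by rewrite clamp_id ?(ltW t0)//; lra.
rewrite (clamp_id (ltW s0) (ltW s1)).
have [t1|/ltW t1] := leP 1 t; first by rewrite clamp1// ger0_norm; lra.
by rewrite clamp_id ?(ltW t0)// ger0_norm; lra.
Qed.

Lemma klip_clamp (T : normedModType R) k (f : T -> R) :
  klip k f -> klip k (fun x => clamp (f x)).
Proof. by move=> fk x y; rewrite (le_trans (clamp_dist _ _)). Qed.

Lemma klip_norm (T : normedModType R) (a : T) : klip 1 (fun x => `|x - a|).
Proof.
move=> x y; rewrite mul1r (le_trans (ler_dist_dist _ _))//.
by rewrite opprB addrA subrK.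
Qed.

(** A Lipschitz cutoff, equal to 1 on the ball of radius [q] about [a] and
    vanishing outside the ball of radius [2 q]. *)
Definition cutoff (T : normedModType R) (a : T) (q : R) (x : T) : R :=
  clamp (2 - q^-1 * `|x - a|).

Lemma klip_cutoff (T : normedModType R) (a : T) q : 0 < q ->
  klip q^-1 (cutoff a q).
Proof.
move=> q0; apply: klip_clamp.
rewrite -[X in klip X _]add0r; apply: klipB; first exact: klip_cst.
rewrite -[X in klip X _]mulr1.
have := klipZ q^-1 (klip_norm a); rewrite ger0_norm//.
by rewrite invr_ge0 ltW.
Qed.

Lemma cutoff1 (T : normedModType R) (a : T) q x : 0 < q ->
  `|x - a| <= q -> cutoff a q x = 1.
Proof.
move=> q0 xa; apply: clamp1; rewrite lerBrDr -lerBrDl -ler_pdivlMl ?invr_gt0//.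
by rewrite invrK (_ : 2 - 1 = 1 :> R) ?mulr1//; ring.
Qed.

Lemma cutoff0 (T : normedModType R) (a : T) q x : 0 < q ->
  2 * q <= `|x - a| -> cutoff a q x = 0.
Proof.
move=> q0 xa; apply: clamp0; rewrite subr_le0 -ler_pdivrMl ?invr_gt0//.
by rewrite invrK mulrC.
Qed.

End Lipschitz.

(** * Folds over independent families *)

Section Independence.
Context {d} {Om : measurableType d} {R : realType} (P : probability Om R).

(** Both sides are finite measures in [W] that agree on rectangles. *)
Lemma indep_pair {d1 d2} {T1 : measurableType d1} {T2 : measurableType d2}
    (Y1 : Om -> T1) (Y2 : Om -> T2) (C : set Om) :
  measurable_fun setT Y1 -> measurable_fun setT Y2 -> measurable C ->
  (forall A B, measurable A -> measurable B ->
    P (Y1 @^-1` A `&` Y2 @^-1` B `&` C) =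
    (P (Y1 @^-1` A `&` Y2 @^-1` B) * P C)%E) ->
  forall W, measurable W ->
    P ((fun w => (Y1 w, Y2 w)) @^-1` W `&` C) =
    (P ((fun w => (Y1 w, Y2 w)) @^-1` W) * P C)%E.
Proof.
move=> mY1 mY2 mC H W mW.
pose Y w := (Y1 w, Y2 w).
have mY : measurable_fun setT Y by exact: measurable_fun_pair.
pose Ym : {mfun Om >-> (T1 * T2)%type} := HB.pack Y (isMeasurableFun.Build _ _ _ _ Y mY).
have PC0 : (0 <= fine (P C))%R by rewrite fine_ge0.
pose m1 : {measure set (T1 * T2) -> \bar R} := pushforward (mrestr P mC) Ym.
pose m2 : {measure set (T1 * T2) -> \bar R} :=
  mscale (NngNum PC0) (pushforward P Ym).
have PCE : P C = (fine (P C))%:E by rewrite fineK// fin_num_measure.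
suff : m1 mY W = m2 mY W.
  by rewrite /m1 /m2 /= /mscale /pushforward /mrestr /= -PCE muleC.
pose G := [set A `*` B | A in @measurable _ T1 & B in @measurable _ T2].
apply: (measure_unique G (fun=> setT `*` setT)) => //.
- exact: measurable_prod_measurableType.
- move=> _ _ [A1 mA1 [B1 mB1 <-]] [A2 mA2 [B2 mB2 <-]].
  by rewrite -setXI; exists (A1 `&` A2); [exact: measurableI|];
     exists (B1 `&` B2) => //; exact: measurableI.
- by move=> _; exists setT => //; exists setT.
- by rewrite bigcup_const ?setXTT//; exists 0%N.
- move=> _ [A mA [B mB <-]].
  rewrite /m1 /m2 /= /mscale /pushforward /mrestr /= -PCE.
  by rewrite muleC -H.
- move=> _; rewrite /m1 /pushforward /mrestr.
  apply: (@le_lt_trans _ _ 1%E); last exact: ltry.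
  by apply: probability_le1; rewrite setXTT preimage_setT setTI.
Qed.

(** Trajectories of the dynamics and partial sums of the noise are both obtained
    by folding finitely many members of an independent family; such a fold is
    independent of the members that it leaves out. *)
Section Fold.
Context {d1 d2} {T1 : measurableType d1} {T2 : measurableType d2}.
Context {I : choiceType} (D : set I) (X : I -> {mfun Om >-> T1}).
Hypothesis indep : mutually_independent P D X.
Variables (z0 : T2) (g : I -> T2 * T1 -> T2).
Hypothesis mg : forall i, measurable_fun setT (g i).

Fixpoint fold_rv (s : seq I) (w : Om) : T2 :=
  if s is i :: s' then g i (fold_rv s' w, X i w) else z0.

Lemma measurable_fold_rv s : measurable_fun setT (fold_rv s).
Proof.
elim: s => [|i s IH]; first exact: measurable_cst.
exact: (measurableT_comp (mg i) (measurable_fun_pair IH (measurable_funP (X i)))).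
Qed.

(** By induction on [s]: the pair made of the shorter fold and the next member is
    independent of the remaining members, by the induction hypothesis on
    rectangles and [indep_pair] in general. *)
Lemma fold_rv_indep s : uniq s -> (forall i, i \in s -> D i) ->
  forall (r : {fset I}) (A : set T2) (B : I -> set T1),
  (forall i, i \in r -> D i /\ i \notin s) -> measurable A ->
  (forall i, measurable (B i)) ->
  P (fold_rv s @^-1` A `&` \bigcap_(i in [set` r]) (X i @^-1` B i)) =
  (P (fold_rv s @^-1` A) * \prod_(i <- r) P (X i @^-1` B i))%E.
Proof.
elim: s => [_ _|i s IH /= /andP[ins us] sD] r A B rD mA mB.
  have -> : \bigcap_(i in [set` r]) X i @^-1` B i =
    setT `&` \bigcap_(i in [set` r]) X i @^-1` B i by rewrite setTI.
  have [Az|Az] := pselect (A z0).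
    rewrite (_ : fold_rv nil @^-1` A = setT); last by apply/seteqP; split.
    rewrite !setTI probability_setT mul1e indep// => j jr.
    by have [] := rD _ jr.
  rewrite (_ : fold_rv nil @^-1` A = set0); last by apply/seteqP; split.
  by rewrite set0I measure0 mul0e.
have sD' j : j \in s -> D j by move=> js; apply: sD; rewrite inE js orbT.
have ir : i \notin r.
  by apply/negP => /rD[_]; rewrite inE eqxx.
have mXB j : measurable (X j @^-1` B j).
  by rewrite -[X in measurable X]setTI; exact: (measurable_funP (X j)).
have mC : measurable (\bigcap_(j in [set` r]) X j @^-1` B j).
  by apply: fin_bigcap_measurable => // j _; exact: mXB.
have PC : P (\bigcap_(j in [set` r]) X j @^-1` B j) =
    (\prod_(j <- r) P (X j @^-1` B j))%E.
  by apply: indep => // j /rD[].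
rewrite -PC.
rewrite (_ : fold_rv (i :: s) @^-1` A =
  (fun w => (fold_rv s w, X i w)) @^-1` (g i @^-1` A))//.
apply: indep_pair => //; first exact: measurable_fold_rv.
- move=> A' B' mA' mB'.
  pose B2 j := if j == i then B' else B j.
  have mB2 j : measurable (B2 j) by rewrite /B2; case: ifP.
  have E1 : \bigcap_(j in [set` (i |` r)%fset]) X j @^-1` B2 j =
      X i @^-1` B' `&` \bigcap_(j in [set` r]) X j @^-1` B j.
    apply/seteqP; split => [w H|w [H1 H2] j /=].
      split; first by have := H i; rewrite /= /B2 eqxx; apply; rewrite fset1U1.
      move=> j jr; have := H j; rewrite /= /B2.
      case: eqP => [ji|_]; first by rewrite -ji jr in ir.
      by apply; rewrite in_fset1U jr orbT.
    rewrite in_fset1U /B2; case: eqP => [-> _|_ /=]//.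
    by move=> jr; exact: H2.
  rewrite -setIA -E1 IH//; last first.
    move=> j; rewrite in_fset1U => /orP[/eqP->|jr]; first by split=> //; apply: sD; rewrite mem_head.
    by have [Dj] := rD _ jr; rewrite inE negb_or => /andP[].
  rewrite big_fsetU1//= {1}/B2 eqxx.
  have -> : (\prod_(j <- r) P (X j @^-1` B2 j) = \prod_(j <- r) P (X j @^-1` B j))%E.
    rewrite !big_seq; apply: eq_bigr => j jr; rewrite /B2; case: eqP => // ji.
    by rewrite -ji jr in ir.
  rewrite -PC muleA; congr (_ * _)%E.
  have := IH us sD' [fset i]%fset A' B2.
  rewrite big_seq_fset1 (_ : \bigcap_(_ in _) _ = X i @^-1` B'); last first.
    apply/seteqP; split => [w H|w H j /=].
      by have := H i; rewrite /B2 eqxx; apply; rewrite /= inE.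
    by rewrite inE => /eqP->; rewrite /B2 eqxx.
  rewrite /B2 eqxx => ->//.
  by move=> j; rewrite inE => /eqP ->; split=> //; apply: sD; rewrite mem_head.
- by rewrite -[X in measurable X]setTI; exact: mg.
Qed.

(** By independence the pair has a product law, so that the variable outside the
    fold can be integrated first. *)
Lemma Ex_fold_rv s i (F : T2 * T1 -> R) :
  uniq s -> (forall j, j \in s -> D j) -> D i -> i \notin s -> bmfun F ->
  \int[P]_w F (fold_rv s w, X i w) =
  \int[P]_w \int[distribution P (X i)]_y F (fold_rv s w, y).
Proof.
move=> us sD Di ins bF.
have mZ := measurable_fold_rv s.
pose Z : {mfun Om >-> T2} := HB.pack (fold_rv s) (isMeasurableFun.Build _ _ _ _ _ mZ).
have mY := measurable_fun_pair mZ (measurable_funP (X i)).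
pose Y : {mfun Om >-> (T2 * T1)%type} := HB.pack (fun w => (fold_rv s w, X i w)) (isMeasurableFun.Build _ _ _ _ _ mY).
rewrite -(@Ex_pushforward _ _ _ _ _ P Y F)//.
rewrite (@Ex_prod _ _ _ _ _ (distribution P Z) (distribution P (X i)))//.
  by apply: Ex_pushforward; exact: (bm_Ex (distribution P Z) (distribution P (X i)) bF).
move=> A B mA mB.
have /= := @fold_rv_indep s us sD [fset i]%fset A (fun=> B).
rewrite big_seq_fset1 => <-//.
- rewrite /distribution /pushforward; congr (P _).
  apply/seteqP; split => [w [/= wA wB]|w [/= wA wB]].
    by split=> // j; rewrite /= inE => /eqP ->.
  by split=> //=; apply: (wB i); rewrite /= inE.
- by move=> j; rewrite inE => /eqP ->.
Qed.

End Fold.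
End Independence.

(** * Translation of a Lipschitz density *)

Section Density.
Context {R : realType}.
Local Notation leb := (@lebesgue_measure R).
Local Notation shift t :=
  (fun x : measurableTypeR R => (x + t)%R : measurableTypeR R).

Lemma lebesgue_shift (t : R) (A : set R) : measurable A ->
  pushforward leb (shift t) A = leb A.
Proof.
move=> mA; apply/esym.
have mt : measurable_fun setT (shift t).
  by apply: measurable_funD => //; exact: measurable_cst.
pose m : {measure set (measurableTypeR R) -> \bar R} :=
  pushforward leb (shift t).
apply: (@lebesgue_measure_unique _ (m mt)) => //= _ [[a b]] _ <-.
rewrite /m /pushforward /=.
rewrite (_ : _ @^-1` _ = `](a - t), (b - t)]%classic); last first.
  by apply/seteqP; split => x /=; rewrite !in_itv /= ltrBlDr lerBrDr.
rewrite !lebesgue_measure_itv /= !lte_fin ltrD2r; case: ifP => // _.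
by rewrite -!EFinD; congr EFin; ring.
Qed.

Lemma integral_shift (t : R) (f : R -> \bar R) :
  leb.-integrable setT f ->
  leb.-integrable setT (fun x : R => f (x + t)%R) /\
  (\int[leb]_x f (x + t)%R = \int[leb]_x f x)%E.
Proof.
move=> intf; have mf := measurable_int _ intf.
have mt : measurable_fun setT (shift t).
  by apply: measurable_funD => //; exact: measurable_cst.
have mft : measurable_fun setT (fun x : R => f (x + t)%R).
  exact: (measurableT_comp mf mt).
have intft : leb.-integrable setT (fun x : R => f (x + t)%R).
  apply/integrableP; split => //.
  move/integrableP : intf => [_]; apply: le_lt_trans.
  rewrite le_eqVlt; apply/orP; left; apply/eqP.
  transitivity (\int[pushforward leb (shift t)]_x `|f x|)%E.
    rewrite ge0_integral_pushforward//; exact: measurableT_comp.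
  by apply: eq_measure_integral => //= A mA _; exact: lebesgue_shift.
split => //.
transitivity (\int[pushforward leb (shift t)]_x f x)%E.
  by rewrite integral_pushforward// preimage_setT.
by apply: eq_measure_integral => //= A mA _; exact: lebesgue_shift.
Qed.

(** A probability with Lipschitz density, carried by the interval [[-A, A]]. *)
Variables (m : probability (measurableTypeR R) R) (rho : R -> R) (K A : R).
Hypothesis rho0 : forall x, 0 <= rho x.
Hypothesis rhoK : forall x y, `|rho x - rho y| <= K * `|x - y|.
Hypothesis mrho : forall B : set R, measurable B ->
  m B = (\int[leb]_(x in B) (rho x)%:E)%E.
Hypothesis mA : m [set x | A < `|x|] = 0%E.

Lemma density_cont : continuous rho.
Proof. exact: klip_continuous rhoK. Qed.

Lemma density_meas : measurable_fun setT rho.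
Proof. by apply: continuous_measurable_fun; exact: density_cont. Qed.

Lemma density_int : leb.-integrable setT (EFin \o rho).
Proof.
apply/integrableP; split; first by apply/measurable_EFinP; exact: density_meas.
have -> : (\int[leb]_x `|(EFin \o rho) x| = m setT)%E.
  by rewrite mrho//; apply: eq_integral => x _; rewrite /= ger0_norm.
by rewrite probability_setT ltry.
Qed.

(** The given density is almost everywhere the Radon-Nikodym derivative, to which
    the change of variables formula applies. *)
Lemma Ex_density (f : R -> R) : bmfun (f : measurableTypeR R -> R) ->
  \int[m]_x f x = \int[leb]_x (f x * rho x).
Proof.
move=> bf; congr fine.
have dom : m `<< leb.
  apply/null_content_dominatesP => B mB B0; rewrite mrho//.
  apply: null_set_integral => //; apply: measurable_funTS.
  by apply/measurable_EFinP; exact: density_meas.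
have intf := bm_int m bf.
rewrite -(Radon_Nikodym_change_of_variables dom)//=.
apply: ae_eq_integral => //.
- apply: emeasurable_funM; first by apply/measurable_EFinP; exact: bf.1.
  by apply: (measurable_int leb); exact: Radon_Nikodym_integrable.
- apply/measurable_EFinP; apply: measurable_funM; [exact: bf.1|exact: density_meas].
have : ae_eq leb setT (Radon_Nikodym (charge_of_finite_measure m) leb) (EFin \o rho).
  apply: integral_ae_eq => //.
  - exact: Radon_Nikodym_integrable.
  - by apply/measurable_EFinP; exact: density_meas.
  - by move=> B _ mB; rewrite -Radon_Nikodym_integral//= mrho.
by apply: filterS => x /(_ I) /= + _ => ->; rewrite EFinM.
Qed.

(** By continuity a positive value of [rho] at [x] would give positive mass to a
    ball about [x]. *)
Lemma density_supp x : A < `|x| -> rho x = 0.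
Proof.
move=> Ax; apply/eqP; rewrite eq_le rho0 andbT leNgt; apply/negP => rx.
have : \forall y \near x, rho x / 2 < rho y /\ A < `|y|.
  apply: filterI.
    have /cvgrPdist_lt := @density_cont x => /(_ (rho x / 2)).
    rewrite divr_gt0// => /(_ isT); apply: filterS => y.
    by rewrite ltr_norml => /andP[_]; lra.
  have : `|y| @[y --> x] --> `|x| by exact: cvg_norm.
  by move=> /cvgr_gt; apply.
move=> /nbhs_ballP[r /= r0 rP].
have mB : measurable (ball x r) by exact: measurable_ball.
have : m (ball x r) = 0%E.
  apply/eqP; rewrite eq_le measure_ge0 andbT -mA; apply: le_measure; rewrite ?inE//.
    rewrite [X in measurable X](_ : _ = (@Num.norm _ R) @^-1` `]A, +oo[%classic).
      rewrite -[X in measurable X]setTI; exact: normr_measurable.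
    by apply/seteqP; split => y /=; rewrite in_itv /= andbT.
  by move=> y /rP[].
rewrite mrho// => /eqP; apply/negP; rewrite gt_eqF//.
apply: (@lt_le_trans _ _ (\int[leb]_(y in ball x r) (rho x / 2)%:E)%E).
  rewrite integral_cst//= lebesgue_measure_ball//; last exact: ltW.
  by rewrite -EFinM lte_fin mulr_gt0// ?divr_gt0// mulrn_wgt0.
apply: ge0_le_integral => //.
- by move=> y _; rewrite lee_fin divr_ge0.
- by apply/measurable_EFinP/measurable_funTS; exact: density_meas.
- by move=> y /rP[/ltW]; rewrite lee_fin.
Qed.

(** The integrand is at most [K * `|t|] and vanishes outside the interval
    [[-(`|A| + 1), `|A| + 1]], because [t] is at most 1 in absolute value. *)
Lemma density_shiftL1 t : `|t| <= 1 ->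
  leb.-integrable setT (fun x : R => (`|rho (x + t) - rho x|)%R%:E) /\
  (\int[leb]_x (`|rho (x + t) - rho x|)%R%:E
    <= (K * 2 * (`|A| + 1) * `|t|)%:E)%E.
Proof.
move=> t1.
have K0 : 0 <= K.
  by have := rhoK 1 0; rewrite subr0 normr1 mulr1; apply: le_trans.
have intt : leb.-integrable setT (EFin \o (fun x => rho (x + t) - rho x)).
  have [it _] := @integral_shift t _ density_int.
  exact: (integrableB measurableT it density_int).
have intn := integrable_norm intt.
split; first exact: intn.
pose I := `[- (`|A| + 1), `|A| + 1]%classic : set R.
have mI : measurable I by exact: measurable_itv.
apply: (@le_trans _ _ (\int[leb]_x ((K * `|t|) * \1_I x)%:E)%E).
  apply: ge0_le_integral => //.
  - exact: measurable_int intn.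
  - by apply/measurable_EFinP; apply: measurable_funM => //; exact: measurable_indic.
  move=> x _; rewrite lee_fin indicE.
  case: (boolP (x \in I)) => [_|/negP xI]; rewrite /= ?mulr1 ?mulr0.
    by rewrite (le_trans (rhoK _ _))// addrAC subrr add0r.
  have Ax : `|A| + 1 < `|x|.
    rewrite ltNge; apply/negP => xA; apply: xI; rewrite inE /I /= in_itv /=.
    by rewrite -ler_norml.
  rewrite !density_supp ?subrr ?normr0//.
    by rewrite (le_lt_trans (ler_norm A))// (le_lt_trans _ Ax)// lerDl.
  rewrite (le_lt_trans (ler_norm A))//.
  have := ler_normB (x + t) t; rewrite addrK => xt.
  by rewrite -(ltrD2r 1); rewrite (lt_le_trans Ax)// (le_trans xt)// lerD.
have -> : (\int[leb]_x ((K * `|t|) * \1_I x)%:E =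
    (K * `|t|)%:E * \int[leb]_x (\1_I x)%:E)%E.
  rewrite -ge0_integralZl//.
  - by apply/measurable_EFinP; exact: measurable_indic.
  - by rewrite lee_fin mulr_ge0.
have mIE : lebesgue_measure I = (2 * (`|A| + 1))%:E.
  rewrite /I lebesgue_measure_itv /= lte_fin ifT; last by rewrite gtrN// ltr_wpDl.
  by rewrite -EFinD; congr EFin; ring.
have -> : (\int[leb]_x (\1_I x)%:E = (2 * (`|A| + 1))%:E)%E.
  by rewrite integral_indic// setIT.
by rewrite -EFinM lee_fin le_eqVlt; apply/orP; left; apply/eqP; ring.
Qed.

(** A change of variables carries the translation from [phi], on whose regularity
    nothing is assumed, over to [chi] and to the density. *)
Lemma Ex_density_shift (phi chi : R -> R) (M D t : R) : `|t| <= 1 ->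
  measurable_fun setT phi -> measurable_fun setT chi ->
  (forall x, `|phi x| <= M) -> (forall x, `|chi x| <= 1) ->
  (forall x, `|chi (x - t) - chi x| <= D) ->
  `|\int[m]_x (phi (x + t) * chi x) - \int[m]_x (phi x * chi x)|
     <= M * (D + K * 2 * (`|A| + 1) * `|t|).
Proof.
move=> t1 mphi mchi phiM chi1 chiD.
have M0 : 0 <= M by exact: le_trans (normr_ge0 _) (phiM 0).
have D0 : 0 <= D by exact: le_trans (normr_ge0 _) (chiD 0).
have msh s : measurable_fun setT (fun x : R => x + s).
  by apply: measurable_funD => //; exact: measurable_cst.
have mphit : measurable_fun setT (fun x : R => phi (x + t)).
  exact: (measurableT_comp mphi (msh t)).
have mchit : measurable_fun setT (fun x : R => chi (x - t)).
  exact: (measurableT_comp mchi (msh (- t))).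
have bphi : bmfun phi by split => //; exists M.
have bphit : bmfun (fun x : R => phi (x + t)) by split => //; exists M.
have bchi : bmfun chi by split => //; exists 1.
have intM (f g : R -> R) : bmfun f -> leb.-integrable setT (EFin \o g) ->
    leb.-integrable setT (EFin \o (fun x => f x * g x)).
  move=> [mf [N fN]] ig.
  have := @integrableMr _ _ _ leb setT measurableT f (EFin \o g) mf _ ig.
  by apply; exists N; split; [exact: num_real | move=> x Nx y _; exact: le_trans (ltW Nx)].
rewrite !Ex_density; [|exact: bmM|exact: bmM].
have int1 : leb.-integrable setT (EFin \o (fun x => phi (x + t) * chi x * rho x)).
  by apply: intM; [exact: bmM | exact: density_int].
have int2 : leb.-integrable setT (EFin \o (fun x => phi x * chi x * rho x)).
  by apply: intM; [exact: bmM | exact: density_int].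
have [int1' E1] := @integral_shift (- t) _ int1.
have -> : \int[leb]_x (phi (x + t) * chi x * rho x) =
    \int[leb]_x (phi x * chi (x - t) * rho (x - t)).
  rewrite /Rintegral; congr fine; rewrite -[LHS]E1.
  by apply: eq_integral => x _; rewrite /= subrK.
have int1'' : leb.-integrable setT
    (EFin \o (fun x => phi x * chi (x - t) * rho (x - t))).
  by apply: eq_integrable int1' => // x _ /=; rewrite subrK.
rewrite -RintegralB//.
have intB := integrableB measurableT int1'' int2.
rewrite (le_trans (le_normr_Rintegral _ _))//.
have tN1 : `|- t| <= 1 by rewrite normrN.
have [intr ler] := density_shiftL1 tN1.
have intD : leb.-integrable setT (EFin \o (fun x => D * rho x)).
  by apply: intM; [exact: bm_cst | exact: density_int].
have intr' : leb.-integrable setT (EFin \o (fun x => M * (D * rho x + `|rho (x - t) - rho x|))).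
  apply: intM; first exact: bm_cst.
  exact: (integrableD measurableT intD intr).
apply: (@le_trans _ _ (\int[leb]_x (M * (D * rho x + `|rho (x - t) - rho x|)))).
  apply: le_Rintegral => //.
    exact: (integrable_norm intB).
  move=> x _.
  have -> : phi x * chi (x - t) * rho (x - t) - phi x * chi x * rho x =
    phi x * ((chi (x - t) - chi x) * rho x + chi (x - t) * (rho (x - t) - rho x)).
    by ring.
  rewrite normrM ler_pM// (le_trans (ler_normD _ _))// lerD//.
    by rewrite normrM (ger0_norm (rho0 x)) ler_wpM2r.
  by rewrite normrM ler_piMl.
rewrite RintegralZl//; last exact: (integrableD measurableT intD intr).
rewrite ler_wpM2l// RintegralD// RintegralZl//; last exact: density_int.
have -> : \int[leb]_x rho x = 1.
  by rewrite /Rintegral -mrho// probability_setT.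
rewrite mulr1 lerD2l -lee_fin -[X in _ * X](normrN t) /Rintegral fineK//.
exact: (integrable_fin_num measurableT intr).
Qed.

End Density.

(** * Translation of the noise along a basis vector *)

Section Translation.
Context {R : realType} {E : completeNormedModType R} {ip : {dot E for idfun}}.
Hypothesis normE : induces_norm ip.
Hypothesis sepE : separable E.
Context {d} {Om : measurableType d} {P : probability Om R}.
Context {J : set nat} {e : nat -> E} {b : nat -> R}.
Context {xi : nat -> {RV P >-> R}} {eta : {RV P >-> borel E}}.
Hypothesis ortho : forall i j, J i -> J j -> ip (e i) (e j) = (i == j)%:R.
Hypothesis indep : mutually_independent P J xi.

Definition noise_term (w : Om) (i : nat) : E := (b i * xi i w) *: e i.

Definition noise_sum (n : nat) (w : Om) : E :=
  \sum_(i < n | (i : nat) \in J) noise_term w i.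

Hypothesis eta_sum : {ae P, forall w, noise_sum ^~ w @ \oo --> (eta w : E)}.

Definition others (j n : nat) : seq nat :=
  [seq i <- iota 0 n | (i \in J) && (i != j)].

Definition add_term (i : nat) (p : E * R) : E := p.1 + (b i * p.2) *: e i.

Lemma add_term_cont i : continuous (add_term i).
Proof.
move=> p; apply: cvgD; first exact: cvg_fst.
apply: cvgZr_tmp; apply: cvgM; [exact: cvg_cst|exact: cvg_snd].
Qed.

Lemma measurable_add_term i :
  measurable_fun setT (add_term i : borel E * R -> borel E).
Proof.
have := @pair_borel R _ (borel E * R)%type E R E fst snd (add_term i) sepE
  (@separable_real R).
rewrite (_ : (fun w => _) = add_term i); last by apply/funext => -[].
apply; [exact: measurable_fst| |exact: add_term_cont].
apply/borel_realP; exact: measurable_snd.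
Qed.

Definition others_sum j n : Om -> E :=
  fold_rv (T1 := R) (T2 := borel E) xi (0 : E) add_term (others j n).

Lemma others_sumE j n w :
  others_sum j n w = \sum_(i <- others j n) noise_term w i.
Proof.
rewrite /others_sum; elim: (others j n) => [|i s IH]; first by rewrite big_nil.
by rewrite big_cons /= IH /add_term /= addrC.
Qed.

Lemma noise_sumE j n w : J j -> (j < n)%N ->
  noise_sum n w = others_sum j n w + (b j * xi j w) *: e j.
Proof.
move=> Jj jn; rewrite others_sumE /others.
rewrite /noise_sum -(big_mkord (fun i => i \in J) (noise_term w)) /index_iota subn0.
rewrite -big_filter (bigD1_seq j) ?filter_uniq ?iota_uniq//=; last first.
  by rewrite mem_filter (mem_set Jj) mem_iota.
rewrite addrC; congr (_ + _).
by rewrite -big_filter -filter_predI; congr bigop; apply: eq_filter => i /=; rewrite andbC.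
Qed.

Lemma others_ortho j n w : J j -> ip (others_sum j n w) (e j) = 0.
Proof.
move=> Jj; rewrite others_sumE linear_sumlz big_seq big1// => i.
rewrite mem_filter => /andP[/andP[/set_mem Ji ij] _].
by rewrite /noise_term linearZl_LR /= ortho// (negbTE ij) mulr0.
Qed.

Lemma noise_coord_le j n w : J j -> (j < n)%N ->
  `|b j * xi j w| <= `|noise_sum n w|.
Proof.
move=> Jj jn; rewrite -(ler_pXn2r (n := 2))// ?nnegrE//.
rewrite normE (noise_sumE w Jj jn) hnormDd; last first.
  by rewrite linearZr_LR /= others_ortho// mulr0.
have nn : 0 <= ip (others_sum j n w) (others_sum j n w).
  by have := sqr_ge0 `|others_sum j n w|; rewrite normE.
rewrite linearZl_LR linearZr_LR /= ortho// eqxx mulr1.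
by rewrite -normrX ger0_norm ?sqr_ge0// expr2 lerDr.
Qed.

(** By orthonormality every coordinate of a partial sum is bounded by the norm of
    this sum, hence in the limit by the bound on the noise. This is what confines
    the support of the density of each coordinate. *)
Lemma noise_coord_ae j (B : R) : J j -> b j != 0 ->
  {ae P, forall w, `|(eta w : E)| <= B} ->
  {ae P, forall w, `|xi j w| <= B / `|b j|}.
Proof.
move=> Jj bj etaB; move: eta_sum etaB; apply: filterS2 => w ew Bw.
rewrite ler_pdivlMr ?normr_gt0// mulrC -normrM (le_trans _ Bw)//.
apply: cvgr_to_ge (cvg_norm ew) _.
by near=> n; apply: noise_coord_le => //; near: n; exact: nbhs_infty_gt.
Unshelve. all: by end_near. Qed.

(** Conditionally on the other coordinates, a translation of the noise along a
    basis vector is a shift of a real variable that has a Lipschitz density with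
    bounded support. *)
Section Coordinate.
Variables (j : nat) (rho : R -> R) (K B : R).
Hypotheses (Jj : J j) (bj : b j != 0).
Hypothesis rho0 : forall x, 0 <= rho x.
Hypothesis rhoK : forall x y, `|rho x - rho y| <= K * `|x - y|.
Hypothesis mrho : forall A : set R, measurable A ->
  distribution P (xi j) A = (\int[lebesgue_measure]_(x in A) (rho x)%:E)%E.
Hypothesis etaB : {ae P, forall w, `|(eta w : E)| <= B}.

(** For a partial sum of the noise the coordinate [j] is integrated first, the
    others being frozen, and [Ex_density_shift] applies; the bound does not depend
    on the number of terms and passes to the limit because [phi] and [chi] are
    continuous. *)
Lemma Ex_shift_coord (phi chi : E -> R) (M D s : R) :
  continuous phi -> continuous chi ->
  (forall x, `|phi x| <= M) -> (forall x, `|chi x| <= 1) ->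
  (forall x y, `|chi x - chi y| <= D * `|x - y|) -> `|s| <= `|b j| ->
  `|\int[P]_w (phi (eta w + s *: e j) * chi (eta w))
    - \int[P]_w (phi (eta w) * chi (eta w))|
    <= M * (D + K * 2 * (`|B / `|b j| | + 1) / `|b j|) * `|s|.
Proof.
move=> cphi cchi phiM chi1 chiD sb.
pose c := M * (D + K * 2 * (`|B / `|b j| | + 1) / `|b j|) * `|s|.
rewrite -/c.
have M0 : 0 <= M by exact: le_trans (normr_ge0 _) (phiM 0).
have nej : `|e j| = 1.
  by apply/eqP; rewrite -(@pexpr_eq1 _ _ 2)// normE ortho// eqxx.
have mA : distribution P (xi j) [set x | B / `|b j| < `|x|] = 0%E.
  have mS : measurable [set x : R | B / `|b j| < `|x|].
    rewrite [X in measurable X](_ : _ = (@Num.norm _ R) @^-1` `]B / `|b j|, +oo[%classic).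
      rewrite -[X in measurable X]setTI; exact: normr_measurable.
    by apply/seteqP; split => y /=; rewrite in_itv /= andbT.
  have mS' : measurable (xi j @^-1` [set x : R | B / `|b j| < `|x|]).
    by rewrite -[X in measurable X]setTI; exact: (measurable_funP (xi j)).
  suff : P (xi j @^-1` [set x : R | B / `|b j| < `|x|]) = 0%E by [].
  apply/negligibleP => //.
  apply: negligibleS (noise_coord_ae Jj bj etaB) => w /= xw xw'.
  by move: xw; rewrite ltNge xw'.
(* Both integrals are values of one function of the translation, [s] or [0]. *)
pose F s (y : E) := phi (y + s *: e j) * chi y.
have cF s' : continuous (F s').
  move=> y; apply: cvgM; last exact: cchi.
  apply: (@continuous_comp _ _ _ (fun y => y + s' *: e j) phi); last exact: cphi.
  by apply: cvgD; [exact: cvg_id | exact: cvg_cst].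
have FM s' y : `|F s' y| <= M.
  by rewrite /F normrM -[leRHS]mulr1 ler_pM.
have mns n : measurable_fun setT (noise_sum n : Om -> borel E).
  elim: n => [|n IH].
    rewrite (_ : noise_sum 0 = cst (0 : E)); first exact: measurable_cst.
    by apply/funext => w; rewrite /noise_sum big_ord0.
  have [Jn|Jn] := boolP (n \in J); last first.
    rewrite (_ : noise_sum n.+1 = noise_sum n)//.
    apply/funext => w; rewrite /noise_sum big_mkcond big_ord_recr /= (negbTE Jn).
    by rewrite addr0 -big_mkcond.
  rewrite (_ : noise_sum n.+1 = fun w => add_term n (noise_sum n w, xi n w)).
    exact: (measurableT_comp (measurable_add_term n)
      (measurable_fun_pair IH (measurable_funP (xi n)))).
  apply/funext => w; rewrite /noise_sum big_mkcond big_ord_recr /= Jn.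
  by rewrite -big_mkcond.
have mF s' : measurable_fun setT (F s' : borel E -> R).
  exact: continuous_borelR.
have cv s' : (fun n => \int[P]_w F s' (noise_sum n w)) @ \oo -->
    \int[P]_w F s' (eta w).
  apply: (@Ex_cvg _ _ _ P _ _ M) => //.
  - by move=> n; exact: (measurableT_comp (mF s') (mns n)).
  - exact: (measurableT_comp (mF s') (measurable_funP eta)).
  move: eta_sum; apply: filterS => w ew.
  by apply: continuous_cvg => //; exact: cF.
have cvd : (fun n => `|\int[P]_w F s (noise_sum n w) - \int[P]_w F 0 (noise_sum n w)|)
    @ \oo --> `|\int[P]_w F s (eta w) - \int[P]_w F 0 (eta w)|.
  by apply: cvg_norm; apply: cvgB; exact: cv.
have -> : \int[P]_w (phi (eta w) * chi (eta w)) = \int[P]_w F 0 (eta w).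
  by apply: eq_Rintegral => w _; rewrite /F scale0r addr0.
refine (cvgr_to_le cvd _).
near=> n.
have jn : (j < n)%N by near: n; exact: nbhs_infty_gt.
pose G s' (p : borel E * R) := F s' (add_term j p).
have mG s' : bmfun (G s').
  split; last by exists M => p; exact: FM.
  exact: (measurableT_comp (mF s') (measurable_add_term j)).
have EG s' : \int[P]_w F s' (noise_sum n w) =
    \int[P]_w \int[distribution P (xi j)]_x G s' (others_sum j n w, x).
  transitivity (\int[P]_w G s' (others_sum j n w, xi j w)).
    by apply: eq_Rintegral => w _; rewrite /G /= /add_term/= (noise_sumE _ Jj jn).
  have H := @Ex_fold_rv _ Om R P _ _ R (borel E) nat J xi indep (0:E) add_term measurable_add_term (others j n) j (G s'). apply: H => //.
  - by rewrite filter_uniq// iota_uniq.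
  - by move=> i; rewrite mem_filter => /andP[/andP[/set_mem]].
  - by rewrite mem_filter eqxx andbF.
have mos : measurable_fun setT (others_sum j n : Om -> borel E).
  by apply: measurable_fold_rv; exact: measurable_add_term.
have bm s' : bmfun (fun w => \int[distribution P (xi j)]_x G s' (others_sum j n w, x)).
  exact: (bm_comp (bm_Ex (distribution P eta) _ (mG s')) mos).
rewrite /= !EG -ExB//.
apply: Ex_bound => [|w]; first by apply: measurable_funB; [exact: (bm s).1|exact: (bm 0).1].
set y := others_sum j n w.
pose f x := phi (y + (b j * x) *: e j).
pose g x := chi (y + (b j * x) *: e j).
have cl : continuous (fun x : R => y + (b j * x) *: e j).
  move=> x; apply: cvgD; first exact: cvg_cst.
  by apply: cvgZr_tmp; apply: cvgM; [exact: cvg_cst|exact: cvg_id].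
have -> : \int[distribution P (xi j)]_x G s (y, x) =
    \int[distribution P (xi j)]_x (f (x + s / b j) * g x).
  apply: eq_Rintegral => x _; rewrite /G /F /f /g /add_term /=.
  by rewrite mulrDr mulrCA divff// mulr1 scalerDl addrA.
have -> : \int[distribution P (xi j)]_x G 0 (y, x) =
    \int[distribution P (xi j)]_x (f x * g x).
  by apply: eq_Rintegral => x _; rewrite /G /F /f /g /add_term /= scale0r addr0.
have mxR : measurable_fun setT (xi j : Om -> measurableTypeR R).
  exact: (measurable_funP (xi j)).
pose xR : {mfun Om >-> measurableTypeR R} :=
  HB.pack (xi j : Om -> R) (isMeasurableFun.Build _ _ _ _ _ mxR).
have mf : measurable_fun setT f.
  apply: continuous_measurable_fun => x.
  by apply: continuous_comp; [exact: cl|exact: cphi].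
have mg : measurable_fun setT g.
  apply: continuous_measurable_fun => x.
  by apply: continuous_comp; [exact: cl|exact: cchi].
have fM x : `|f x| <= M by exact: phiM.
have g1 x : `|g x| <= 1 by exact: chi1.
have gD x : `|g (x - s / b j) - g x| <= D * `|s|.
  rewrite (le_trans (chiD _ _))//.
  rewrite opprD addrACA subrr add0r -scalerBl mulrBr addrAC subrr add0r.
  by rewrite normrZ nej mulr1 normrN mulrCA divff// mulr1.
have sb1 : `|s / b j| <= 1.
  by rewrite normrM normfV ler_pdivrMr ?normr_gt0// mul1r.
have bf : bmfun f by split => //; exists M.
have bg : bmfun g by split => //; exists 1.
have bfs : bmfun (fun x : R => f (x + s / b j)).
  by apply: (bm_comp bf); apply: measurable_funD => //; exact: measurable_cst.
have ER (h : R -> R) : bmfun h ->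
    \int[distribution P (xi j)]_x h x = \int[distribution P xR]_x h x.
  by move=> bh; rewrite !Ex_pushforward.
rewrite !ER; [|exact: bmM|exact: bmM].
apply: le_trans.
  exact: (@Ex_density_shift _ (distribution P xR) rho K (B / `|b j|)
    rho0 rhoK mrho mA f g M (D * `|s|) (s / b j)).
by rewrite /c (normrM s) (normfV (b j)) le_eqVlt; apply/orP; left; apply/eqP; ring.
Unshelve. all: by end_near. Qed.

End Coordinate.
End Translation.

(** * Strict differentiability *)

Section StrictDifferentiability.
Context {R : realType}.

(** The mean value inequality: the bound [`|G t - G 0| <= c * t] is closed in [t],
    and the local hypothesis extends it past any time [t < 1], so the supremum of
    these times is 1. *)
Lemma mean_value_le (W : normedModType R) (G : R -> W) (c : R) : 0 <= c ->
  (forall t, 0 <= t <= 1 ->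
    \forall s \near (0 : R), `|G (t + s) - G t| <= c * `|s|) ->
  `|G 1 - G 0| <= c.
Proof.
move=> c0 H.
pose A : set R := [set t | 0 <= t <= 1 /\ `|G t - G 0| <= c * t].
have A0 : A 0 by split; rewrite ?lexx ?ler01// subrr normr0 mulr0.
have ubA : ubound A 1 by move=> t [/andP[]].
have supA : has_sup A by split; [exists 0 | exists 1].
pose t := sup A.
have t01 : 0 <= t <= 1.
  apply/andP; split; first by apply: sup_upper_bound.
  by apply: ge_sup => //; exists 0.
have /nbhs_norm0P[r /= r0 Hr] := H t t01.
have At : `|G t - G 0| <= c * t.
  have [a Aa ta] := sup_adherent r0 supA.
  have at' : a <= t by exact: sup_upper_bound.
  have [_ Ga] := Aa.
  have /Hr : `|a - t| < r by rewrite distrC ger0_norm ?subr_ge0// ltrBlDr -ltrBlDl.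
  rewrite addrCA subrr addr0 distrC distrC => Gta.
  rewrite -(subrK (G a) (G t)) -addrA (le_trans (ler_normD _ _))//.
  rewrite distrC (le_trans (lerD Gta Ga))// distrC ger0_norm ?subr_ge0//.
  by rewrite -mulrDr subrK.
have [t1|t1] := leP 1 t.
  have E1 : t = 1 by apply/eqP; rewrite eq_le t1; case/andP: t01 => _ ->.
  by move: At; rewrite E1 mulr1.
pose s := Num.min (r / 2) (1 - t).
have s0 : 0 < s by rewrite lt_min divr_gt0//= subr_gt0.
have sr : `|s| < r.
  by rewrite gtr0_norm// gt_min ltr_pdivrMr// ltr_pMr// ltr1n.
have := Hr _ sr; rewrite gtr0_norm// => Gs.
have : A (t + s).
  split.
    case/andP: t01 => t0 _; apply/andP; split; first by rewrite addr_ge0// ltW.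
    by rewrite -lerBrDl ge_min lexx orbT.
  rewrite -(subrK (G t) (G (t + s))) -addrA (le_trans (ler_normD _ _))//.
  by rewrite (le_trans (lerD Gs At))// -mulrDr addrC.
move/(sup_upper_bound supA); rewrite -/t gerDl leNgt s0//.
Qed.

Lemma mul1tupE (U : normedModType R) (h : U) :
  \prod_(i < 1) `|tnth [tuple h] i| = `|h|.
Proof. by rewrite big_ord1 (tnth_nth 0). Qed.

Section FrechetC1.
Context {U W : normedModType R} {f : U -> W} {n : nat}.
Context {D : forall j, U -> j.-tuple U -> W}.
Hypothesis n0 : (0 < n)%N.
Hypothesis fD : frechet_derivatives n f D.
Hypothesis contD : opnorm_continuous (@D 1%N).

Definition deriv1 (x h : U) : W := @D 1%N x [tuple h].

Lemma deriv1_linear x : linear (deriv1 x).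
Proof.
move=> a u v; have [_ /(_ 1%N x n0)[+ _] _] := fD.
move=> /(_ ord0 [tuple 0] a u v); rewrite /deriv1.
suff E (w : U) : tuple_upd [tuple 0] ord0 w = [tuple w] :> 1.-tuple U by rewrite !E.
by apply: eq_from_tnth => i; rewrite tnth_mktuple ord1 eqxx (tnth_nth 0).
Qed.

Lemma deriv1_bounded x : exists M, forall h, `|deriv1 x h| <= M * `|h|.
Proof.
have [_ /(_ 1%N x n0)[_ [M HM]] _] := fD.
by exists M => h; rewrite /deriv1 (le_trans (HM _))// mul1tupE.
Qed.

Lemma deriv1P x (e : R) : 0 < e -> \forall h \near (0 : U),
  `|f (x + h) - f x - deriv1 x h| <= e * `|h|.
Proof.
move=> e0; have [f0 _ /(_ 0%N x n0 e e0)] := fD.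
apply: filterS => h /(_ [tuple]); rewrite big_ord0 mulr1 !f0 /deriv1.
by rewrite (_ : [tuple of h :: [tuple]] = [tuple h])//; apply: val_inj.
Qed.

Lemma deriv1_cont x (e : R) : 0 < e -> \forall y \near x,
  forall h, `|deriv1 y h - deriv1 x h| <= e * `|h|.
Proof.
move=> e0; have := contD x e0; apply: filterS => y H h.
by rewrite (le_trans (H _))// mul1tupE.
Qed.

(** A continuous derivative is strict: along the segment from [z] to [y], the
    derivative of [f] minus its linearization at [x] is small, and the mean value
    inequality integrates this bound. *)
Lemma strict_deriv1 x (e : R) : 0 < e -> exists2 r, 0 < r &
  forall y z, `|y - x| < r -> `|z - x| < r ->
    `|f y - f z - deriv1 x (y - z)| <= e * `|y - z|.
Proof.
move=> e0; have e20 : 0 < e / 2 by rewrite divr_gt0.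
have /nbhs_normP[r /= r0 Hr] := deriv1_cont x e20.
exists r => // y z yx zx.
pose p t := z + t *: (y - z).
have linD := deriv1_linear x.
have L0 : deriv1 x 0 = 0.
  have := linD (-1) 0 0; rewrite scaler0 addr0 scaleN1r => ->.
  by rewrite addNr.
have DE a (h : U) : deriv1 x (a *: h) = a *: deriv1 x h.
  by have := linD a h 0; rewrite addr0 L0 addr0.
pose G t := f (p t) - t *: deriv1 x (y - z).
have -> : f y - f z - deriv1 x (y - z) = G 1 - G 0.
  rewrite /G /p !scale1r !scale0r addr0 subr0 subrKC.
  by rewrite addrAC.
have [yz0|yz0] := eqVneq (y - z) 0.
  by rewrite /G /p yz0 L0 !scaler0 !subrr !normr0 mulr0.
apply: mean_value_le => [|t /andP[t0 t1]]; first by rewrite mulr_ge0// ltW.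
have px : `|x - p t| < r.
  have -> : x - p t = (1 - t) *: (x - z) + t *: (x - y).
    rewrite /p [in RHS]scalerBl scale1r -[in RHS]addrA -[X in _ + (X + _)]scalerN.
    by rewrite -scalerDr opprB addrA subrK opprD addrA -scalerN opprB.
  have t1' : 0 <= 1 - t by rewrite subr_ge0.
  rewrite (le_lt_trans (ler_normD _ _))// !normrZ (ger0_norm t0) (ger0_norm t1').
  rewrite (distrC x z) (distrC x y).
  have [->|tn0] := eqVneq t 0; first by rewrite subr0 mul1r mul0r addr0.
  have tp : 0 < t by rewrite lt_neqAle eq_sym tn0.
  apply: (@lt_le_trans _ _ ((1 - t) * r + t * r)); last by rewrite -mulrDl subrK mul1r.
  by apply: ler_ltD; [rewrite ler_wpM2l// ltW | rewrite ltr_pM2l].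
have /nbhs_norm0P[q /= q0 Hq] := deriv1P (p t) e20.
have yzp : 0 < `|y - z| by rewrite normr_gt0.
apply/nbhs_norm0P; exists (q / `|y - z|) => /=; first by rewrite divr_gt0.
move=> s; rewrite /= ltr_pdivlMr// -normrZ => sq.
have ptE : p (t + s) = p t + s *: (y - z) by rewrite /p scalerDl addrA.
have -> : G (t + s) - G t = (f (p t + s *: (y - z)) - f (p t)
    - deriv1 (p t) (s *: (y - z))) +
    (deriv1 (p t) (s *: (y - z)) - deriv1 x (s *: (y - z))).
  rewrite /G ptE addrA subrK DE scalerDl opprB opprD -!addrA; congr (_ + _).
  by rewrite [X in _ + X]addrCA addKr addrC.
rewrite (le_trans (ler_normD _ _))// (le_trans (lerD (Hq _ sq) (Hr _ px _)))//.
by rewrite -mulrDl -splitr normrZ mulrCA mulrC.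
Qed.

End FrechetC1.
End StrictDifferentiability.

Section Control.
Context {R : realType}.

Lemma bounded_by (U : normedModType R) (A : set U) (M : R) :
  (forall x, A x -> `|x| <= M) -> bounded_set A.
Proof.
move=> AM; exists M; split; first exact: num_real.
by move=> N MN x Ax /=; rewrite (le_trans (AM _ Ax))// ltW.
Qed.

Lemma compact_norm_le (U : normedModType R) (A : set U) : compact A ->
  exists2 M, 0 < M & forall x, A x -> `|x| <= M.
Proof.
move=> /compact_bounded/pinfty_ex_gt0[M M0 HM]; exists M => //.
Qed.

Lemma linear_norm_le (U W : normedModType R) (T : {linear U -> W}) (M : R) :
  (forall v, `|v| <= 1 -> `|T v| <= M) -> forall v, `|T v| <= M * `|v|.
Proof.
move=> TM v; have [->|v0] := eqVneq v 0; first by rewrite linear0 !normr0 mulr0.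
have nv0 : 0 < `|v| by rewrite normr_gt0.
rewrite -ler_pdivrMr// mulrC.
have := TM (`|v|^-1 *: v); rewrite linearZ !normrZ normfV normr_id mulVf ?gt_eqF//.
exact.
Qed.

Context {H E V : completeNormedModType R}.

Lemma compact_embedding_bounded (iota : {linear V -> H}) :
  compact_embedding iota -> exists2 M, 0 < M & forall v, `|iota v| <= M * `|v|.
Proof.
move=> [_ /(_ [set v : V | `|v| <= 1])].
have b1 : bounded_set [set v : V | `|v| <= 1] by exact: (bounded_by (M := 1)).
move=> /(_ b1); rewrite precompactE => /compact_norm_le[M M0 HM].
exists M => //; apply: linear_norm_le => v v1.
by apply: HM; apply: subset_closure; exists v.
Qed.

(** What the proof uses of the smoothness of [S]: a linearization [L] at [p]
    that is strict, in the sense that it controls increments between any two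
    points close to [p], and compact in the first variable. *)
Definition strict_linearization (S : H * E -> H) (p : H * E)
    (L : H * E -> H) :=
  [/\ exists2 M, 0 < M & forall h, `|L h| <= M * `|h|,
      forall e, 0 < e -> exists2 r, 0 < r & forall y z : H * E,
        `|y - p| < r -> `|z - p| < r -> `|S y - S z - L (y - z)| <= e * `|y - z|
    & compact (closure [set L (h, 0) | h in [set h : H | `|h| <= 1]])].

Lemma prod_norm_pairl (h : H) : `|((h, 0) : H * E)| = `|h|.
Proof. by rewrite prod_normE /= normr0; apply/max_idPl. Qed.

Lemma prod_norm_pairr (w : E) : `|((0, w) : H * E)| = `|w|.
Proof. by rewrite prod_normE /= normr0; apply/max_idPr. Qed.

(** The strict derivative of the [V]-valued map, composed with the embedding. The
    derivative maps the unit ball to a bounded subset of [V], which is precompact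
    in [H]. *)
Lemma smooth_strict_linearization (iota : {linear V -> H}) (S : H * E -> H)
    (SV : H * E -> V) :
  compact_embedding iota -> (forall p, S p = iota (SV p)) -> C2_bounded SV ->
  forall p, exists2 L : {linear (H * E)%type -> H},
    strict_linearization S p L &
    forall w : E, L ((0, w) : H * E) = 'd (fun y : E => S (p.1, y)) (p.2 : E) w.
Proof.
move=> iotaP SE [D [fD DC]] p.
have [Mi Mi0 HMi] := compact_embedding_bounded iotaP.
have [cD _] := DC 1%N isT.
have linD := deriv1_linear (isT : (0 < 2)%N) fD p.
pose L0 h := iota (deriv1 (D := D) p h).
have linL0 : linear L0 by move=> a u v; rewrite /L0 linD linearP.
pose L : {linear (H * E)%type -> H} := HB.pack L0 (GRing.isLinear.Build _ _ _ _ L0 linL0).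
have [M1 HM1] := deriv1_bounded (isT : (0 < 2)%N) fD p.
have bL h : `|L h| <= Mi * (`|M1| + 1) * `|h|.
  rewrite /L /= /L0 (le_trans (HMi _))// -mulrA ler_wpM2l ?(ltW Mi0)//.
  by rewrite (le_trans (HM1 _))// ler_wpM2r// (le_trans (ler_norm M1))// lerDl.
have strictL e : 0 < e -> exists2 r, 0 < r & forall y z : H * E,
    `|y - p| < r -> `|z - p| < r -> `|S y - S z - L (y - z)| <= e * `|y - z|.
  move=> e0; have e1 : 0 < e / Mi by rewrite divr_gt0.
  have [r r0 Hr] := strict_deriv1 (isT : (0 < 2)%N) fD cD p e1.
  exists r => // y z yp zp; rewrite !SE /L /= /L0 -!linearB.
  rewrite (le_trans (HMi _))// -ler_pdivlMl// mulrA (mulrC Mi^-1).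
  exact: Hr.
exists L.
  split => //.
    by exists (Mi * (`|M1| + 1)) => //; rewrite mulr_gt0// ltr_wpDl.
  rewrite -precompactE.
  have := iotaP.2 [set v : V | `|v| <= `|M1| + 1].
  have b1 : bounded_set [set v : V | `|v| <= `|M1| + 1].
    exact: (bounded_by (M := `|M1| + 1)).
  move=> /(_ b1); apply: precompact_subset => _ [h /= h1 <-].
  exists (deriv1 (D := D) p (h, 0)) => //=.
  rewrite (le_trans (HM1 _))// prod_norm_pairl.
  rewrite (le_trans (ler_wpM2r (normr_ge0 _) (ler_norm M1)))//.
  by rewrite (le_trans (ler_wpM2l (normr_ge0 M1) h1))// mulr1 lerDl.
have linLE : linear (fun w : E => L ((0, w) : H * E)).
  move=> a u v; rewrite -linearP; congr (L _).
  by apply/eqP; rewrite xpair_eqE /= scaler0 addr0 !eqxx.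
pose LE : {linear E -> H} := HB.pack (fun w : E => L ((0, w) : H * E))
  (GRing.isLinear.Build _ _ _ _ (fun w : E => L ((0, w) : H * E)) linLE).
move=> w0; rewrite (_ : L (0, w0) = LE w0)//; congr (_ w0).
apply/esym; apply: (@diff_unique _ _ _ _ LE).
  apply: bounded_linear_continuous; apply/linear_boundedP.
  exists (Mi * (`|M1| + 1)); split; first exact: num_real.
  move=> r Hr x; rewrite /LE /= (le_trans (bL _))// prod_norm_pairr.
  by rewrite ler_wpM2r// ltW.
apply/eqaddoP => e e0.
have [r r0 Hr] := strictL e e0.
apply/nbhs_norm0P; exists r => //= w wr.
have := Hr (p.1, w + p.2) p; rewrite subrr normr0.
have -> : (p.1, w + p.2) - p = (0, w).
  by case: (p) => a b; apply/eqP; rewrite xpair_eqE /= subrr addrK !eqxx.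
rewrite prod_norm_pairr => /(_ wr r0).
have -> : S p = S (p.1, p.2) by case: (p).
by rewrite -addrA -opprD.
Qed.

End Control.

(** * Compensating a change of state by a translation of the noise *)

Section LocalControl.
Context {R : realType} {H E : completeNormedModType R}.
Variables (J : set nat) (e : nat -> E).

(** The perturbations of the noise that are used: finite combinations of basis
    vectors, with the same set of indices as the sums of the noise. *)
Definition comb (n : nat) (s : nat -> R) : E :=
  \sum_(i < n | (i : nat) \in J) s i *: e i.

Hypothesis e1 : forall i, J i -> `|e i| <= 1.

Lemma comb_norm n s (B : R) : 0 <= B -> (forall i, `|s i| <= B) ->
  `|comb n s| <= n%:R * B.
Proof.
move=> B0 sB; rewrite (le_trans (ler_norm_sum _ _ _))//.
rewrite (@le_trans _ _ (\sum_(i < n) B))//; last by rewrite sumr_const card_ord mulr_natl.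
rewrite big_mkcond/=; apply: ler_sum => i _; case: ifPn => // /set_mem Ji.
by rewrite normrZ -[leRHS]mulr1 ler_pM// e1.
Qed.

Lemma combZ n s (t : R) : t *: comb n s = comb n (fun i => t * s i).
Proof. by rewrite /comb scaler_sumr; apply: eq_bigr => i _; rewrite scalerA. Qed.

Lemma comb_widen n m s : (n <= m)%N ->
  comb n s = comb m (fun i => if (i < n)%N then s i else 0).
Proof.
move=> nm; rewrite /comb (big_ord_widen_cond _ (fun i => i \in J) (fun i => s i *: e i) nm).
rewrite [LHS]big_mkcond [RHS]big_mkcond /=; apply: eq_bigr => i _.
by case: (_ \in _) => //=; case: ifP => //; rewrite scale0r.
Qed.

Hypothesis span_dense :
  dense [set x : E | exists n (c : nat -> R), x = comb n c].

Variables (S : H * E -> H) (p : H * E) (L : {linear (H * E)%type -> H}).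
Hypothesis SL : strict_linearization S p L.

Lemma pair_linE (h : H) (w : E) : L (h, w) = L (h, 0) + L (0, w).
Proof.
rewrite -linearD; congr (L _); apply/eqP.
by rewrite xpair_eqE /= addr0 add0r !eqxx.
Qed.

(** Each direction produced by perturbing the state is approximated by
    perturbations of the noise, by density of the image of the partial derivative
    and of the finite combinations. These directions form a precompact set, so that
    finitely many coordinates and bounded coefficients suffice for all of them. One
    integer [n] bounds both the number of coordinates and the coefficients. *)
Lemma finite_control (eps : R) : 0 < eps ->
  dense (range (fun w : E => L (0, w))) ->
  exists n, forall h : H, `|h| <= 1 -> exists c : nat -> R,
    (forall i, `|c i| <= n%:R) /\ `|L (h, 0) - L (0, comb n c)| <= eps.
Proof.
move=> eps0 Ld.
have [[M M0 LM] _ /compact_near_coveringP cC] := SL.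
pose Q (n : nat) (y : H) := exists c : nat -> R,
  (forall i, `|c i| <= n%:R) /\ `|y - L (0, comb n c)| <= eps.
have /(cC _ \oo Q) : forall y : H,
    closure [set L (h, 0) | h in [set h : H | `|h| <= 1]] y ->
    \forall y' \near y & n \near \oo, Q n y'.
  move=> y _.
  have e3 : 0 < eps / 3 by rewrite divr_gt0.
  have [y0 [/= y1 [w _ wy]]] : ball y (eps / 3) `&` range (fun w : E => L (0, w)) !=set0.
    by apply: Ld; [exists y; exact: ballxx|exact: ball_open].
  rewrite -{}wy in y1.
  have e3M : 0 < eps / 3 / M by rewrite divr_gt0.
  have [w0 [/= w1 [n [c wc]]]] : ball w (eps / 3 / M) `&`
      [set x : E | exists n (c : nat -> R), x = comb n c] !=set0.
    by apply: span_dense; [exists w; exact: ballxx|exact: ball_open].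
  rewrite {}wc in w1.
  have [B HB] : exists B : nat, forall i, `|if (i < n)%N then c i else 0| <= B%:R.
    pose B := \sum_(i < n) `|c i|.
    have B0 : 0 <= B by exact: sumr_ge0.
    exists (Num.truncn B).+1 => i; case: ifP => [ni|]; last by rewrite normr0.
    rewrite (@le_trans _ _ B)//; last by apply/ltW; rewrite truncnS_gt.
    by rewrite /B (bigD1 (Ordinal ni))//= lerDl sumr_ge0.
  have yn : \forall y' \near y, `|y - y'| < eps / 3.
    by apply: filterS (nbhsx_ballx y _ e3) => z; rewrite -ball_normE.
  near=> y' m => /=.
  have nm : (n <= m)%N by near: m; exact: nbhs_infty_ge.
  exists (fun i => if (i < n)%N then c i else 0); split.
    move=> i; rewrite (le_trans (HB i))// ler_nat.
    by near: m; exact: nbhs_infty_ge.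
  rewrite -comb_widen//.
  have -> : y' - L (0, comb n c) = (y' - y) + (y - L (0, w)) + L (0, w - comb n c).
    rewrite addrA subrK; have -> : ((0, w - comb n c) : H * E) = (0, w) - (0, comb n c).
      by apply/eqP; rewrite xpair_eqE /= subr0 !eqxx.
    by rewrite linearB addrA subrK.
  rewrite (le_trans (ler_normD _ _))//.
  have -> : eps = eps / 3 + eps / 3 + eps / 3 by field.
  apply: lerD; last first.
    rewrite (le_trans (LM _))// prod_norm_pairr -ler_pdivlMl// mulrC.
    by apply: ltW; move: w1; rewrite -ball_normE.
  rewrite (le_trans (ler_normD _ _))//; apply: lerD; last first.
    by apply: ltW; move: y1; rewrite -ball_normE.
  by rewrite distrC; apply: ltW; near: y'.
move=> [n _ /(_ n (leqnn n)) Hn]; exists n => h h1.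
by apply: Hn; apply: subset_closure; exists h.
Unshelve. all: by end_near. Qed.

(** The effect of changing the state from [u] to [v] is imitated, up to the factor
    [kap], by a translation of the noise of size proportional to [`|u - v|]. By
    strictness of the linearization the translation can be chosen the same for all
    noises [z] near [p.2]: it is therefore a rigid translation of the law, not a
    change of variables, that has to be estimated afterwards. *)
Lemma local_control (kap : R) : 0 < kap ->
  dense (range (fun w : E => L (0, w))) ->
  exists n r, 0 < r /\ forall u v, `|u - p.1| < r -> `|v - p.1| < r ->
    exists s : nat -> R, (forall i, `|s i| <= n%:R * `|u - v|) /\
      forall z, `|z - p.2| < r ->
        `|S (v, z) - S (u, z + comb n s)| <= kap * `|u - v|.
Proof.
move=> kap0 Ld; have kap20 : 0 < kap / 2 by rewrite divr_gt0.
have [n Hn] := finite_control kap20 Ld.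
have [[M M0 LM] strictS _] := SL.
(* [B] bounds the norm of the increment of [S]'s argument, relative to [`|u - v|]. *)
pose B : R := 1 + n%:R * n%:R.
have B1 : 1 <= B by rewrite lerDl mulr_ge0.
have B0 : 0 < B by exact: lt_le_trans B1.
have eps0 : 0 < kap / 2 / B by rewrite divr_gt0.
have [r r0 Hr] := strictS _ eps0.
have B20 : 0 < 2 * B by rewrite mulr_gt0.
exists n, (r / (2 * B)); split; first by rewrite divr_gt0.
move=> u v up vp.
have B2 : r / (2 * B) <= r / 2.
  by rewrite ler_wpM2l ?(ltW r0)// lef_pV2 ?posrE// ler_peMr.
have r2r : r / 2 <= r by lra.
have [uv|uv] := eqVneq u v.
  exists (fun=> 0); split=> [i|z zp]; first by rewrite normr0 mulr_ge0.
  rewrite uv (_ : comb n _ = 0) ?addr0 ?subrr ?normr0 ?mulr0//.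
  by rewrite /comb big1// => i _; rewrite scale0r.
pose t := `|u - v|.
have t0 : 0 < t by rewrite normr_gt0 subr_eq0.
have tr : t < 2 * (r / (2 * B)).
  rewrite /t -(subrK p.1 u) -addrA (le_lt_trans (ler_normD _ _))//.
  by rewrite mulr2n mulrDl mul1r ltrD// distrC.
have h1 : `|t^-1 *: (v - u)| <= 1.
  by rewrite normrZ normfV distrC /t normr_id mulVf ?normr_eq0 ?subr_eq0.
have [c [cn Hc]] := Hn _ h1.
exists (fun i => t * c i); split=> [i|z zp].
  by rewrite normrM mulrC (gtr0_norm t0) ler_pM2r.
rewrite -combZ; set w := comb n c in Hc *.
have wn : `|w| <= n%:R * n%:R by apply: comb_norm.
have vzp : `|((v, z) : H * E) - p| < r.
  rewrite prod_normE /= gt_max (lt_le_trans vp) ?(lt_le_trans zp)//.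
    exact: le_trans B2 r2r.
  exact: le_trans B2 r2r.
have uzp : `|((u, z + t *: w) : H * E) - p| < r.
  rewrite prod_normE /= gt_max (lt_le_trans up)/=; last first.
    exact: le_trans B2 r2r.
  rewrite addrAC (le_lt_trans (ler_normD _ _))// normrZ (gtr0_norm t0).
  have twn : t * `|w| <= t * (n%:R * n%:R) by rewrite ler_pM2l.
  have rE : r = 2 * (r / (2 * B)) + 2 * (r / (2 * B)) * (n%:R * n%:R).
    by rewrite -[X in X + _]mulr1 -mulrDr -/B; field; rewrite gt_eqF.
  have q0 : 0 < r / (2 * B) by rewrite divr_gt0.
  have twq : t * (n%:R * n%:R) <= 2 * (r / (2 * B)) * (n%:R * n%:R).
    by rewrite ler_wpM2r ?mulr_ge0// ltW.
  rewrite [ltRHS]rE; lra.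
have duz : ((v, z) : H * E) - (u, z + t *: w) = (v - u, - (t *: w)).
  by apply/eqP; rewrite xpair_eqE /= opprD addrA subrr add0r !eqxx.
have LE : L ((v, z) - (u, z + t *: w)) = t *: (L (t^-1 *: (v - u), 0) - L (0, w)).
  have E1 : ((v - u, 0) : H * E) = t *: (t^-1 *: (v - u), 0).
    apply/eqP.
    by rewrite xpair_eqE /= scaler0 scalerA divff ?gt_eqF// scale1r !eqxx.
  have E2 : ((0, - (t *: w)) : H * E) = (- t) *: (0, w).
    by apply/eqP; rewrite xpair_eqE /= scaler0 scaleNr !eqxx.
  by rewrite duz pair_linE E1 E2 !linearZ /= scaleNr [RHS]scalerBr.
have := Hr _ _ vzp uzp; rewrite LE => Hs.
rewrite -(subrK (t *: (L (t^-1 *: (v - u), 0) - L (0, w))) (_ - S (u, _))).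
rewrite (le_trans (ler_normD _ _))// (le_trans (lerD Hs (lexx _)))//.
rewrite normrZ (gtr0_norm t0) duz.
have dn : `|((v - u, - (t *: w)) : H * E)| <= t * B.
  rewrite prod_normE /= ge_max normrN normrZ (gtr0_norm t0) distrC -/t.
  rewrite -{1}[t]mulr1 !ler_pM2l// B1 /=.
  by rewrite (le_trans wn)// lerDr.
rewrite (@le_trans _ _ (kap / 2 / B * (t * B) + t * (kap / 2)))//.
  by apply: lerD; [rewrite ler_pM2l | rewrite ler_pM2l].
have -> : kap / 2 / B * (t * B) + t * (kap / 2) = kap * t; last by [].
by field; rewrite gt_eqF.
Qed.

Lemma local_lip : exists2 r, 0 < r & exists2 C, 0 < C & forall y z : H * E,
  `|y - p| < r -> `|z - p| < r -> `|S y - S z| <= C * `|y - z|.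
Proof.
have [[M M0 LM] strictS _] := SL.
have [r r0 Hr] := strictS 1 ltr01.
exists r => //; exists (1 + M); first by rewrite addr_gt0.
move=> y z yp zp; rewrite -(subrK (L (y - z)) (S y - S z)).
by rewrite (le_trans (ler_normD _ _))// mulrDl lerD// ?Hr.
Qed.

End LocalControl.

(** * The Lasota-Yorke inequality *)

Section CombShift.
Context {R : realType} {E : completeNormedModType R}.
Variables (J : set nat) (e : nat -> E) (l : probability (borel E) R).

(** Since [phi] is merely bounded, this is a bound, linear in [s], on the total
    variation distance between the law localized by [chi] and its translate by
    [s *: v]. It is the smoothing supplied by the Lipschitz densities. *)
Definition shift_stable (v : E) (C c : R) :=
  forall (phi chi : E -> R) (M D s : R),
  continuous phi -> continuous chi ->
  (forall x, `|phi x| <= M) -> (forall x, `|chi x| <= 1) -> klip D chi ->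
  `|s| <= c ->
  `|\int[l]_z (phi (z + s *: v) * chi z) - \int[l]_z (phi z * chi z)|
    <= M * (D + C) * `|s|.

Hypothesis shiftP : forall j, J j -> exists C c, 0 < c /\ shift_stable (e j) C c.

(** The coordinates are translated one after the other; the translations already
    made are absorbed in the arbitrary bounded function [phi]. *)
Lemma comb_shift n (D : R) : exists C c, 0 < c /\
  forall (phi chi : E -> R) (M t : R) (s : nat -> R),
  continuous phi -> continuous chi ->
  (forall x, `|phi x| <= M) -> (forall x, `|chi x| <= 1) -> klip D chi ->
  (forall i, `|s i| <= t) -> t <= c ->
  `|\int[l]_z (phi (z + comb J e n s) * chi z) - \int[l]_z (phi z * chi z)|
    <= M * C * t.
Proof.
elim: n => [|n [C [c [c0 IH]]]].
  exists 0, 1; split => // phi chi M t s _ _ _ _ _ _ _.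
  rewrite (_ : comb J e 0 s = 0); last by rewrite /comb big_ord0.
  under [X in `|X - _|]eq_Rintegral do rewrite addr0.
  by rewrite subrr normr0 mulr0 mul0r.
have [Jn|Jn] := pselect (J n); last first.
  exists C, c; split => // phi chi M t s cp cc pM c1 cD st tc.
  rewrite (_ : comb J e n.+1 s = comb J e n s); first exact: IH.
  by rewrite /comb big_mkcond big_ord_recr /= memNset// addr0 -big_mkcond.
have [C' [c' [c'0 shn]]] := shiftP Jn.
exists (C + `|D + C'|), (Num.min c c'); split; first by rewrite lt_min c0.
move=> phi chi M t s cp cc pM c1 cD st; rewrite le_min => /andP[tc tc'].
pose phi1 z := phi (z + s n *: e n).
have cp1 : continuous phi1.
  move=> z; apply: (@continuous_comp _ _ _ (fun z => z + s n *: e n) phi); last exact: cp.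
  by apply: cvgD; [exact: cvg_id | exact: cvg_cst].
have M0 : 0 <= M by exact: le_trans (normr_ge0 _) (pM 0).
have t0 : 0 <= t by exact: le_trans (normr_ge0 _) (st 0%N).
have -> : \int[l]_z (phi (z + comb J e n.+1 s) * chi z) =
    \int[l]_z (phi1 (z + comb J e n s) * chi z).
  apply: eq_Rintegral => z _; rewrite /phi1 -addrA; congr (phi (_ + _) * _).
  by rewrite /comb big_mkcond big_ord_recr /= mem_set// -big_mkcond.
rewrite -(subrK (\int[l]_z (phi1 z * chi z)) (\int[l]_z (phi1 _ * _))) -addrA.
rewrite (le_trans (ler_normD _ _))// mulrDr mulrDl; apply: lerD.
  by apply: IH => // z; exact: pM.
apply: (le_trans (shn phi chi M D (s n) cp cc pM c1 cD (le_trans (st n) tc'))).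
rewrite -!mulrA ler_wpM2l//.
by rewrite (le_trans (ler_wpM2r (normr_ge0 _) (ler_norm _)))// ler_wpM2l.
Qed.

End CombShift.

Section Contraction.
Context {R : realType} {H E : completeNormedModType R}.
Hypothesis sepE : separable E.
Variables (J : set nat) (e : nat -> E) (l : probability (borel E) R).
Variables (S : H * E -> H) (X : set H).
Hypothesis S_cont : continuous S.
Hypothesis K_compact : compact (msupport l).
Hypothesis X_compact : compact X.
Hypothesis e1 : forall i, J i -> `|e i| <= 1.
Hypothesis span_dense :
  dense [set x : E | exists n (c : nat -> R), x = comb J e n c].
Hypothesis shiftP : forall j, J j ->
  exists C c, 0 < c /\ shift_stable l (e j) C c.
Hypothesis strictP : forall p, exists L : {linear (H * E)%type -> H},
  strict_linearization S p L.
Hypothesis denseP : forall u, X u -> {ae l, forall z : borel E,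
  exists2 L : {linear (H * E)%type -> H}, strict_linearization S (u, z : E) L &
    dense (range (fun w : E => L (0, w)))}.

Lemma S_cont2 u : continuous (fun z : E => S (u, z)).
Proof.
move=> z; apply: (@continuous_comp _ _ _ (fun z => (u, z)) S); last exact: S_cont.
by apply: cvg_pair; [exact: cvg_cst | exact: cvg_id].
Qed.

(** The local Lipschitz bounds near the points [(u0, z)] become uniform in [z] by
    compactness of the support; the index [n] plays the role of both the constant
    and the inverse of the radius. *)
Lemma lip_on_support u0 : exists2 r, 0 < r & exists2 C, 0 < C &
  forall u v z, `|u - u0| < r -> `|v - u0| < r -> msupport l z ->
    `|S (u, z) - S (v, z)| <= C * `|u - v|.
Proof.
have /compact_near_coveringP cK := K_compact.
pose Q (n : nat) (z : E) := forall u v, `|u - u0| < n.+1%:R^-1 ->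
  `|v - u0| < n.+1%:R^-1 -> `|S (u, z) - S (v, z)| <= n.+1%:R * `|u - v|.
have /(cK _ \oo Q) : forall z, msupport l z ->
    \forall z' \near z & n \near \oo, Q n z'.
  move=> z _; have [L SL] := strictP (u0, z).
  have [r r0 [C C0 HC]] := local_lip SL.
  have zn : \forall z' \near z, `|z' - z| < r.
    by apply: filterS (nbhsx_ballx z _ r0) => z'; rewrite -ball_normE /= distrC.
  near=> z' n => u v un vn.
  have nr : n.+1%:R^-1 < r.
    by near: n; exact: (near_infty_natSinv_lt (PosNum r0)).
  have pr w : `|w - u0| < n.+1%:R^-1 -> `|((w, z') : H * E) - (u0, z)| < r.
    move=> wn; rewrite prod_normE /= gt_max (lt_trans wn nr)/=.
    by near: z'.
  rewrite (le_trans (HC _ _ (pr _ un) (pr _ vn)))//.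
  have -> : ((u, z') : H * E) - (v, z') = (u - v, 0).
    by apply/eqP; rewrite xpair_eqE /= subrr !eqxx.
  rewrite prod_norm_pairl ler_wpM2r//.
  have : (Num.truncn C <= n)%N by near: n; exact: nbhs_infty_ge.
  rewrite -(ler_nat R) => Cn; rewrite (@le_trans _ _ (Num.truncn C).+1%:R)//.
    by apply/ltW; rewrite truncnS_gt.
  by rewrite ler_nat ltnS -(ler_nat R).
move=> [n _ /(_ n (leqnn n)) Hn].
by exists n.+1%:R^-1 => //; exists n.+1%:R => // u v z un vn /Hn; exact.
Unshelve. all: by end_near. Qed.

(** A ball of noises on which the effect of changing the state from [u] to [v]
    can be compensated by a translation of the noise independent of the noise. *)
Definition controlled (u0 : H) (a : E) (q : R) := exists n r, 0 < r /\
  forall u v, `|u - u0| < r -> `|v - u0| < r ->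
    exists s : nat -> R, (forall i, `|s i| <= n%:R * `|u - v|) /\
      forall z, `|z - a| < q ->
        `|S (v, z) - S (u, z + comb J e n s)| <= 4^-1 * `|u - v|.

Lemma bm_klip (chi : E -> R) (D : R) : klip D chi ->
  (forall z, `|chi z| <= 1) -> bmfun (chi : borel E -> R).
Proof.
move=> cD c1; split; last by exists 1.
by apply: continuous_borelR; exact: klip_continuous cD.
Qed.

Lemma bm_test f M k u w (chi : E -> R) (D : R) : test_bound f M k ->
  klip D chi -> (forall z, `|chi z| <= 1) ->
  bmfun ((fun z => f (S (u, z + w)) * chi z) : borel E -> R).
Proof.
move=> [fM fk] cD c1; apply: bmM.
  split; last by exists M => z; exact: fM.
  apply: continuous_borelR => z.
  apply: (@continuous_comp _ _ _ (fun z => S (u, z + w)) f).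
    apply: (@continuous_comp _ _ _ (fun z => z + w) (fun z => S (u, z))).
      by apply: cvgD; [exact: cvg_id|exact: cvg_cst].
    exact: S_cont2.
  exact: klip_continuous fk _.
exact: bm_klip cD c1.
Qed.

Lemma bm_test0 f M k u (chi : E -> R) (D : R) : test_bound f M k ->
  klip D chi -> (forall z, `|chi z| <= 1) ->
  bmfun ((fun z => f (S (u, z)) * chi z) : borel E -> R).
Proof.
move=> tf cD c1; have := @bm_test f M k u 0 chi D tf cD c1.
by under eq_fun do rewrite addr0.
Qed.

(** Replacing the state [v] by [u] and translating the noise to compensate moves
    the arguments of [f] by at most [`|u - v| / 4], which costs [k / 4] times the
    mass of [chi]; undoing the translation in the law costs a multiple of [M] by
    shift stability, whatever the Lipschitz constant [k]. *)
Lemma controlled_piece u0 a q (chi : E -> R) (D : R) : controlled u0 a q ->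
  klip D chi -> (forall z, 0 <= chi z <= 1) ->
  (forall z, q <= `|z - a| -> chi z = 0) ->
  exists C r, 0 < r /\ forall f M k u v, test_bound f M k -> 0 <= k ->
    `|u - u0| < r -> `|v - u0| < r ->
    `|\int[l]_z (f (S (v, z)) * chi z) - \int[l]_z (f (S (u, z)) * chi z)|
    <= (k / 4 * \int[l]_z chi z + C * M) * `|u - v|.
Proof.
move=> [n [r [r0 Hr]]] cD c01 c0.
have c1 z : `|chi z| <= 1 by have /andP[? ?] := c01 z; rewrite ger0_norm.
have bchi : bmfun (chi : borel E -> R).
  exact: bm_klip cD c1.
have [C [c [cp HC]]] := comb_shift shiftP n D.
pose r' := Num.min r (c / (2 * (n%:R + 1))).
have n1 : 0 < n%:R + 1 :> R by rewrite ltr_wpDl.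
exists (C * n%:R), r'; split; first by rewrite lt_min r0 divr_gt0// mulr_gt0.
move=> f M k u v tf k0; rewrite !lt_min => /andP[ur uc] /andP[vr vc].
have [s [sn Hs]] := Hr u v ur vr.
have [fM fk] := tf.
have tc : n%:R * `|u - v| <= c.
  have -> : u - v = (u - u0) + (u0 - v) by rewrite addrA subrK.
  rewrite (le_trans (ler_wpM2l _ (ler_normD _ _)))// (distrC u0).
  have : `|u - u0| + `|v - u0| <= c / (n%:R + 1).
    rewrite (le_trans (lerD (ltW uc) (ltW vc)))//.
    by rewrite le_eqVlt; apply/orP; left; apply/eqP; field; rewrite gt_eqF.
  rewrite ler_pdivlMr// => uvc; apply: le_trans uvc.
  by rewrite mulrC ler_wpM2l ?addr_ge0// lerDl.
set w := comb J e n s in Hs.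
rewrite -(subrK (\int[l]_z (f (S (u, z + w)) * chi z)) (\int[l]_z (f (S (v, _)) * _))) -addrA.
rewrite (le_trans (ler_normD _ _))// mulrDl; apply: lerD.
  have b1 := @bm_test0 f M k v chi D tf cD c1.
  have b2 := @bm_test f M k u w chi D tf cD c1.
  rewrite -(ExB l b1 b2).
  rewrite (le_trans (Ex_normle _ _))//.
    exact: bmB.
  have -> : k / 4 * \int[l]_z chi z * `|u - v| = \int[l]_z (k / 4 * `|u - v| * chi z).
    by rewrite ExZ//; ring.
  apply: Ex_le.
  - by apply: bm_norm; exact: bmB.
  - by apply: bmM => //; exact: bm_cst.
  move=> z; rewrite -mulrBl normrM (ger0_norm (x := chi z)); last by case/andP: (c01 z).
  have [za|za] := ltP `|z - a| q; last by rewrite c0// !mulr0.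
  rewrite ler_wpM2r//; first by case/andP: (c01 z).
  rewrite (le_trans (fk _ _))// -mulrA ler_wpM2l//.
  exact: Hs.
have cphi : continuous (fun z : E => f (S (u, z))).
  move=> z; apply: (@continuous_comp _ _ _ (fun z => S (u, z)) f); first exact: S_cont2.
  exact: klip_continuous fk _.
have := HC (fun z => f (S (u, z))) chi M (n%:R * `|u - v|) s cphi
  (klip_continuous cD) (fun z => fM _) c1 cD sn tc.
by move=> /le_trans; apply; rewrite le_eqVlt; apply/orP; left; apply/eqP; ring.
Qed.

(** Almost every noise has a dense partial derivative, hence lies in one of
    countably many balls where the noise compensates the state. Finitely many of
    these balls carry all of the law but a small mass [\int Rem N], where the plain
    Lipschitz bound on [S] is good enough. The loss [k / 4] on the controlled part
    and the loss [k / 4] on the remainder add up to [k / 2]. *)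
Lemma local_contraction u0 : X u0 ->
  exists C r, 0 < r /\ forall f M k u v, test_bound f M k -> 0 <= k ->
    `|u - u0| < r -> `|v - u0| < r ->
    `|\int[l]_z f (S (v, z)) - \int[l]_z f (S (u, z))|
    <= (k / 2 + C * M) * `|u - v|.
Proof.
move=> Xu0.
have [r1 r10 [CS CS0 HCS]] := lip_on_support u0.
have [a [q [q0 aq]]] := separable_balls sepE.
(* The radius is doubled because the cutoffs vanish only outside the doubled balls. *)
pose good i := `[< controlled u0 (a i) (2 * q i) >].
pose psi i : E -> R := if good i then cutoff (a i) (q i) else fun=> 0.
have psi01 i z : 0 <= psi i z <= 1.
  by rewrite /psi; case: ifP; rewrite ?lexx ?ler01// /cutoff clamp_ge0 clamp_le1.
have psiL i : klip (q i)^-1 (psi i).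
  rewrite /psi; case: ifP => _; first exact: klip_cutoff.
  by apply: klip_le (klip_cst 0); rewrite invr_ge0 ltW.
(* What the first [n] cutoffs leave: [Rem n = (1 - psi 0) * ... * (1 - psi (n-1))]. *)
pose Rem := fix Rem n (z : E) : R := if n is m.+1 then Rem m z * (1 - psi m z) else 1.
have RemS n z : Rem n.+1 z = Rem n z * (1 - psi n z) by [].
have Rem0 z : Rem 0%N z = 1 by [].
have Rem01 n z : 0 <= Rem n z <= 1.
  elim: n => [|n /andP[IH0 IH1]]; first by rewrite Rem0 ler01 lexx.
  have /andP[p0 p1] := psi01 n z.
  by rewrite RemS mulr_ge0 ?subr_ge0//= mulr_ile1// ?subr_ge0// lerBlDr lerDl.
have Rem1 n z : `|Rem n z| <= 1 by have /andP[? ?] := Rem01 n z; rewrite ger0_norm.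
have psi1 n z : `|psi n z| <= 1 by have /andP[? ?] := psi01 n z; rewrite ger0_norm.
have RemL n : exists D, klip D (Rem n).
  elim: n => [|n [D IH]] /=; first by exists 0; exact: klip_cst.
  eexists; apply: (klipM (M := 1) (M' := 1)) => //.
    move=> z; have /andP[p0 p1] := psi01 n z.
    by rewrite ger0_norm ?subr_ge0// lerBlDr lerDl.
  apply: klipB; [exact: klip_cst | exact: psiL].
have bRem n : bmfun (Rem n : borel E -> R).
  have [D RD] := RemL n.
  exact: bm_klip RD (Rem1 n).
have cvR : (fun n => \int[l]_z Rem n z) @ \oo --> \int[l]_z (0 : R).
  apply: (@Ex_cvg _ _ _ l _ _ 1) => //; first by move=> n; exact: (bRem n).1.
  apply: filterS (denseP Xu0) => z [L SL Ld].
  have k0 : 0 < 4^-1 :> R by rewrite invr_gt0.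
  have [n [r [r0 Hr]]] := local_control e1 span_dense SL k0 Ld.
  have r30 : 0 < r / 3 by rewrite divr_gt0.
  have [i [qi ai]] := aq z _ r30.
  have gi : good i.
    apply/asboolP; exists n, r; split => // u v ur vr.
    have [s [sn Hs]] := Hr u v ur vr; exists s; split => // z' z'a.
    apply: Hs => /=; rewrite -(subrK (a i) z') -addrA (le_lt_trans (ler_normD _ _))//.
    by rewrite (distrC (a i)); lra.
  have R0 m : Rem (i.+1 + m)%N z = 0.
    elim: m => [|m IH]; last by rewrite addnS RemS IH mul0r.
    by rewrite addn0 RemS /psi gi cutoff1// ?subrr ?mulr0// ltW.
  apply: cvg_near_cst; near=> m.
  by rewrite -(R0 (m - i.+1)%N) subnKC//; near: m; exact: nbhs_infty_ge.
rewrite Ex_cst in cvR.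
have [N HN] : exists N, \int[l]_z Rem N z <= (4 * CS)^-1.
  have c0 : 0 < (4 * CS)^-1 by rewrite invr_gt0 mulr_gt0.
  have /cvgrPdist_lt/(_ _ c0)[N _ HN] := cvR.
  exists N; have := HN N (leqnn N); rewrite sub0r normrN => /ltW.
  exact/le_trans/ler_norm.
(* [Rem n - Rem n.+1 = psi n * Rem n] is supported in a single ball. *)
have peel n : exists C r, 0 < r /\ forall f M k u v, test_bound f M k -> 0 <= k ->
    `|u - u0| < r -> `|v - u0| < r ->
    `|\int[l]_z (f (S (v, z)) * (1 - Rem n z)) -
      \int[l]_z (f (S (u, z)) * (1 - Rem n z))|
    <= (k / 4 * \int[l]_z (1 - Rem n z) + C * M) * `|u - v|.
  elim: n => [|n [C [r [r0 IH]]]].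
    exists 0, 1; split => // f M k u v tf k0 _ _.
    have Z (g : E -> R) : \int[l]_z (g z * (1 - Rem 0%N z)) = 0.
      rewrite -[RHS](Ex_cst l 0); apply: eq_Rintegral => z _.
      by rewrite Rem0 subrr mulr0.
    rewrite !Z subrr normr0 mul0r addr0 !mulr_ge0// ?divr_ge0//.
    by apply: Ex_ge0 => z; rewrite Rem0 subrr.
  have [D RD] := RemL n.
  pose chi z := psi n z * Rem n z.
  have chi01 z : 0 <= chi z <= 1.
    have /andP[? ?] := psi01 n z; have /andP[? ?] := Rem01 n z.
    by rewrite /chi mulr_ge0//= mulr_ile1.
  have chi1 z : `|chi z| <= 1 by have /andP[? ?] := chi01 z; rewrite ger0_norm.
  have chiL : klip ((q n)^-1 * 1 + 1 * D) chi by apply: klipM.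
  have R1L : klip (0 + D) (fun z => 1 - Rem n z) by apply: klipB => //; exact: klip_cst.
  have R11 z : `|1 - Rem n z| <= 1.
    have /andP[? ?] := Rem01 n z.
    by rewrite ger0_norm ?subr_ge0// lerBlDr lerDl.
  have [C' [r' [r'0 H']]] : exists C r, 0 < r /\ forall f M k u v,
      test_bound f M k -> 0 <= k -> `|u - u0| < r -> `|v - u0| < r ->
      `|\int[l]_z (f (S (v, z)) * chi z) - \int[l]_z (f (S (u, z)) * chi z)|
      <= (k / 4 * \int[l]_z chi z + C * M) * `|u - v|.
    have [gn|gn] := boolP (good n).
      apply: (@controlled_piece u0 (a n) (2 * q n) chi) chiL chi01 _.
        exact/asboolP.
      by move=> z za; rewrite /chi /psi gn cutoff0// mul0r.
    have chi0 z : chi z = 0 by rewrite /chi /psi (negbTE gn) mul0r.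
    exists 0, 1; split => // f M k u v tf k0 _ _.
    have Z (g : E -> R) : \int[l]_z (g z * chi z) = 0.
      rewrite -[RHS](Ex_cst l 0); apply: eq_Rintegral => z _.
      by rewrite chi0 mulr0.
    rewrite !Z subrr normr0 mul0r addr0 !mulr_ge0// ?divr_ge0//.
    by apply: Ex_ge0 => z; rewrite chi0.
  exists (C + C'), (Num.min r r'); split; first by rewrite lt_min r0.
  move=> f M k u v tf k0; rewrite !lt_min => /andP[ur ur'] /andP[vr vr'].
  have bchi : bmfun (chi : borel E -> R).
    exact: bm_klip chiL chi1.
  have bR1 : bmfun ((fun z => 1 - Rem n z) : borel E -> R).
    exact: bm_klip R1L R11.
  have E1 w : \int[l]_z (f (S (w, z)) * (1 - Rem n.+1 z)) =
      \int[l]_z (f (S (w, z)) * (1 - Rem n z)) + \int[l]_z (f (S (w, z)) * chi z).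
    rewrite -ExD; [|exact: bm_test0 tf R1L R11|exact: bm_test0 tf chiL chi1].
    by apply: eq_Rintegral => z _; rewrite /chi RemS; ring.
  have E2 : \int[l]_z (1 - Rem n.+1 z) = \int[l]_z (1 - Rem n z) + \int[l]_z chi z.
    by rewrite -ExD//; apply: eq_Rintegral => z _; rewrite /chi RemS; ring.
  rewrite !E1 E2 opprD addrACA (le_trans (ler_normD _ _))//.
  rewrite (le_trans (lerD (IH _ _ _ _ _ tf k0 ur vr) (H' _ _ _ _ _ tf k0 ur' vr')))//.
  by rewrite le_eqVlt; apply/orP; left; apply/eqP; ring.
have [C [r [r0 HC]]] := peel N.
exists C, (Num.min r r1); split; first by rewrite lt_min r0.
move=> f M k u v tf k0; rewrite !lt_min => /andP[ur ur1] /andP[vr vr1].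
have [D RD] := RemL N.
have R1L : klip (0 + D) (fun z => 1 - Rem N z) by apply: klipB => //; exact: klip_cst.
have R11 z : `|1 - Rem N z| <= 1.
  have /andP[? ?] := Rem01 N z.
  by rewrite ger0_norm ?subr_ge0// lerBlDr lerDl.
have bR1 : bmfun ((fun z => 1 - Rem N z) : borel E -> R).
  exact: bm_klip R1L R11.
have E1 w : \int[l]_z f (S (w, z)) =
    \int[l]_z (f (S (w, z)) * (1 - Rem N z)) + \int[l]_z (f (S (w, z)) * Rem N z).
  rewrite -ExD; [|exact: bm_test0 tf R1L R11|exact: bm_test0 tf RD (Rem1 N)].
  by apply: eq_Rintegral => z _ /=; ring.
rewrite !E1 opprD addrACA (le_trans (ler_normD _ _))//.
have uv0 := normr_ge0 (u - v).
have M0 : 0 <= M by exact: le_trans (normr_ge0 _) (tf.1 u).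
have I1 : \int[l]_z (1 - Rem N z) <= 1.
  rewrite -[leRHS](Ex_cst l 1); apply: Ex_le => //; first exact: bm_cst.
  by move=> z; exact: le_trans (ler_norm _) (R11 z).
have P1 := HC _ _ _ _ _ tf k0 ur vr.
have P2 : `|\int[l]_z (f (S (v, z)) * Rem N z) - \int[l]_z (f (S (u, z)) * Rem N z)|
    <= k / 4 * `|u - v|.
  have bt w : bmfun ((fun z => f (S (w, z)) * Rem N z) : borel E -> R).
    exact: bm_test0 tf RD (Rem1 N).
  rewrite -ExB// (le_trans (Ex_normle _ _))//; first exact: bmB.
  apply: (@le_trans _ _ (\int[l]_z (k * CS * `|u - v| * Rem N z))).
    apply: Ex_ae_le; first by apply: bm_norm; exact: bmB.
      by apply: bmM => //; exact: bm_cst.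
    refine (@filterS _ _ (ae_filter_ringOfSetsType l) _ _ _ (msupport_ae sepE l)) => z Kz.
    have /andP[Rz _] := Rem01 N z.
    rewrite -mulrBl normrM (ger0_norm Rz) ler_wpM2r//.
    rewrite (le_trans (tf.2 _ _))// -mulrA ler_wpM2l// (distrC u).
    exact: HCS.
  rewrite ExZ//.
  rewrite (le_trans (ler_wpM2l _ HN))//; first by rewrite !mulr_ge0// ltW.
  by rewrite le_eqVlt; apply/orP; left; apply/eqP; field; rewrite gt_eqF.
rewrite (le_trans (lerD P1 P2))//.
rewrite -mulrDl ler_wpM2r//.
have : k / 4 * \int[l]_z (1 - Rem N z) <= k / 4.
  by rewrite ler_piMr// divr_ge0.
lra.
Unshelve. all: by end_near. Qed.

(** A Lasota-Yorke inequality. The local estimates have uniform constants by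
    compactness of [X], and at distances bounded below the supremum norm alone
    gives the bound. The factor 1/2 on the Lipschitz constant is what keeps iterates
    of the averaging in one class of Lipschitz functions. *)
Theorem lasota_yorke : exists C, 0 <= C /\ forall f M k u v,
  test_bound f M k -> 0 <= k -> X u -> X v ->
  `|\int[l]_z f (S (u, z)) - \int[l]_z f (S (v, z))| <= (k / 2 + C * M) * `|u - v|.
Proof.
have /compact_near_coveringP cX := X_compact.
pose Q (n : nat) (u : H) := forall f M k v, test_bound f M k -> 0 <= k ->
  `|u - v| < n.+1%:R^-1 ->
  `|\int[l]_z f (S (v, z)) - \int[l]_z f (S (u, z))|
    <= (k / 2 + n.+1%:R * M) * `|u - v|.
have /(cX _ \oo Q) : forall u, X u -> \forall u' \near u & n \near \oo, Q n u'.
  move=> u0 Xu0; have [C [r [r0 HC]]] := local_contraction Xu0.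
  have r20 : 0 < r / 2 by rewrite divr_gt0.
  have un : \forall u' \near u0, `|u' - u0| < r / 2.
    by apply: filterS (nbhsx_ballx u0 _ r20) => u'; rewrite -ball_normE /= distrC.
  near=> u n => f M k v tf k0 uv.
  have ur : `|u - u0| < r / 2 by near: u.
  have nr : n.+1%:R^-1 < r / 2.
    by near: n; exact: (near_infty_natSinv_lt (PosNum r20)).
  have vr : `|v - u0| < r.
    rewrite -(subrK u v) -addrA (le_lt_trans (ler_normD _ _))// (distrC v).
    by rewrite (splitr r) ltrD// (lt_trans uv).
  have ur' : `|u - u0| < r by apply: (lt_trans ur); rewrite ltr_pdivrMr// ltr_pMr// ltr1n.
  have M0 : 0 <= M by exact: le_trans (normr_ge0 _) (tf.1 u).
  rewrite (le_trans (HC _ _ _ _ _ tf k0 ur' vr))// ler_wpM2r// lerD2l ler_wpM2r//.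
  have : (Num.truncn `|C| <= n)%N by near: n; exact: nbhs_infty_ge.
  rewrite -(ler_nat R) => Cn; rewrite (le_trans (ler_norm _))//.
  rewrite (@le_trans _ _ (Num.truncn `|C|).+1%:R)//.
    by apply/ltW; rewrite truncnS_gt.
  by rewrite ler_nat ltnS -(ler_nat R).
move=> [n _ /(_ n (leqnn n)) Hn].
exists (n.+1%:R + 2 * n.+1%:R); split; first by rewrite addr_ge0// mulr_ge0.
move=> f M k u v tf k0 Xu Xv.
have M0 : 0 <= M by exact: le_trans (normr_ge0 _) (tf.1 u).
have [uv|uv] := ltP `|u - v| n.+1%:R^-1.
  rewrite distrC (le_trans (Hn u Xu _ _ _ _ tf k0 uv))// ler_wpM2r// lerD2l.
  by rewrite ler_wpM2r// lerDl mulr_ge0.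
have bM w : `|\int[l]_z f (S (w, z))| <= M.
  apply: Ex_bound; last by move=> z; exact: tf.1.
  apply: continuous_borelR => z.
  apply: (@continuous_comp _ _ _ (fun z => S (w, z)) f); first exact: S_cont2.
  exact: klip_continuous tf.2 _.
rewrite (le_trans (ler_normB _ _))// (le_trans (lerD (bM _) (bM _)))//.
have n0 : 0 < n.+1%:R :> R by rewrite ltr0n.
have : 1 <= n.+1%:R * `|u - v|.
  by rewrite -ler_pdivrMl// mulr1.
have uv0 := normr_ge0 (u - v); have : 0 <= k / 2 * `|u - v| by rewrite mulr_ge0// divr_ge0.
nra.
Unshelve. all: by end_near. Qed.

End Contraction.

(** * Trajectories and the Markov property *)

Section MarkovProperty.
Context {R : realType} {H E : completeNormedModType R}.
Hypotheses (sepH : separable H) (sepE : separable E).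
Context {d} {Om : measurableType d} {P : probability Om R}.
Variables (S : H * E -> H) (eta : nat -> {RV P >-> borel E}).
Variables (l : probability (borel E) R) (X : set H).
Hypothesis S_cont : continuous S.
Hypothesis eta_indep : mutually_independent P [set: nat] eta.
Hypothesis eta_law : forall k (Gamma : set (borel E)), measurable Gamma ->
  distribution P (eta k) Gamma = l Gamma.
Hypothesis X_inv : forall u z, X u -> msupport l z -> X (S (u, z)).

Definition state (k : nat) (u : H) (w : Om) : H := traj S (eta ^~ w) u k.

Lemma measurable_S : measurable_fun setT (S : borel H * borel E -> borel H).
Proof.
have := @pair_borel R _ (borel H * borel E)%type H E H fst snd S sepH sepE.
rewrite (_ : (fun w => _) = S); last by apply/funext => -[].
by apply; [exact: measurable_fst|exact: measurable_snd|exact: S_cont].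
Qed.

Lemma measurable_state2 k :
  measurable_fun setT ((fun p => state k p.1 p.2) : borel H * Om -> borel H).
Proof.
elim: k => [|k IH]; first exact: measurable_fst.
have m2 : measurable_fun setT ((fun p => eta k p.2) : borel H * Om -> borel E).
  exact: (measurableT_comp (measurable_funP (eta k)) measurable_snd).
exact: (measurableT_comp measurable_S (measurable_fun_pair IH m2)).
Qed.

Lemma measurable_state k u : measurable_fun setT (state k u : Om -> borel H).
Proof.
exact: (measurableT_comp (measurable_state2 k) (measurable_pair1 (u : borel H))).
Qed.

(** A trajectory is a fold over the noises of the past, which makes it independent
    of the noise to come. *)
Lemma stateE k u w : state k u w =
  fold_rv (T1 := borel E) (T2 := borel H) eta (u : H) (fun=> S) (rev (iota 0 k)) w.
Proof.
elim: k => [//|k IH].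
by rewrite -addn1 iotaD add0n cats1 rev_rcons /= -IH addn1.
Qed.

Definition avg (f : H -> R) (u : H) : R := \int[l]_z f (S (u, z)).

Lemma bm_avg (f : borel H -> R) : bmfun f -> bmfun (avg f : borel H -> R).
Proof.
move=> bf; have bF : bmfun (fun p : borel H * borel E => f (S p)).
  exact: (bm_comp bf measurable_S).
exact: (bm_Ex (@dirac _ (borel H) (point : H) R : probability (borel H) R) l bF).
Qed.

(** The noise of the last step is independent of the state that it acts on, and can
    be integrated first. *)
Lemma Ex_stateS (f : borel H -> R) k u : bmfun f ->
  \int[P]_w f (state k.+1 u w) = \int[P]_w avg f (state k u w).
Proof.
move=> bf.
have bF : bmfun (fun p : borel H * borel E => f (S p)).
  exact: (bm_comp bf measurable_S).
have Hf := @Ex_fold_rv _ Om R P _ _ (borel E) (borel H) nat setT eta eta_indep u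
  (fun=> S) (fun=> measurable_S) (rev (iota 0 k)) k _.
transitivity (\int[P]_w f (S (fold_rv (T1 := borel E) (T2 := borel H) eta u (fun=> S) (rev (iota 0 k)) w, eta k w))).
  by apply: eq_Rintegral => w _; rewrite -stateE.
rewrite (Hf (fun p => f (S p))) ?rev_uniq ?iota_uniq// ?mem_rev ?mem_iota ?ltnn//.
apply: eq_Rintegral => w _; rewrite /avg -stateE.
by congr fine; apply: eq_measure_integral => A mA _; exact: eta_law.
Qed.

Lemma noise_support : {ae P, forall w, forall k, msupport l (eta k w : E)}.
Proof.
have := msupport_ae sepE l => -[N [mN lN HN]].
apply: (@negligibleS _ _ _ _ (\bigcup_k (eta k @^-1` N))).
  by move=> w /existsNP[k kw]; exists k => //; exact: HN.
apply: negligible_bigcup => k.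
apply/negligibleP.
  by rewrite -[X in measurable X]setTI; exact: (measurable_funP (eta k)).
by rewrite -[RHS]lN -(eta_law k).
Qed.

Lemma state_X u : X u -> {ae P, forall w, forall k, X (state k u w)}.
Proof.
move=> Xu.
refine (@filterS _ _ (ae_filter_ringOfSetsType P) _ _ _ noise_support) => w Kw.
by elim=> [//|k IH]; exact: X_inv.
Qed.

End MarkovProperty.

(** * Representation of positive functionals on Lipschitz functions *)

Section Separation.
Context {R : realType} {T : normedModType R}.

(** The functions are multiples of the distance to [F], truncated at 1. They serve
    twice: to split covers along a closed set, and to approximate the indicator of
    an open set from below. *)
Lemma closed_separation (F : set T) : closed F -> exists psi : nat -> T -> R,
  [/\ forall n, klip n%:R (psi n), forall n x, 0 <= psi n x <= 1,
      forall n x, psi n x <= psi n.+1 x, forall n x, F x -> psi n x = 0 &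
      forall x, ~ F x -> exists n0, forall n, (n0 <= n)%N -> psi n x = 1].
Proof.
move=> cF; have [[y0 Fy0]|F0] := pselect (F !=set0); last first.
  exists (fun _ _ => 1); split => //.
  - by move=> n x y; rewrite subrr normr0 mulr_ge0.
  - by move=> n x; rewrite ler01 lexx.
  - by move=> n x Fx; exfalso; apply: F0; exists x.
  - by move=> x _; exists 0%N.
pose D x : set R := [set `|x - y| | y in F].
have infD x : has_inf (D x).
  by split; [exists `|x - y0|, y0|exists 0 => _ [y Fy <-]].
pose dist x := inf (D x).
have dist_le x y : F y -> dist x <= `|x - y|.
  by move=> Fy; apply: ge_inf; [exact: (infD x).2|exists y].
have dist0 x : 0 <= dist x.
  by apply: lb_le_inf; [exists `|x - y0|, y0 | move=> _ [y Fy <-]].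
have dist1 x x' : dist x <= dist x' + `|x - x'|.
  rewrite -lerBlDr; apply: lb_le_inf; first by exists `|x' - y0|, y0.
  move=> _ [y Fy <-]; rewrite lerBlDr (le_trans (dist_le x y Fy))//.
  by rewrite [leRHS]addrC ler_distD.
have kdist : klip 1 dist.
  move=> x x'; rewrite mul1r ler_norml; apply/andP; split.
    by have := dist1 x' x; rewrite distrC; lra.
  by have := dist1 x x'; lra.
exists (fun n x => clamp (n%:R * dist x)); split.
- move=> n; apply: klip_clamp; have := klipZ n%:R kdist.
  by rewrite ger0_norm// mulr1.
- by move=> n x; rewrite clamp_ge0 clamp_le1.
- move=> n x; have nd : n%:R * dist x <= n.+1%:R * dist x.
    by rewrite ler_wpM2r// ler_nat.
  have n0 : 0 <= n%:R * dist x by rewrite mulr_ge0.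
  have [h|h] := leP 1 (n.+1%:R * dist x); first by rewrite [leRHS]clamp1// clamp_le1.
  by rewrite !clamp_id// ?(le_trans n0 nd)// ?ltW// (le_lt_trans nd).
- move=> n x Fx; rewrite clamp0//.
  by have := dist_le x x Fx; rewrite subrr normr0 => d0; rewrite mulr_ge0_le0.
move=> x Fx; have /nbhs_ballP[r /= r0 Hr] : nbhs x (~` F).
  by apply: open_nbhs_nbhs; split => //; exact: closed_openC.
have rd : r <= dist x.
  apply: lb_le_inf; first by exists `|x - y0|, y0.
  move=> _ [y Fy <-]; rewrite leNgt; apply/negP => xy.
  by apply: (Hr y) => //; rewrite -ball_normE.
exists (Num.truncn r^-1).+1 => n nr; apply: clamp1.
rewrite (@le_trans _ _ (r^-1 * r))//; first by rewrite mulVf ?gt_eqF.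
apply: ler_pM => //; rewrite ?invr_ge0 ?(ltW r0)//.
by rewrite (@le_trans _ _ (Num.truncn r^-1).+1%:R) ?ler_nat// ltW// truncnS_gt.
Qed.

End Separation.

Section Daniell.
Context {R : realType} {H : completeNormedModType R}.
Variables (X : set H) (Lam : (H -> R) -> R).

(** The functions on which the functional [Lam] is meant to act; [BL] stands for
    bounded Lipschitz. *)
Definition BL (f : H -> R) := exists M k, test_bound f M k.

Lemma BL_cst c : BL (fun=> c).
Proof. by exists `|c|, 0; split => //; exact: klip_cst. Qed.

Lemma BL_D f g : BL f -> BL g -> BL (fun x => f x + g x).
Proof.
move=> [M [k [fM fk]]] [N [j [gN gj]]]; exists (M + N), (k + j); split.
  by move=> x; rewrite (le_trans (ler_normD _ _))// lerD.
exact: klipD.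
Qed.

Lemma BL_M f g : BL f -> BL g -> BL (fun x => f x * g x).
Proof.
move=> [M [k [fM fk]]] [N [j [gN gj]]].
have M0 : 0 <= M by exact: le_trans (normr_ge0 _) (fM 0).
have N0 : 0 <= N by exact: le_trans (normr_ge0 _) (gN 0).
exists (M * N), (k * N + M * j); split; first by move=> x; rewrite normrM ler_pM.
exact: klipM.
Qed.

Lemma BL_Z c f : BL f -> BL (fun x => c * f x).
Proof. by move=> bf; apply: BL_M => //; exact: BL_cst. Qed.

Lemma BL_B f g : BL f -> BL g -> BL (fun x => f x - g x).
Proof.
move=> [M [k [fM fk]]] [N [j [gN gj]]]; exists (M + N), (k + j); split.
  by move=> x; rewrite (le_trans (ler_normB _ _))// lerD.
exact: klipB.
Qed.

Lemma BL_clamp f : BL f -> BL (fun x => clamp (f x)).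
Proof.
move=> [M [k [fM fk]]]; exists 1, k; split; first by move=> x; exact: clamp_norm.
exact: klip_clamp.
Qed.

Lemma BL_sum n (f : nat -> H -> R) : (forall i, BL (f i)) ->
  BL (fun x => \sum_(i < n) f i x).
Proof.
move=> bf; elim: n => [|n IH].
  by under eq_fun do rewrite big_ord0; exact: BL_cst.
by under eq_fun do rewrite big_ord_recr /=; exact: BL_D.
Qed.

Lemma BL_bm f : BL f -> bmfun (f : borel H -> R).
Proof.
move=> [M [k [fM fk]]]; split; last by exists M.
by apply: continuous_borelR; exact: klip_continuous fk.
Qed.

Hypothesis X_compact : compact X.
Hypothesis LamD : forall f g, BL f -> BL g ->
  Lam (fun x => f x + g x) = Lam f + Lam g.
Hypothesis LamZ : forall c f, BL f -> Lam (fun x => c * f x) = c * Lam f.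
Hypothesis Lam1 : Lam (fun=> 1) = 1.
Hypothesis Lam_le : forall f g, BL f -> BL g -> (forall x, X x -> f x <= g x) ->
  Lam f <= Lam g.

Lemma Lam_cst (c : R) : Lam (fun=> c) = c.
Proof.
by have := LamZ c (BL_cst 1); rewrite Lam1 mulr1.
Qed.

Lemma LamB f g : BL f -> BL g -> Lam (fun x => f x - g x) = Lam f - Lam g.
Proof.
move=> bf bg; apply/eqP; rewrite -subr_eq opprK -LamD//; last exact: BL_B.
by apply/eqP; congr Lam; apply/funext => x; rewrite subrK.
Qed.

Lemma Lam_sum n (f : nat -> H -> R) : (forall i, BL (f i)) ->
  Lam (fun x => \sum_(i < n) f i x) = \sum_(i < n) Lam (f i).
Proof.
move=> bf; elim: n => [|n IH].
  by rewrite big_ord0 -[RHS](Lam_cst 0); congr Lam; apply/funext => x; rewrite big_ord0.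
rewrite big_ord_recr /= -IH -LamD//; last exact: BL_sum.
by congr Lam; apply/funext => x; rewrite big_ord_recr.
Qed.

(** Daniell's construction: a set is measured by increasing sequences of test
    functions that eventually reach 1 at each of its points. Only points of [X]
    count, which concentrates the resulting measure on [X]. *)
Definition dcover (A : set H) (s : R) (f : nat -> H -> R) :=
  [/\ forall n, BL (f n), forall n x, 0 <= f n x, forall n x, f n x <= f n.+1 x,
      forall n, Lam (f n) <= s & forall x, X x -> A x -> exists n, 1 <= f n x].

Definition dcost (A : set H) : set R := [set s | exists f, dcover A s f].

Definition daniell (A : set H) : R := inf (dcost A).

Lemma dcover_mono A s f : dcover A s f -> forall m n x, (m <= n)%N -> f m x <= f n x.
Proof.
move=> [_ _ fS _ _] m n x; elim: n => [|n IH]; first by rewrite leqn0 => /eqP->.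
rewrite leq_eqVlt => /orP[/eqP->//|]; rewrite ltnS => mn.
by rewrite (le_trans (IH mn)).
Qed.

Lemma dcost_ge0 A s : dcost A s -> 0 <= s.
Proof.
move=> [f [bf f0 _ fs _]]; rewrite (le_trans _ (fs 0%N))// -[leLHS](Lam_cst 0).
by apply: Lam_le => //; exact: BL_cst.
Qed.

Lemma dcost1 A : dcost A 1.
Proof.
exists (fun _ _ => 1); split => //; first by move=> _; exact: BL_cst.
  by move=> n; rewrite Lam1.
by exists 0%N.
Qed.

Lemma has_inf_dcost A : has_inf (dcost A).
Proof. by split; [exists 1; exact: dcost1 | exists 0 => s; exact: dcost_ge0]. Qed.

Lemma daniell_le A s : dcost A s -> daniell A <= s.
Proof. by move=> As; apply: ge_inf => //; exact: (has_inf_dcost A).2. Qed.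

Lemma daniell_ge A s : (forall t, dcost A t -> s <= t) -> s <= daniell A.
Proof. by move=> H'; apply: lb_le_inf => //; exact: (has_inf_dcost A).1. Qed.

Lemma daniell_ge0 A : 0 <= daniell A.
Proof. by apply: daniell_ge => t; exact: dcost_ge0. Qed.

Lemma daniell0 : daniell set0 = 0.
Proof.
apply/eqP; rewrite eq_le daniell_ge0 andbT; apply: daniell_le.
exists (fun _ _ => 0); split => //; first by move=> _; exact: BL_cst.
by move=> n; rewrite Lam_cst.
Qed.

Lemma daniell_homo A B : A `<=` B -> daniell A <= daniell B.
Proof.
move=> AB; apply: daniell_ge => t [f [bf f0 fS ft fB]]; apply: daniell_le.
by exists f; split => // x Xx /AB; exact: fB.
Qed.

Lemma geometric_sum_le (n : nat) (e : R) : 0 <= e ->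
  \sum_(i < n) e / (2 ^+ i.+1) <= e.
Proof.
move=> e0; suff -> : \sum_(i < n) e / (2 ^+ i.+1) = e - e / 2 ^+ n.
  by rewrite gerBl divr_ge0// exprn_ge0.
elim: n => [|n IH]; first by rewrite big_ord0 expr0 divr1 subrr.
by rewrite big_ord_recr /= IH exprS; field; rewrite expf_neq0.
Qed.

(** Covers of the sets [F i] with errors [e / 2 ^ i.+1] are combined
    diagonally: the [n]-th function is the sum over [i < n] of the [n]-th functions
    of the covers. *)
Lemma daniell_sigma_subadditive :
  sigma_subadditive (fun A : set H => (daniell A)%:E).
Proof.
move=> F.
have F0 n : (0 <= (daniell (F n))%:E)%E by rewrite lee_fin daniell_ge0.
have [->|fin] := eqVneq (\sum_(i <oo) (daniell (F i))%:E)%E +oo%E; first exact: leey.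
have {}fin : (\sum_(i <oo) (daniell (F i))%:E)%E \is a fin_num.
  by rewrite ge0_fin_numE ?nneseries_ge0// ltey.
rewrite -(fineK fin) lee_fin; set s := fine _.
have sums n : \sum_(i < n) daniell (F i) <= s.
  rewrite -lee_fin /s fineK// -sumEFin.
  rewrite -(big_mkord xpredT (fun i => (daniell (F i))%:E)).
  by apply: nneseries_lim_ge.
apply/ler_addgt0Pr => e e0.
have [f fP] : {f : nat -> nat -> H -> R & forall i, exists2 t,
    t <= daniell (F i) + e / 2 ^+ i.+1 & dcover (F i) t (f i)}.
  apply: (@choice _ _ (fun i g => exists2 t,
    t <= daniell (F i) + e / 2 ^+ i.+1 & dcover (F i) t g)) => i.
  have ei : 0 < e / 2 ^+ i.+1 by rewrite divr_gt0// exprn_gt0.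
  have [t [g gt] tF] := inf_adherent ei (has_inf_dcost (F i)).
  by exists g, t => //; exact: ltW.
have bf i n : BL (f i n) by have [t _ []] := fP i.
have f0 i n x : 0 <= f i n x by have [t _ []] := fP i.
have fS i n x : f i n x <= f i n.+1 x by have [t _ []] := fP i.
apply: daniell_le; exists (fun n x => \sum_(i < n) f i n x); split.
- by move=> n; apply: (@BL_sum n (fun i => f i n)).
- by move=> n x; apply: sumr_ge0.
- move=> n x; rewrite big_ord_recr /=.
  by rewrite (@le_trans _ _ (\sum_(i < n) f i n.+1 x))// ?lerDl// ler_sum.
- move=> n; rewrite (@Lam_sum n (fun i => f i n))//.
  apply: (@le_trans _ _ (\sum_(i < n) (daniell (F i) + e / 2 ^+ i.+1))).
    apply: ler_sum => i _; have [t tle [_ _ _ ft _]] := fP i.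
    exact: le_trans (ft n) tle.
  by rewrite big_split lerD//; apply: geometric_sum_le; exact: ltW.
- move=> x Xx [i _ Fix].
  have [t _ dc] := fP i; have [_ _ _ _ /(_ x Xx Fix)[n fn]] := dc.
  exists (maxn n i.+1).
  have im : (i < maxn n i.+1)%N by rewrite leq_max ltnSn orbT.
  rewrite (bigD1 (Ordinal im))//= (le_trans fn)//.
  rewrite (le_trans (dcover_mono dc x (leq_maxl n i.+1)))//.
  by rewrite lerDl sumr_ge0.
Qed.

Lemma dcover_shift A s f k : dcover A s f -> dcover A s (fun n => f (n + k)%N).
Proof.
move=> dc; have [bf f0 fS fs fA] := dc; split => //.
move=> x Xx /(fA x Xx)[n fn]; exists n.
by rewrite (le_trans fn)// (dcover_mono dc)// leq_addr.
Qed.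

(** Closed sets are Caratheodory measurable. With [psi] increasing to the indicator
    of the complement of [F], a cover [f] of [A] splits: [f * (1 - psi k)] covers
    the part in [F] for each fixed [k], and the diagonal sequence [f n * psi n]
    covers the part outside. *)
Lemma daniell_closed (F A : set H) : closed F ->
  daniell (A `&` F) + daniell (A `&` ~` F) <= daniell A.
Proof.
move=> cF; have [psi [kpsi psi01 psiS psi0 psi1]] := closed_separation cF.
have bpsi n : BL (psi n).
  exists 1, n%:R; split => // x; have /andP[? ?] := psi01 n x.
  by rewrite ger0_norm.
have p0 n x : 0 <= psi n x by have /andP[] := psi01 n x.
have p1 n x : psi n x <= 1 by have /andP[] := psi01 n x.
apply: daniell_ge => s [f dc]; have [bf f0 fS fs fA] := dc.
pose g n x := f n x * psi n x.
have bg n : BL (g n) by exact: BL_M.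
have gF k : daniell (A `&` F) <= s - Lam (g k).
  apply: daniell_le; exists (fun n x => f (n + k)%N x * (1 - psi k x)).
  have dck := dcover_shift k dc; have [bfk fk0 fkS fks fkA] := dck.
  split.
  - by move=> n; apply: BL_M => //; apply: BL_B => //; exact: BL_cst.
  - by move=> n x; rewrite mulr_ge0// subr_ge0.
  - by move=> n x; rewrite ler_wpM2r ?subr_ge0.
  - move=> n; have -> : (fun x => f (n + k)%N x * (1 - psi k x)) =
        (fun x => f (n + k)%N x - f (n + k)%N x * psi k x).
      by apply/funext => x; ring.
    rewrite LamB//; last exact: BL_M.
    rewrite lerB//; apply: Lam_le => //; first exact: BL_M.
    by move=> x _; rewrite ler_wpM2r// (dcover_mono dc)// leq_addl.
  - move=> x Xx [Ax Fx]; have [n fn] := fkA x Xx Ax; exists n.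
    by rewrite psi0// subr0 mulr1.
have gS n x : g n x <= g n.+1 x by rewrite ler_pM.
suff : daniell (A `&` ~` F) <= s - daniell (A `&` F) by lra.
apply: daniell_le; exists g; split => //.
- by move=> n x; rewrite mulr_ge0.
- by move=> n; have := gF n; lra.
- move=> x Xx [Ax Fx]; have [n fn] := fA x Xx Ax.
  have [m pm] := psi1 x Fx; exists (maxn n m).
  rewrite /g pm ?leq_maxr// mulr1 (le_trans fn)// (dcover_mono dc)//.
  exact: leq_maxl.
Qed.

(** A compactness argument of Dini type: an increasing sequence that reaches 1 at
    each point of [X] exceeds [1 - e] uniformly on [X] from some index on. *)
Lemma daniell_lower (A : set H) e : 0 < e -> X `<=` A -> 1 - e <= daniell A.
Proof.
move=> e0 XA; apply: daniell_ge => s [f dc]; have [bf f0 fS fs fA] := dc.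
have /compact_near_coveringP cX := X_compact.
pose Q (n : nat) (u : H) := 1 - e <= f n u.
have /(cX _ \oo Q) : forall u, X u -> \forall u' \near u & n \near \oo, Q n u'.
  move=> u Xu; have [n fn] := fA u Xu (XA u Xu).
  have gn : \forall u' \near u, 1 - e <= f n u'.
    have [M [k [_ fk]]] := bf n.
    have /cvgrPdist_lt/(_ _ e0) := klip_continuous fk (x := u).
    by apply: filterS => u'; rewrite ltr_norml => /andP[_]; lra.
  near=> u' m; rewrite /Q /=; apply: (@le_trans _ _ (f n u')); first by near: u'.
  apply: (dcover_mono dc); near: m; exact: nbhs_infty_ge.
move=> [n _ /(_ n (leqnn n)) Hn].
rewrite (le_trans _ (fs n))// -[leLHS](Lam_cst (1 - e)).
by apply: Lam_le => //; exact: BL_cst.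
Unshelve. all: by end_near. Qed.

Lemma daniell_full A : X `<=` A -> daniell A = 1.
Proof.
move=> XA; apply/eqP; rewrite eq_le; apply/andP; split.
  by apply: daniell_le; exact: dcost1.
by apply/ler_addgt0Pr => e e0; rewrite -lerBlDr; exact: daniell_lower.
Qed.

Lemma daniell_test A f : BL f -> (forall x, 0 <= f x) ->
  (forall x, X x -> A x -> 1 <= f x) -> daniell A <= Lam f.
Proof.
move=> bf f0 fA; apply: daniell_le; exists (fun=> f); split => //.
by move=> x Xx Ax; exists 0%N; exact: fA.
Qed.

(** Caratheodory's theorem gives a measure on the measurable sets of the outer
    measure, which include the Borel sets. *)
Lemma daniell_measure : exists mu : probability (borel H) R,
  forall A : set (borel H), measurable A -> mu A = (daniell A)%:E.
Proof.
pose om : set H -> \bar R := fun A => (daniell A)%:E.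
have om0 : om set0 = 0%E by rewrite /om daniell0.
have om_ge0 A : (0 <= om A)%E by rewrite lee_fin daniell_ge0.
have om_homo : {homo om : A B / A `<=` B >-> (A <= B)%E}.
  by move=> A B AB; rewrite lee_fin daniell_homo.
pose mu : {outer_measure set H -> \bar R} := HB.pack om
  (isOuterMeasure.Build R H om om0 om_ge0 om_homo daniell_sigma_subadditive).
have cara (A : set (borel H)) : measurable A -> mu.-caratheodory A.
  move: A; apply: smallest_sub.
    split.
    - exact: caratheodory_measurable_set0.
    - by move=> A mA; rewrite setTD; exact: caratheodory_measurable_setC.
    - by move=> A mA; exact: caratheodory_measurable_bigcup.
  move=> A oA; rewrite -(setCK A); apply: caratheodory_measurable_setC.
  apply: le_caratheodory_measurable => B; rewrite /mu /= /om -EFinD lee_fin.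
  by apply: daniell_closed; exact: open_closedC.
pose m : set (borel H) -> \bar R := om.
have m0 : m set0 = 0%E by [].
have msa : semi_sigma_additive m.
  move=> F mF tF mU.
  exact: (@caratheodory_measure_sigma_additive R H mu F (fun n => cara _ (mF n)) tF (cara _ mU)).
have mT : m setT = 1%E by rewrite /m /om daniell_full.
pose mm : {measure set (borel H) -> \bar R} := HB.pack m
  (isMeasure.Build _ _ _ m m0 om_ge0 msa).
have mmT : mm setT = 1%E by [].
(* Normalizing a measure of mass 1 does nothing but package it as a probability. *)
exists (mnormalize mm (@dirac _ (borel H) (point : H) R : probability (borel H) R)).
move=> A mA; rewrite /= /mnormalize mmT onee_eq0 /= invr1 mule1.
by [].
Qed.

Lemma clamp_sum (n : nat) (t : R) : 0 <= t <= n%:R -> \sum_(i < n) clamp (t - i%:R) = t.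
Proof.
move=> /andP[t0 tn].
suff -> : \sum_(i < n) clamp (t - i%:R) = Num.min t n%:R by apply/min_idPl.
elim: (n) {tn} => [|m IH]; first by rewrite big_ord0; apply/esym/min_idPr.
rewrite big_ord_recr /= IH -natr1.
have [tm|tm] := leP t m%:R.
  by rewrite clamp0 ?subr_le0// addr0; apply/esym/min_idPl; lra.
have [tm1|tm1] := leP t (m%:R + 1).
  by rewrite clamp_id; lra.
by rewrite clamp1; lra.
Qed.

(** A layer-cake comparison: [n * f] is a sum of [n] truncations [g i], and the
    truncation [g i] lies between the indicators of [n * f >= i + 1] and
    [n * f > i]. Comparing these layers one level apart costs 1 in total, that is
    [1 / n] for [f] itself. *)
Lemma Ex_le_Lam (mu : probability (borel H) R) f :
  (forall A : set (borel H), measurable A -> mu A = (daniell A)%:E) ->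
  BL f -> (forall x, 0 <= f x <= 1) -> \int[mu]_x f x <= Lam f.
Proof.
move=> muE bf f01.
suff layer (n : nat) : (0 < n)%N -> n%:R * \int[mu]_x f x <= n%:R * Lam f + 1.
  apply/ler_addgt0Pr => e e0.
  have [n ne] : exists n : nat, n.+1%:R^-1 < e.
    have [n _ nP] := near_infty_natSinv_lt (PosNum e0).
    by exists n; exact: (nP n (leqnn n)).
  have n0 : 0 < n.+1%:R :> R by rewrite ltr0n.
  have := layer n.+1 isT; rewrite -(ler_pM2l n0) => h.
  rewrite -(ler_pM2l n0) mulrDr.
  have : 1 <= n.+1%:R * e by rewrite -ler_pdivrMl// mulr1 ltW.
  have := layer n.+1 isT; lra.
move=> n0.
pose g i x := clamp (n%:R * f x - i%:R).
have bnf : BL (fun x => n%:R * f x) by exact: BL_Z.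
have bg i : BL (g i) by apply: BL_clamp; apply: BL_B => //; exact: BL_cst.
have fsum x : \sum_(i < n) g i x = n%:R * f x.
  apply: clamp_sum; have /andP[? ?] := f01 x.
  by rewrite mulr_ge0//= ler_piMr.
pose A i : set (borel H) := [set x | i.+1%:R <= n%:R * f x].
have mA i : measurable (A i).
  have mnf := (BL_bm bnf).1.
  have := mnf measurableT `[i.+1%:R, +oo[%classic (measurable_itv _).
  rewrite setTI (_ : _ @^-1` _ = A i)//.
  by apply/seteqP; split => x; rewrite /A /= in_itv /= andbT.
have gA i : \int[mu]_x \1_(A i) x <= Lam (g i).
  rewrite -lee_fin Ex_indic// muE// lee_fin; apply: daniell_test => //.
    by move=> x; exact: clamp_ge0.
  move=> x _ Ax; have {Ax} : i.+1%:R <= n%:R * f x := Ax.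
  by rewrite -natr1 => Ax; rewrite /g clamp1//; lra.
rewrite -ExZ; last exact: BL_bm.
have bA i : bmfun (\1_(A i) : borel H -> R) by exact: bm_indic.
have bsum m : bmfun (fun x => \sum_(i < m) \1_(A i) x : R).
  elim: m => [|m IH].
    by under eq_fun do rewrite big_ord0; exact: bm_cst.
  by under eq_fun do rewrite big_ord_recr /=; exact: bmD.
have Esum m : \int[mu]_x (\sum_(i < m) \1_(A i) x) = \sum_(i < m) \int[mu]_x \1_(A i) x.
  elim: m => [|m IH].
    rewrite big_ord0 -[RHS](Ex_cst mu 0); apply: eq_Rintegral => x _.
    by rewrite big_ord0.
  rewrite big_ord_recr /= -IH -ExD//; apply: eq_Rintegral => x _.
  by rewrite big_ord_recr.
apply: (@le_trans _ _ (\int[mu]_x (\sum_(i < n) \1_(A i) x + 1))).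
  apply: Ex_le; [exact: BL_bm|by apply: bmD => //; exact: bm_cst|].
  move=> x; rewrite -fsum.
  have bound m : \sum_(i < m) g i x <= \sum_(i < m) \1_(A i) x + 1.
    case: m => [|m]; first by rewrite !big_ord0 add0r ler01.
    rewrite big_ord_recl [leRHS]addrC; apply: lerD; first exact: clamp_le1.
    rewrite big_ord_recr /= (@le_trans _ _ (\sum_(i < m) \1_(A i) x))//; last first.
      by rewrite lerDl.
    apply: ler_sum => i _; rewrite /bump /= add1n /g indicE.
    case: (boolP (x \in A i)) => [_|/negP Ai]; first exact: clamp_le1.
    rewrite clamp0// subr_le0 leNgt; apply/negP => h; apply: Ai.
    by rewrite inE /A /=; exact: ltW.
  exact: bound.
rewrite ExD//; last exact: bm_cst.
rewrite Ex_cst lerD2r Esum -LamZ//.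
have -> : (fun x => n%:R * f x) = (fun x => \sum_(i < n) g i x).
  by apply/funext => x; rewrite fsum.
by rewrite Lam_sum//; apply: ler_sum => i _; exact: gA.
Qed.

(** The layer-cake inequality for [f] and for [1 - f] together is an equality. *)
Theorem riesz : exists mu : probability (borel H) R, mu X = 1%E /\
  forall f, BL f -> \int[mu]_x f x = Lam f.
Proof.
have [mu muE] := daniell_measure; exists mu.
have cX : closed X by apply: compact_closed => //; exact: norm_hausdorff.
split; first by rewrite muE ?daniell_full//; exact: closed_borel.
have E01 f : BL f -> (forall x, 0 <= f x <= 1) -> \int[mu]_x f x = Lam f.
  move=> bf f01; apply/eqP; rewrite eq_le (Ex_le_Lam muE bf f01) /=.
  have b1 : BL (fun x => 1 - f x) by apply: BL_B => //; exact: BL_cst.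
  have f1 x : 0 <= 1 - f x <= 1.
    by have /andP[? ?] := f01 x; apply/andP; split; lra.
  have := Ex_le_Lam muE b1 f1.
  rewrite LamB//; last exact: BL_cst.
  rewrite ExB; [|exact: bm_cst|exact: BL_bm].
  by rewrite Ex_cst Lam1 lerD2l lerN2.
move=> f [M [k [fM fk]]].
pose N := M + 1.
have M0 : 0 <= M by exact: le_trans (normr_ge0 _) (fM 0).
have N0 : 0 < N by rewrite ltr_wpDl.
pose g x := (2 * N)^-1 * (f x + N).
have bf : BL f by exists M, k.
have bg : BL g by apply: BL_Z; apply: BL_D => //; exact: BL_cst.
have g01 x : 0 <= g x <= 1.
  have := fM x; rewrite ler_norml => /andP[f1 f2].
  rewrite /g mulr_ge0 ?invr_ge0 ?mulr_ge0 ?(ltW N0)//=; last by rewrite /N; lra.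
  by rewrite ler_pdivrMl ?mulr_gt0// mulr1 /N; lra.
have -> : f = (fun x => 2 * N * g x - N).
  by apply/funext => x; rewrite /g; field; rewrite gt_eqF.
rewrite LamB; [|exact: BL_Z|exact: BL_cst].
rewrite LamZ// Lam_cst ExB; [|exact/BL_bm/BL_Z|exact: bm_cst].
by rewrite Ex_cst ExZ ?E01//; exact: BL_bm.
Qed.

(** Lipschitz functions increase to the indicator of any open set, and the open
    sets form a generating family stable under intersection. *)
Lemma BL_determines (mu nu : probability (borel H) R) :
  (forall f, BL f -> \int[mu]_x f x = \int[nu]_x f x) ->
  forall A : set (borel H), measurable A -> mu A = nu A.
Proof.
move=> Hf.
have Hopen (A : set H) : open A -> mu (A : set (borel H)) = nu (A : set (borel H)).
  move=> oA; have mA := open_borel oA.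
  have [psi [kpsi psi01 psiS psi0 psi1]] := closed_separation (open_closedC oA).
  have bpsi n : BL (psi n).
    exists 1, n%:R; split => // x; have /andP[? ?] := psi01 n x.
    by rewrite ger0_norm.
  have cv (la : probability (borel H) R) :
      (fun n => \int[la]_x psi n x) @ \oo --> \int[la]_x \1_(A : set (borel H)) x.
    apply: (@Ex_cvg _ _ _ la _ _ 1).
    - by move=> n; exact: (BL_bm (bpsi n)).1.
    - exact: measurable_indic.
    - by move=> n x; have /andP[? ?] := psi01 n x; rewrite ger0_norm.
    apply: (@aeW _ _ _ la) => x.
    have [Ax|Ax] := pselect (A x).
      rewrite indicE mem_set//; have [|n0 Hn] := psi1 x; first by apply.
      apply: cvg_near_cst; near=> n; apply: Hn; near: n; exact: nbhs_infty_ge.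
    rewrite indicE memNset//; apply: cvg_near_cst; apply: nearW => n.
    exact: psi0.
  have E : (fun n => \int[mu]_x psi n x) = (fun n => \int[nu]_x psi n x).
    by apply/funext => n; exact: Hf.
  have cvm := cv mu; rewrite E in cvm.
  rewrite -!Ex_indic//; congr EFin.
  exact: (cvg_unique (@Rhausdorff R) cvm (cv nu)).
move=> A mA.
apply: (@measure_unique _ R (borel H) (@open H) (fun=> setT) _ _ _ _ mu nu) => //.
- exact: openI.
- by move=> _; exact: openT.
- by rewrite bigcup_const//; exists 0%N.
- by move=> _; rewrite (probm_setT mu) ltry.
Unshelve. all: by end_near. Qed.

End Daniell.

(** * Measures carried by a set and product probabilities *)

Section Concentration.
Import HBNNSimple.
Context {d} {T : measurableType d} {R : realType}.

(** For bare set functions: the integral is built from the values on measurable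
    sets only. This allows integrating against a set function that has not been
    shown to be a measure as such. *)
Lemma integral_ext (m1 m2 : set T -> \bar R) (D : set T) (f : T -> \bar R) :
  (forall A, measurable A -> m1 A = m2 A) -> integral m1 D f = integral m2 D f.
Proof.
move=> m12.
have E (h : {nnsfun T >-> R}) : sintegral m1 h = sintegral m2 h.
  by rewrite /sintegral; apply: eq_fsbigr => x _; rewrite m12.
rewrite /integral; congr (ereal_sup _ - ereal_sup _)%E.
  by apply/seteqP; split => x [h hf <-]; exists h => //; rewrite E.
by apply/seteqP; split => x [h hf <-]; exists h => //; rewrite E.
Qed.

Variables (mu : probability T R) (X : set T).
Hypotheses (mX : measurable X) (muX : mu X = 1%E).

Lemma full_measure_setC : mu (~` X) = 0%E.
Proof. by rewrite probability_setC// muX subee. Qed.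

Lemma full_measure_ae : {ae mu, forall x, X x}.
Proof. by exists (~` X); split => //; [exact: measurableC|exact: full_measure_setC]. Qed.

Lemma full_measure_bound (h : T -> R) (a : R) : bmfun h ->
  (forall x, X x -> `|h x| <= a) -> `|\int[mu]_x h x| <= a.
Proof.
move=> bh ha; rewrite (le_trans (Ex_normle mu bh))// -[leRHS](Ex_cst mu a).
apply: Ex_ae_le; [exact: bm_norm|exact: bm_cst|].
by apply: filterS full_measure_ae => x /ha.
Qed.

Lemma full_measure_eq (f g : T -> R) : bmfun f -> bmfun g ->
  (forall x, X x -> f x = g x) -> \int[mu]_x f x = \int[mu]_x g x.
Proof.
move=> bf bg fg; apply: Ex_ae_eq => //.
by apply: filterS full_measure_ae => x /fg.
Qed.

Lemma full_measure_integral (f : T -> R) : bmfun f ->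
  (\int[mu]_(x in X) (f x)%:E)%E = (\int[mu]_x f x)%:E.
Proof.
move=> bf; rewrite -(Ex_fin mu bf).
rewrite [RHS](@negligible_integral _ _ _ mu setT (~` X))//.
- by rewrite setTD setCK.
- exact: measurableC.
- exact: bm_int.
- exact: full_measure_setC.
Qed.

End Concentration.

Lemma product_probability {d d'} {T : measurableType d} {T' : measurableType d'}
    {R : realType} (mu : probability T R) (nu : probability T' R) :
  exists m : probability (T * T')%type R, forall A B,
    measurable A -> measurable B -> m (A `*` B) = (mu A * nu B)%E.
Proof.
pose m : {measure set (T * T')%type -> \bar R} := (mu \x nu)%E.
have mE A B : measurable A -> measurable B -> m (A `*` B) = (mu A * nu B)%E.
  by move=> mA mB; exact: product_measure1E.
have mT : m setT = 1%E.
  by rewrite -setXTT mE// (probm_setT mu) (probm_setT nu) mule1.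
(* Normalizing a measure of mass 1 does nothing but package it as a probability. *)
exists (mnormalize m (@dirac _ (T * T')%type (point, point) R : probability (T * T')%type R)).
by move=> A B mA mB; rewrite /= /mnormalize mT onee_eq0 /= invr1 mule1 mE.
Qed.

(** * Mixing and the equilibrium measure *)

Section McShane.
Context {R : realType} {H : normedModType R}.
Variable X : set H.

(** McShane's formula, the supremum over [y] in [X] of [f y - k * `|x - y|],
    truncated from below by [- M] to keep the bound. *)
Lemma lip_extend (f : H -> R) (M k : R) : X !=set0 -> 0 <= k ->
  (forall x, X x -> `|f x| <= M) ->
  (forall x y, X x -> X y -> `|f x - f y| <= k * `|x - y|) ->
  exists2 g, test_bound g M k & forall x, X x -> g x = f x.
Proof.
move=> [x0 Xx0] k0 fM fk.
pose h y x := Num.max (f y - k * `|x - y|) (- M).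
pose A x : set R := [set h y x | y in X].
have hM y x : X y -> h y x <= M.
  move=> Xy; have := fM _ Xy; rewrite ler_norml => /andP[fl fr].
  rewrite /h ge_max; apply/andP; split; last by lra.
  by rewrite (le_trans _ fr)// gerBl mulr_ge0.
have supA x : has_sup (A x).
  by split; [exists (h x0 x), x0|exists M => _ [y Xy <-]; exact: hM].
have hsup y x : X y -> h y x <= sup (A x).
  by move=> Xy; apply: (sup_upper_bound (supA x)); exists y.
have supk x x' : sup (A x) <= sup (A x') + k * `|x - x'|.
  apply: ge_sup; first by exists (h x0 x), x0.
  move=> _ [y Xy <-]; rewrite (@le_trans _ _ (h y x' + k * `|x - x'|))//; last first.
    by rewrite lerD2r hsup.
  have kk : 0 <= k * `|x - x'| by rewrite mulr_ge0.
  rewrite /h ge_max; apply/andP; split.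
    rewrite (@le_trans _ _ (f y - k * `|x' - y| + k * `|x - x'|))//; last first.
      by rewrite lerD2r le_max lexx.
    rewrite -addrA lerD2l addrC -mulrBr -mulrN ler_wpM2l//.
    have := ler_normD (x' - x) (x - y); rewrite addrA subrK (distrC x' x); lra.
  by rewrite (@le_trans _ _ (- M))// ?lerDl// -[leLHS]addr0 lerD// le_max lexx orbT.
exists (fun x => sup (A x)) => [|x Xx]; first split.
- move=> x; rewrite ler_norml; apply/andP; split.
    by rewrite (le_trans _ (hsup x0 x Xx0))// /h le_max lexx orbT.
  apply: ge_sup; first by exists (h x0 x), x0.
  by move=> _ [y Xy <-]; exact: hM.
- move=> x y; rewrite ler_norml; apply/andP; split.
    by have := supk y x; rewrite distrC; lra.
  by have := supk x y; lra.
apply/eqP; rewrite eq_le; apply/andP; split.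
  apply: ge_sup; first by exists (h x0 x), x0.
  move=> _ [y Xy <-]; rewrite /h ge_max; apply/andP; split.
    have := fk _ _ Xy Xx; rewrite distrC => /(le_trans (ler_norm _)).
    by have := fk _ _ Xx Xy; rewrite ler_norml => /andP[]; lra.
  by have := fM _ Xx; rewrite ler_norml => /andP[].
by rewrite (le_trans _ (hsup x x Xx))// /h subrr normr0 mulr0 subr0 le_max lexx.
Qed.

End McShane.

Section Mixing.
Context {R : realType} {H E : completeNormedModType R}.
Hypotheses (sepH : separable H) (sepE : separable E).
Context {d} {Om : measurableType d} {P : probability Om R}.
Variables (S : H * E -> H) (eta : nat -> {RV P >-> borel E}).
Variables (l : probability (borel E) R) (X : set H).
Hypothesis S_cont : continuous S.
Hypothesis eta_indep : mutually_independent P [set: nat] eta.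
Hypothesis eta_law : forall k (Gamma : set (borel E)), measurable Gamma ->
  distribution P (eta k) Gamma = l Gamma.
Hypothesis X_inv : forall u z, X u -> msupport l z -> X (S (u, z)).
Hypothesis X_compact : compact X.
Variable C : R.
Hypothesis C0 : 0 <= C.
Hypothesis LY : forall f M k u v,
  test_bound f M k -> 0 <= k -> X u -> X v ->
  `|\int[l]_z f (S (u, z)) - \int[l]_z f (S (v, z))| <= (k / 2 + C * M) * `|u - v|.

Definition transfer (k : nat) (f : H -> R) (u : H) : R :=
  \int[P]_w f (state S eta k u w).

Lemma test_bm f M k : test_bound f M k -> bmfun (f : borel H -> R).
Proof.
move=> [fM fk]; split; last by exists M.
by apply: continuous_borelR; exact: klip_continuous fk.
Qed.

Lemma bm_state (f : borel H -> R) k u : bmfun f ->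
  bmfun (fun w => f (state S eta k u w)).
Proof. by move=> bf; exact: (bm_comp bf (measurable_state sepH sepE eta S_cont k u)). Qed.

Lemma transfer_eqX (f g : borel H -> R) k u : bmfun f -> bmfun g ->
  (forall x, X x -> f x = g x) -> X u -> transfer k f u = transfer k g u.
Proof.
move=> bf bg fg Xu; apply: Ex_ae_eq; [exact: bm_state|exact: bm_state|].
refine (@filterS _ _ (ae_filter_ringOfSetsType P) _ _ _
  (state_X sepE eta_law X_inv Xu)) => w Xw.
exact: fg.
Qed.

Lemma transfer_leX (f g : borel H -> R) k u : bmfun f -> bmfun g ->
  (forall x, X x -> f x <= g x) -> X u -> transfer k f u <= transfer k g u.
Proof.
move=> bf bg fg Xu; apply: Ex_ae_le; [exact: bm_state|exact: bm_state|].
refine (@filterS _ _ (ae_filter_ringOfSetsType P) _ _ _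
  (state_X sepE eta_law X_inv Xu)) => w Xw.
exact: fg.
Qed.

Lemma transfer0 f u : transfer 0 f u = f u.
Proof. by rewrite /transfer /state /= Ex_cst. Qed.

(** The averaging can be performed at the last step first, which turns statements on
    [k.+1] steps into statements on [k] steps for another test function. *)
Lemma transferS (f g : borel H -> R) k u : bmfun f -> bmfun g ->
  (forall x, X x -> g x = avg S l f x) -> X u ->
  transfer k.+1 f u = transfer k g u.
Proof.
move=> bf bg gf Xu; rewrite /transfer (Ex_stateS sepH sepE S_cont eta_indep eta_law)//.
apply: (@transfer_eqX (avg S l f)) => //; last by move=> x /gf.
exact: bm_avg.
Qed.

(** The Lasota-Yorke inequality is available on [X] only; the extension makes the
    averaged function a test function again. *)
Lemma avg_extend f M k : X !=set0 -> test_bound f M k -> 0 <= k -> 0 <= M ->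
  exists2 g, test_bound g M (k / 2 + C * M) & forall u, X u -> g u = avg S l f u.
Proof.
move=> X0 tf k0 M0; apply: lip_extend => //.
- by rewrite addr_ge0 ?mulr_ge0// invr_ge0.
- move=> u _; apply: Ex_bound => [|z]; last exact: tf.1.
  have bF := bm_comp (test_bm tf) (measurable_S sepH sepE S_cont).
  exact: (bm_comp bF (measurable_pair1 (u : borel H))).1.
- by move=> u v Xu Xv; exact: LY.
Qed.

(** Being at least [2 * C], this constant satisfies [Lstar / 2 + C <= Lstar], so
    that averaging preserves the test class below. Being at least 2, it makes this
    class contain the functions of dual-Lipschitz norm at most 1. *)
Definition Lstar := Num.max (2 * C) 2.

Lemma Lstar_ge : C * 2 <= Lstar /\ 2 <= Lstar.
Proof. by rewrite /Lstar; split; rewrite le_max ?lexx ?orbT// mulrC lexx. Qed.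

Definition testF (f : H -> R) := test_bound f 1 Lstar.

Lemma avg_testF f : X !=set0 -> testF f ->
  exists2 g, testF g & forall u, X u -> g u = avg S l f u.
Proof.
have [L1 L2] := Lstar_ge.
move=> X0 tf; have [|g [g1 gk] gE] := avg_extend X0 tf _ ler01; first by lra.
by exists g => //; split=> //; apply: klip_le gk; lra.
Qed.

Lemma transfer_testF k f : X !=set0 -> testF f -> exists g, [/\ testF g,
  forall u, X u -> transfer k f u = g u &
  forall j u, X u -> transfer (j + k) f u = transfer j g u].
Proof.
move=> X0; elim: k f => [|k IH] f tf.
  by exists f; split => // [u _|j u _]; rewrite ?transfer0 ?addn0.
have [f1 tf1 f1E] := avg_testF X0 tf.
have [g [tg gE1 gE2]] := IH f1 tf1.
exists g; split => // [u Xu|j u Xu].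
  by rewrite (@transferS f f1)//; [exact: gE1|exact: test_bm tf|exact: test_bm tf1].
by rewrite addnS (@transferS f f1)//; [exact: gE2|exact: test_bm tf|exact: test_bm tf1].
Qed.

(** By induction on the number of steps: the averaged function is positive at the
    last but one point of the controlled trajectory, because the control is in the
    support of the law and [f] stays away from 0 near it. *)
Lemma transfer_pos m f M k u (zeta : nat -> E) : test_bound f M k -> 0 <= k ->
  0 <= M -> (forall x, X x -> 0 <= f x) -> X u ->
  (forall i, (i < m)%N -> msupport l (zeta i)) ->
  0 < f (traj S zeta u m) -> 0 < transfer m f u.
Proof.
move=> + + M0 + Xu; elim: m f k => [|m IH] f k tf k0 f0 Kz fz.
  by rewrite transfer0.
have X0 : X !=set0 by exists u.
have [g tg gE] := avg_extend X0 tf k0 M0.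
rewrite (@transferS f g)//; [|exact: test_bm tf|exact: test_bm tg].
have bfx x : bmfun ((fun z => f (S (x, z))) : borel E -> R).
  have bF := bm_comp (test_bm tf) (measurable_S sepH sepE S_cont).
  exact: (bm_comp bF (measurable_pair1 (x : borel H))).
have fS x : X x -> {ae l, forall z : borel E, 0 <= f (S (x, z))}.
  move=> Xx.
  refine (@filterS _ _ (ae_filter_ringOfSetsType l) _ _ _ (msupport_ae sepE l)) => z Kzz.
  exact/f0/X_inv.
apply: (IH g (k / 2 + C * M)) => //.
- by rewrite addr_ge0 ?mulr_ge0// invr_ge0.
- move=> x Xx; rewrite gE// /avg -[leLHS](Ex_cst l 0).
  by apply: Ex_ae_le => //; [exact: bm_cst|exact: fS].
- by move=> i im; apply: Kz; exact: ltnW.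
have XT j : (j <= m)%N -> X (traj S zeta u j).
  elim: j => [//|j IHj] jm; apply: X_inv; first exact/IHj/ltnW.
  by apply: Kz; rewrite ltnS ltnW.
set x := traj S zeta u m in fz *.
have Xx : X x by exact: XT.
rewrite gE//.
have cf : continuous (fun z : E => f (S (x, z))).
  move=> z; apply: (@continuous_comp _ _ _ (fun z => S (x, z)) f).
    apply: (@continuous_comp _ _ _ (fun z => (x, z)) S); last exact: S_cont.
    by apply: cvg_pair; [exact: cvg_cst | exact: cvg_id].
  exact: klip_continuous tf.2 _.
rewrite /= -/x in fz.
pose c := f (S (x, zeta m)).
have c20 : 0 < c / 2 by rewrite divr_gt0.
have /nbhs_ballP[r /= r0 Hr] : \forall z \near zeta m, c / 2 < f (S (x, z)).
  have := cf (zeta m) => /cvgrPdist_lt/(_ _ c20); apply: filterS => z.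
  by rewrite -/c ltr_norml => /andP[_]; lra.
have oB : open (ball (zeta m) r) by exact: ball_open.
have mB := open_borel oB.
have lB : 0 < \int[l]_z \1_(ball (zeta m) r : set (borel E)) z.
  rewrite -lte_fin Ex_indic//; apply: (Kz m (ltnSn m)) => //.
  exact: ballxx.
apply: (@lt_le_trans _ _ (\int[l]_z (c / 2 * \1_(ball (zeta m) r : set (borel E)) z))).
  by rewrite ExZ ?mulr_gt0//; exact: bm_indic.
apply: Ex_ae_le => //.
  by apply: bmM; [exact: bm_cst|exact: bm_indic].
refine (@filterS _ _ (ae_filter_ringOfSetsType l) _ _ _ (fS x Xx)) => z fz0.
rewrite indicE; case: (boolP (z \in _)) => [/set_mem zB|_]; last by rewrite mulr0.
by rewrite mulr1 ltW// Hr.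
Qed.

Variable uhat : H.
Hypothesis Xuhat : X uhat.
Hypothesis control : forall eps : R, 0 < eps -> exists m : nat, (1 <= m)%N /\
  forall u, X u -> exists zeta : nat -> E,
    (forall k, (k < m)%N -> msupport l (zeta k)) /\
    `|traj S zeta u m - uhat| < eps.

(** The probability of being near [uhat] after [m] steps is positive for each
    initial state by controllability; it agrees on [X] with a continuous function of
    this state, hence is bounded below on the compact set [X]. *)
Lemma minorization (eps : R) : 0 < eps -> exists m p, [/\ 0 < p, p <= 1 &
  forall u, X u -> p <= transfer m (cutoff uhat eps) u].
Proof.
move=> e0; have [m [_ Hm]] := control e0.
have tc : test_bound (cutoff uhat eps) 1 eps^-1.
  by split; [move=> x; exact: clamp_norm|exact: klip_cutoff].
have ei0 : 0 <= eps^-1 by rewrite invr_ge0 ltW.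
have X0 : X !=set0 by exists uhat.
have pos u : X u -> 0 < transfer m (cutoff uhat eps) u.
  move=> Xu; have [zeta [Kz Hz]] := Hm u Xu.
  apply: (transfer_pos (zeta := zeta) tc ei0 ler01) => // [x _|]; first exact: clamp_ge0.
  by rewrite cutoff1// ltW.
have [g [k tg gE]] : exists g, exists2 k, test_bound g 1 k &
    forall u, X u -> transfer m (cutoff uhat eps) u = g u.
  have : 0 <= eps^-1 by [].
  move: tc; move: (cutoff uhat eps) (eps^-1) => f k.
  elim: (m) f k => [|j IH] f k tf k0.
    by exists f, k => // u _; rewrite transfer0.
  have [f1 tf1 f1E] := avg_extend X0 tf k0 ler01.
  have [|g [k' tg gE]] := IH f1 _ tf1.
    by rewrite addr_ge0 ?mulr_ge0// invr_ge0.
  exists g, k' => // u Xu.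
  by rewrite (@transferS f f1)//; [exact: gE|exact: test_bm tf|exact: test_bm tf1].
have /compact_near_coveringP cX := X_compact.
pose Q (n : nat) (u : H) := n.+1%:R^-1 < g u.
have /(cX _ \oo Q) : forall u, X u -> \forall u' \near u & n \near \oo, Q n u'.
  move=> u Xu; have gu : 0 < g u by rewrite -gE// pos.
  have gu2 : 0 < g u / 2 by rewrite divr_gt0.
  have gn : \forall u' \near u, g u / 2 < g u'.
    have /cvgrPdist_lt/(_ _ gu2) := klip_continuous tg.2 (x := u).
    by apply: filterS => u'; rewrite ltr_norml => /andP[_]; lra.
  near=> u' n; rewrite /Q /=; apply: (@lt_trans _ _ (g u / 2)); last by near: u'.
  by near: n; exact: (near_infty_natSinv_lt (PosNum gu2)).
move=> [n _ /(_ n (leqnn n)) Hn]; exists m, n.+1%:R^-1; split => [//||u Xu].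
  by rewrite invf_le1// ler1n.
by rewrite gE//; apply: ltW; exact: Hn.
Unshelve. all: by end_near. Qed.

Definition osc_le (k : nat) (a : R) := forall f, testF f ->
  exists i, forall x, X x -> i <= transfer k f x <= i + a.

Lemma transfer_cst k (c : R) u : transfer k (fun=> c) u = c.
Proof. exact: Ex_cst. Qed.

Lemma transfer_between j k f (i s : R) u : testF f ->
  (forall x, X x -> i <= transfer k f x <= s) -> X u ->
  i <= transfer (j + k) f u <= s.
Proof.
have X0 : X !=set0 by exists uhat.
move=> tf Hi Xu; have [g [tg gE1 gE2]] := transfer_testF k X0 tf.
rewrite gE2//; apply/andP; split.
  rewrite -[leLHS](transfer_cst j i u).
  apply: transfer_leX => //; [exact: bm_cst|exact: test_bm tg|].
  by move=> y Xy; rewrite -gE1//; case/andP: (Hi y Xy).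
rewrite -[leRHS](transfer_cst j s u).
apply: transfer_leX => //; [exact: test_bm tg|exact: bm_cst|].
by move=> y Xy; rewrite -gE1//; case/andP: (Hi y Xy).
Qed.

Lemma osc_mono k j a : osc_le k a -> osc_le (j + k) a.
Proof.
move=> Hk f tf; have [i Hi] := Hk f tf; exists i => x Xx.
exact: transfer_between.
Qed.

(** A Doeblin type argument. Seen at time [k], a test function becomes a function
    [h] of the same class, with values in [[i, i + a]] and within
    [2 * Lstar * eps] of [h uhat] where the cutoff is not zero. This part is met
    with probability at least [p] from any initial state, and there the
    oscillation is replaced by [4 * Lstar * eps]. *)
Lemma osc_step eps m p k a : 0 < eps -> 0 < p ->
  (forall u, X u -> p <= transfer m (cutoff uhat eps) u) ->
  osc_le k a -> osc_le (m + k) ((1 - p) * a + p * (4 * Lstar * eps)).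
Proof.
move=> e0 p0 Hp Hk f tf; have X0 : X !=set0 by exists uhat.
have [h [th hE1 hE2]] := transfer_testF k X0 tf.
have [i Hi] := Hk f tf.
have {}Hi x : X x -> i <= h x <= i + a by move=> Xx; rewrite -hE1// Hi.
pose c := h uhat; pose dl := 2 * Lstar * eps.
pose g : borel H -> R := cutoff uhat eps.
have tc : test_bound g 1 eps^-1.
  by split; [move=> x; exact: clamp_norm|exact: klip_cutoff].
have bg := test_bm tc; have bh := test_bm th.
have g01 x : 0 <= g x <= 1 by rewrite /g /cutoff clamp_ge0 clamp_le1.
have [L1 L2] := Lstar_ge.
have near_c x : g x != 0 -> `|h x - c| <= dl.
  move=> gx; have xu : `|x - uhat| <= 2 * eps.
    rewrite leNgt; apply/negP => xu; move/eqP: gx; apply.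
    by apply: cutoff0 => //; rewrite ltW.
  rewrite (le_trans (th.2 _ _))// (_ : dl = Lstar * (2 * eps)); last first.
    by rewrite /dl; ring.
  by rewrite ler_wpM2l//; lra.
pose up := Num.max 0 (i + a - c - dl); pose lo := Num.max 0 (c - dl - i).
have up0 : 0 <= up by rewrite /up le_max lexx.
have lo0 : 0 <= lo by rewrite /lo le_max lexx.
have hup x : X x -> h x <= (i + a) + (- up) * g x.
  move=> Xx; have /andP[_ hx] := Hi x Xx; have /andP[gx0 gx1] := g01 x.
  have [->|/near_c] := eqVneq (g x) 0; first by rewrite mulr0 addr0.
  rewrite ler_norml => /andP[_ hc].
  have : up * g x <= up by rewrite ler_piMr.
  have : up <= i + a - h x by rewrite /up ge_max; apply/andP; split; lra.
  lra.
have hlo x : X x -> i + lo * g x <= h x.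
  move=> Xx; have /andP[hx _] := Hi x Xx; have /andP[gx0 gx1] := g01 x.
  have [->|/near_c] := eqVneq (g x) 0; first by rewrite mulr0 addr0.
  rewrite ler_norml => /andP[hc _].
  have : lo * g x <= lo by rewrite ler_piMr.
  have : lo <= h x - i by rewrite /lo ge_max; apply/andP; split; lra.
  lra.
have blin (b t : R) : bmfun (fun x : borel H => b + t * g x).
  by apply: bmD; [exact: bm_cst|apply: bmM => //; exact: bm_cst].
have tlin (b t : R) u : transfer m (fun x => b + t * g x) u = b + t * transfer m g u.
  rewrite /transfer ExD; [|exact: bm_cst|].
    by rewrite Ex_cst ExZ//; exact: bm_state.
  by apply: bmM; [exact: bm_cst|exact: bm_state].
exists (i + p * (c - dl - i)) => x Xx; rewrite hE2//; apply/andP; split.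
  apply: (@le_trans _ _ (transfer m (fun x => i + lo * g x) x)).
    rewrite tlin lerD2l (@le_trans _ _ (p * lo))//.
      by rewrite ler_wpM2l ?(ltW p0)// /lo le_max lexx orbT.
    by rewrite mulrC ler_wpM2l// Hp.
  by apply: transfer_leX.
apply: (@le_trans _ _ (transfer m (fun x => (i + a) + (- up) * g x) x)).
  by apply: transfer_leX.
rewrite tlin.
have : p * up <= up * transfer m g x by rewrite mulrC ler_wpM2l// Hp.
have : p * (i + a - c - dl) <= p * up.
  by rewrite ler_wpM2l ?(ltW p0)// /up le_max lexx orbT.
rewrite /dl; nra.
Qed.

(** Iterating [osc_step] with [eps] small: the factor [1 - p] drives the oscillation
    down geometrically to the order of [Lstar * eps]. *)
Theorem mixing (eps : R) : 0 < eps -> exists N, forall k, (N <= k)%N ->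
  osc_le k eps.
Proof.
move=> e0; have [L1 L2] := Lstar_ge.
have L0 : 0 < Lstar by lra.
have e'0 : 0 < eps / (8 * Lstar) by rewrite divr_gt0// mulr_gt0.
have [m [p [p0 p1 Hp]]] := minorization e'0.
pose b := 4 * Lstar * (eps / (8 * Lstar)).
have bE : b = eps / 2 by rewrite /b; field; rewrite gt_eqF.
have iter n : osc_le (n * m) (2 * (1 - p) ^+ n + b).
  elim: n => [|n IH].
    move=> f tf; exists (- 1) => x Xx; rewrite mul0n transfer0.
    have := tf.1 x; rewrite ler_norml expr0 mulr1 => /andP[-> fx] /=.
    rewrite bE; lra.
  move=> f tf; have [i Hi] := osc_step e'0 p0 Hp IH tf.
  exists i => x Xx; rewrite mulSn; have /andP[-> hx] := Hi x Xx.
  rewrite (le_trans hx)// lerD2l exprS -/b le_eqVlt; apply/orP; left; apply/eqP.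
  by ring.
have cvp : (fun n => (1 - p) ^+ n) @ \oo --> (0 : R).
  apply: cvg_expr; rewrite ger0_norm ?subr_ge0//; lra.
have e4 : 0 < eps / 4 by rewrite divr_gt0.
have /cvgrPdist_lt/(_ _ e4)[n _ /(_ n (leqnn n))] := cvp.
rewrite sub0r normrN => /(le_lt_trans (ler_norm _)) pn.
exists (n * m)%N => k nk f tf.
have [i Hi] := osc_mono (k - n * m) (iter n) tf; rewrite subnK// in Hi.
exists i => x Xx; have /andP[-> hx] := Hi x Xx.
rewrite (le_trans hx)// lerD2l bE; lra.
Qed.

Lemma osc_transfer k j a f u v : osc_le k a -> testF f -> X u -> X v ->
  `|transfer k f u - transfer (j + k) f v| <= a.
Proof.
move=> Hk tf Xu Xv; have [i Hi] := Hk f tf.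
have := Hi u Xu; have := transfer_between j tf Hi Xv.
by move=> /andP[? ?] /andP[? ?]; rewrite ler_norml; apply/andP; split; lra.
Qed.

Lemma transferD k (f g : borel H -> R) u : bmfun f -> bmfun g ->
  transfer k (fun x => f x + g x) u = transfer k f u + transfer k g u.
Proof. by move=> bf bg; rewrite /transfer ExD//; exact: bm_state. Qed.

Lemma transferZ k c (f : borel H -> R) u : bmfun f ->
  transfer k (fun x => c * f x) u = c * transfer k f u.
Proof. by move=> bf; rewrite /transfer ExZ//; exact: bm_state. Qed.

(** Every bounded Lipschitz function is a multiple of a test function, so that
    facts about the test class extend by linearity. *)
Lemma BL_testF f : BL f -> exists c g, testF g /\ f = (fun x => c * g x).
Proof.
have [L1 L2] := Lstar_ge.
move=> [M [k [fM fk]]]; pose c := 1 + `|M| + `|k|.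
have c0 : 0 < c by rewrite /c -addrA ltr_pwDl.
exists c, (fun x => c^-1 * f x); split; last first.
  by apply/funext => x; rewrite mulrA mulfV ?gt_eqF// mul1r.
have cM : M <= c by have := ler_norm M; have := normr_ge0 k; rewrite /c; lra.
have ck : k <= c by have := ler_norm k; have := normr_ge0 M; rewrite /c; lra.
split=> [x|].
  by rewrite normrM gtr0_norm ?invr_gt0// ler_pdivrMl// mulr1 (le_trans (fM x)).
apply: (@klip_le _ _ (`|c^-1| * k)); last exact: klipZ.
rewrite gtr0_norm ?invr_gt0// ler_pdivrMl// (le_trans ck)//.
by rewrite ler_peMr ?(ltW c0)//; lra.
Qed.

Lemma testF_BL f : testF f -> BL f.
Proof. by move=> tf; exists 1, Lstar. Qed.

(** The values of the equilibrium measure on test functions, before this measure is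
    known to exist. *)
Definition equil (f : H -> R) : R := lim (transfer k f uhat @[k --> \oo]).

(** Later averages stay within the range of earlier ones, whose oscillation tends to
    0: the sequence is Cauchy. *)
Lemma transfer_cvg f : BL f ->
  transfer k f uhat @[k --> \oo] --> equil f.
Proof.
move=> /BL_testF[c [g [tg ->]]].
suff cg : cvgn (fun k => transfer k g uhat).
  have -> : equil = fun f => lim (transfer k f uhat @[k --> \oo]) by [].
  under eq_fun do rewrite (transferZ _ _ _ (test_bm tg)).
  by apply: is_cvgM => //; exact: is_cvg_cst.
apply/cauchy_cvgP/cauchy_exP => e e0.
have e20 : 0 < e / 2 by rewrite divr_gt0.
have [N HN] := mixing e20.
exists (transfer N g uhat), N => // k /= Nk.
rewrite -ball_normE /= -(subnK Nk).
rewrite (le_lt_trans (osc_transfer _ (HN N (leqnn N)) tg Xuhat Xuhat))//.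
by rewrite ltr_pdivrMr// ltr_pMr// ltr1n.
Qed.

Lemma equilE f a : transfer k f uhat @[k --> \oo] --> a -> equil f = a.
Proof. by move=> fa; apply: cvg_lim => //; exact: Rhausdorff. Qed.

Lemma equil_approx k a f u : osc_le k a -> testF f -> X u ->
  `|transfer k f u - equil f| <= a.
Proof.
move=> Hk tf Xu.
have cf : transfer (j + k) f uhat @[j --> \oo] --> equil f.
  by rewrite (cvg_shiftn k (fun j => transfer j f uhat)); exact/transfer_cvg/testF_BL.
apply: (cvgr_to_le (cvg_norm (cvgB (cvg_cst (transfer k f u)) cf))); apply: nearW => j.
exact: osc_transfer.
Qed.

(** The limit functional inherits linearity and positivity on [X] from the
    averages. *)
Lemma equilibrium_exists : exists mu : probability (borel H) R, mu X = 1%E /\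
  forall f, BL f -> \int[mu]_x f x = equil f.
Proof.
apply: (riesz X_compact).
- move=> f g bf bg; apply: equilE.
  under eq_fun do rewrite (transferD _ _ (BL_bm bf) (BL_bm bg)).
  exact: cvgD (transfer_cvg bf) (transfer_cvg bg).
- move=> c f bf; apply: equilE.
  under eq_fun do rewrite (transferZ _ _ _ (BL_bm bf)).
  exact: cvgM (cvg_cst c) (transfer_cvg bf).
- apply: equilE; under eq_fun do rewrite transfer_cst.
  exact: cvg_cst.
- move=> f g bf bg fg.
  rewrite -subr_ge0; apply: (cvgr_to_ge (cvgB (transfer_cvg bg) (transfer_cvg bf))).
  by apply: nearW => k; rewrite subr_ge0; apply: transfer_leX => //; exact: BL_bm.
Qed.

Lemma equil_transfer f g : BL f -> BL g ->
  (forall x, X x -> g x = avg S l f x) -> equil g = equil f.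
Proof.
move=> bf bg gf; apply: equilE.
have := transfer_cvg bf; rewrite -(cvg_shiftS (fun j => transfer j f uhat)); apply: cvg_trans.
apply: near_eq_cvg; apply: nearW => k /=.
by rewrite (@transferS f g)//; exact: BL_bm.
Qed.

Lemma bm_transfer k (f : borel H -> R) : bmfun f ->
  bmfun (transfer k f : borel H -> R).
Proof.
move=> bf.
have bF := bm_comp bf (measurable_state2 sepH sepE eta S_cont k).
exact: (bm_Ex (@dirac _ (borel H) (point : H) R : probability (borel H) R) P bF).
Qed.

Let mX : measurable (X : set (borel H)).
Proof.
by apply: closed_borel; apply: compact_closed => //; exact: norm_hausdorff.
Qed.

(** [markov_op] is a bare set function; on Borel sets it agrees with the law of the
    state after [k] steps when the initial state has law [lam] and is independent of
    the noise, realized on the product space. *)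
Lemma evolution k (lam : probability (borel H) R) : lam X = 1%E ->
  exists Q : probability (borel H) R, [/\ Q X = 1%E,
    forall A : set (borel H), measurable A -> markov_op P S eta X k lam A = Q A &
    forall f : borel H -> R, bmfun f ->
      \int[Q]_x f x = \int[lam]_u transfer k f u].
Proof.
move=> lamX; have [m mE] := product_probability lam P.
have ms := measurable_state2 sepH sepE eta S_cont k.
pose Z : {mfun (borel H * Om)%type >-> borel H} :=
  HB.pack (fun p : borel H * Om => state S eta k p.1 p.2 : borel H)
    (isMeasurableFun.Build _ _ _ _ _ ms).
pose Q : probability (borel H) R := distribution m Z.
have QE (f : borel H -> R) : bmfun f -> \int[Q]_x f x = \int[lam]_u transfer k f u.
  move=> bf; rewrite /Q Ex_pushforward// (Ex_prod mE)//.
  exact: (bm_comp bf ms).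
exists Q; split => //.
  rewrite -Ex_indic// QE; last exact: bm_indic.
  congr EFin; rewrite -[RHS](Ex_cst lam 1); apply: (full_measure_eq mX lamX).
  - exact/bm_transfer/bm_indic.
  - exact: bm_cst.
  move=> u Xu; rewrite -[RHS](transfer_cst k 1 u).
  apply: transfer_eqX => //; [exact: bm_indic|exact: bm_cst|].
  by move=> x Xx; rewrite indicE mem_set.
move=> A mA; rewrite -Ex_indic// QE; last exact: bm_indic.
rewrite -(full_measure_integral mX lamX); last exact/bm_transfer/bm_indic.
apply: eq_integral => u _; rewrite /transfer.
have mu := measurable_state sepH sepE eta S_cont k u.
have mu' : measurable (state S eta k u @^-1` A).
  by rewrite -[X in measurable X]setTI; exact: mu.
rewrite -[transition _ _ _ _ _ _]/(P (state S eta k u @^-1` A)).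
by rewrite -(Ex_indic P mu').
Qed.

Lemma BL_avg f : BL f -> exists2 g, BL g & forall u, X u -> g u = avg S l f u.
Proof.
move=> [M [k [fM fk]]].
have M0 : 0 <= M by exact: le_trans (normr_ge0 _) (fM 0).
have X0 : X !=set0 by exists uhat.
have [|g tg gE] := @avg_extend f M `|k| X0 _ (normr_ge0 k) M0.
  by split => //; apply: klip_le fk; exact: ler_norm.
by exists g => //; exists M, (`|k| / 2 + C * M).
Qed.

Lemma transfer1 f g u : BL f -> BL g -> (forall x, X x -> g x = avg S l f x) ->
  X u -> transfer 1 f u = g u.
Proof.
move=> bf bg gf Xu; rewrite (@transferS f g)//; first exact: transfer0.
  exact: BL_bm.
exact: BL_bm.
Qed.

(** The limit defining [equil] does not see a shift of time by one step. *)
Lemma equilibrium_stationary (mu : probability (borel H) R) : mu X = 1%E ->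
  (forall f, BL f -> \int[mu]_x f x = equil f) -> stationary P S eta X mu.
Proof.
move=> muX muE A mA; have [Q [_ QA QE]] := evolution 1 muX.
rewrite QA//; apply: BL_determines mA => f bf.
have [g bg gf] := BL_avg bf.
rewrite QE; last exact: BL_bm.
rewrite (muE _ bf) -(equil_transfer bf bg gf) -(muE _ bg).
apply: (full_measure_eq mX muX); [exact/bm_transfer/BL_bm|exact: BL_bm|].
by move=> u Xu; rewrite (transfer1 bf bg gf).
Qed.

Lemma stationary_transfer (nu : probability (borel H) R) k f : nu X = 1%E ->
  stationary P S eta X nu -> BL f -> \int[nu]_x f x = \int[nu]_x transfer k f x.
Proof.
move=> nuX nuS; elim: k f => [|k IH] f bf.
  by apply: eq_Rintegral => x _; rewrite transfer0.
have [Q [_ QA QE]] := evolution 1 nuX; have [g bg gf] := BL_avg bf.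
have -> : \int[nu]_x f x = \int[Q]_x f x.
  congr fine; apply: integral_ext => A mA.
  exact: etrans (esym (nuS A mA)) (QA A mA).
rewrite QE; last exact: BL_bm.
transitivity (\int[nu]_x g x).
  apply: (full_measure_eq mX nuX); [exact/bm_transfer/BL_bm|exact: BL_bm|].
  by move=> u Xu; rewrite (transfer1 bf bg gf).
rewrite IH//; apply: (full_measure_eq mX nuX).
- exact/bm_transfer/BL_bm.
- exact/bm_transfer/BL_bm.
by move=> u Xu; rewrite (@transferS f g)//; exact: BL_bm.
Qed.

Lemma equil_rate k a (lam : probability (borel H) R) f : lam X = 1%E ->
  osc_le k a -> testF f -> `|\int[lam]_u transfer k f u - equil f| <= a.
Proof.
move=> lamX Hk tf.
have bt := bm_transfer k (test_bm tf).
rewrite -(Ex_cst lam (equil f)) -ExB//; last exact: bm_cst.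
apply: (full_measure_bound mX lamX); first by apply: bmB => //; exact: bm_cst.
by move=> u Xu; exact: equil_approx.
Qed.

(** For a stationary measure the integral of [f] equals that of its averages, which
    are close to the constant [equil f]. *)
Lemma stationary_equil (nu : probability (borel H) R) f : nu X = 1%E ->
  stationary P S eta X nu -> BL f -> \int[nu]_x f x = equil f.
Proof.
move=> nuX nuS /BL_testF[c [g [tg ->]]].
have bg := testF_BL tg.
have -> : equil (fun x => c * g x) = c * equil g.
  apply: equilE; under eq_fun do rewrite (transferZ _ _ _ (test_bm tg)).
  exact: cvgM (cvg_cst c) (transfer_cvg bg).
rewrite ExZ; last exact: test_bm tg.
congr (c * _); apply/eqP; rewrite -subr_eq0 -normr_le0.
apply/ler_addgt0Pr => e e0; rewrite add0r.
have [N HN] := mixing e0.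
rewrite (stationary_transfer N nuX nuS bg).
exact: equil_rate (HN N (leqnn N)) tg.
Qed.

(** The smallest uniform oscillation bound at time [k]; the added term makes it
    positive and above some admissible bound. *)
Definition rate (k : nat) : R :=
  inf [set a | 0 <= a /\ osc_le k a] + k.+1%:R^-1.

Lemma rate_has_inf k : has_inf [set a | 0 <= a /\ osc_le k a].
Proof.
split; last by exists 0 => a [].
exists 2; split => //; rewrite -[k]addn0; apply: osc_mono => f tf.
exists (- 1) => x _; rewrite transfer0.
by have := tf.1 x; rewrite ler_norml => /andP[? ?]; apply/andP; split; lra.
Qed.

Lemma rate_gt0 k : 0 < rate k.
Proof.
rewrite /rate ltr_wpDl// ?invr_gt0//.
by apply: lb_le_inf => [|a []//]; exact: (rate_has_inf k).1.
Qed.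

Lemma rate_osc k : exists2 a, osc_le k a & a <= rate k.
Proof.
have k0 : 0 < k.+1%:R^-1 :> R by rewrite invr_gt0.
have [a [_ Ha] ak] := inf_adherent k0 (rate_has_inf k).
by exists a => //; exact: ltW.
Qed.

Lemma rate_cvg : rate @ \oo --> (0 : R).
Proof.
apply/cvgrPdist_lt => e e0; have e20 : 0 < e / 2 by rewrite divr_gt0.
have [N HN] := mixing e20.
near=> k; rewrite sub0r normrN gtr0_norm; last exact: rate_gt0.
rewrite /rate (splitr e); apply: ler_ltD.
  apply: ge_inf; first exact: (rate_has_inf k).2.
  by split; [exact: ltW|apply: HN; near: k; exact: nbhs_infty_ge].
near: k; exact: (near_infty_natSinv_lt (PosNum e20)).
Unshelve. all: by end_near. Qed.

(** Pairs of points at distance more than 1 are not controlled by the Lipschitz part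
    of the norm, but there the supremum part gives the constant 2. *)
Lemma lip_norm_extend (g : H -> R) : (lip_norm X g <= 1)%E ->
  exists2 f, testF f & forall x, X x -> f x = g x.
Proof.
move=> g1; have [L1 L2] := Lstar_ge.
set s1 := ereal_sup [set `|g u|%:E | u in X].
set s2 := ereal_sup (0%E |` [set q | exists u v,
    [/\ X u, X v, (0 < `|u - v| <= 1)%R
      & q = (`|g u - g v| / `|u - v|)%:E]]).
have s12 : (s1 + s2 <= 1)%E by [].
have s10 : (0 <= s1)%E.
  apply: (@le_trans _ _ `|g uhat|%:E); first by rewrite lee_fin.
  by apply: ereal_sup_ubound; exists uhat.
have s20 : (0 <= s2)%E by apply: ereal_sup_ubound; left.
have gb u : X u -> `|g u| <= 1.
  move=> Xu; rewrite -lee_fin (le_trans _ s12)//.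
  rewrite -[leLHS]adde0; apply: leeD => //.
  by apply: ereal_sup_ubound; exists u.
apply: lip_extend => //.
- by exists uhat.
- by lra.
move=> u v Xu Xv; have [->|uv] := eqVneq u v.
  by rewrite !subrr !normr0 mulr0.
have uv0 : 0 < `|u - v| by rewrite normr_gt0 subr_eq0.
have [uv1|uv1] := leP `|u - v| 1.
  have : `|g u - g v| / `|u - v| <= 1.
    rewrite -lee_fin (le_trans _ s12)//.
    rewrite -[leLHS]add0e; apply: leeD => //.
    by apply: ereal_sup_ubound; right; exists u, v; rewrite uv0.
  rewrite ler_pdivrMr// mul1r => /le_trans; apply.
  by rewrite ler_peMl ?ltW//; lra.
have := gb u Xu; have := gb v Xv => gv gu.
rewrite (le_trans (ler_normB _ _))//; nra.
Qed.

Lemma dual_lip_rate (mu lam : probability (borel H) R) k : mu X = 1%E ->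
  (forall f, BL f -> \int[mu]_x f x = equil f) -> lam X = 1%E ->
  (dual_lip_dist X (markov_op P S eta X k lam) mu <= (rate k)%:E)%E.
Proof.
move=> muX muE lamX; have [Q [QX QA QE]] := evolution k lamX.
apply: ge_ereal_sup => _ [g [_ g1] <-].
have [f tf fg] := lip_norm_extend g1; have bf := test_bm tf.
have intE (m : set (borel H) -> \bar R) :
    (\int[m]_(u in X) (g u)%:E = \int[m]_(u in X) (f u)%:E)%E.
  suff gfX : (fun u : borel H => (g u)%:E) \_ X = (fun u => (f u)%:E) \_ X.
    by rewrite /integral gfX.
  apply/funext => u; rewrite !patchE; case: ifPn => // /set_mem Xu.
  by rewrite fg.
rewrite !intE (integral_ext _ _ QA) (full_measure_integral mX QX bf).
rewrite (full_measure_integral mX muX bf) QE// (muE _ (testF_BL tf)).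
have [a Ha ak] := rate_osc k.
by rewrite lee_fin (le_trans _ ak)//; exact: equil_rate.
Qed.

(** Besides continuity, the invariance of [X] and the independence of the noises,
    only the Lasota-Yorke inequality and the controllability to [uhat] are used. *)
Theorem unique_ergodicity : exists mu : probability (borel H) R,
  [/\ mu X = 1%E, stationary P S eta X mu,
      forall nu : probability (borel H) R, nu X = 1%E ->
        stationary P S eta X nu ->
        forall A : set (borel H), measurable A -> nu A = mu A &
      exists gamma : nat -> R, [/\ forall k, 0 < gamma k,
        gamma @ \oo --> (0 : R) &
        forall k (lam : probability (borel H) R), lam X = 1%E ->
          (dual_lip_dist X (markov_op P S eta X k lam) mu <= (gamma k)%:E)%E]].
Proof.
have [mu [muX muE]] := equilibrium_exists; exists mu; split => //.
- exact: equilibrium_stationary.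
- move=> nu nuX nuS; apply: BL_determines => f bf.
  by rewrite muE// stationary_equil.
exists rate; split; [exact: rate_gt0|exact: rate_cvg|].
by move=> k lam lamX; exact: dual_lip_rate.
Qed.

End Mixing.

(** * Decomposable noise and the main result *)

Lemma mutually_independent_comp {d d'} {T : measurableType d}
    {T' : measurableType d'} {R : realType} (P : probability T R)
    (I I' : choiceType) (D : set I) (X : I -> {mfun T >-> T'}) (h : I' -> I) :
  injective h -> mutually_independent P D X ->
  mutually_independent P (h @^-1` D) (X \o h).
Proof.
move=> hinj indep s B sD mB.
(* The sets [B] are transported along [h], with the full set outside its range. *)
have [B' B'E mB'] : exists2 B' : I -> set T', (forall i, B' (h i) = B i) &
    forall i, measurable (B' i).
  pose inv i := if pselect (exists j, h j = i) is left ex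
    then B (projT1 (cid ex)) else setT.
  exists inv => i; rewrite /inv; case: pselect => [ex|]//.
  - by congr B; apply: hinj; exact: projT2 (cid ex).
  - by case; exists i.
have := indep (h @` s)%fset B'.
rewrite big_imfset /=; last by move=> x y _ _; exact: hinj.
under [in X in _ -> X]eq_bigr do rewrite -B'E.
move=> <- //; last by move=> i /imfsetP[j /= js ->]; exact: sD.
congr (P _); apply/seteqP; split => w Hw i /=.
  by move=> /imfsetP[j /= js ->]; have := Hw j js; rewrite -B'E.
by move=> si; rewrite -B'E; apply: Hw; exact: in_imfset.
Qed.

Lemma lipschitz_constant {R : realType} (f : R -> R) : lipschitz f ->
  exists K, klip K f.
Proof.
move=> /pinfty_ex_gt0[K _ HK]; exists K => x y.
exact: (HK (x, y)).
Qed.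

Section NoiseShift.
Context {R : realType} {E : completeNormedModType R} {ip : {dot E for idfun}}.
Hypotheses (normE : induces_norm ip) (sepE : separable E).
Context {d} {Om : measurableType d} {P : probability Om R}.
Context {J : set nat} {e : nat -> E} {b : nat -> R}.
Context {xi : nat -> {RV P >-> R}} {eta : {RV P >-> borel E}}.
Variable l : probability (borel E) R.
Hypothesis eta_law : forall A : set (borel E), measurable A ->
  distribution P eta A = l A.
Hypothesis K_compact : compact (msupport l).
Hypothesis ortho : forall i j, J i -> J j -> ip (e i) (e j) = (i == j)%:R.
Hypothesis indep : mutually_independent P J xi.
Hypothesis eta_sum : {ae P, forall w,
  (fun n => \sum_(j < n | (j : nat) \in J) (b j * xi j w) *: e j)
    @ \oo --> (eta w : E)}.

Lemma Ex_law (f : borel E -> R) : bmfun f ->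
  \int[l]_z f z = \int[P]_w f (eta w).
Proof.
move=> bf; rewrite -Ex_pushforward//; congr fine.
by apply: eq_measure_integral => A mA _; exact/esym/eta_law.
Qed.

Lemma noise_bounded : exists B, {ae P, forall w, `|(eta w : E)| <= B}.
Proof.
have [B B0 HB] := compact_norm_le K_compact; exists B.
have [N [mN lN HN]] := msupport_ae sepE l.
exists (eta @^-1` N); split.
- by rewrite -[X in measurable X]setTI; exact: (measurable_funP eta).
- by rewrite -[RHS]lN -eta_law.
- by move=> w wB; apply: HN => Kw; apply: wB; exact: HB.
Qed.

(** The density of the coordinate [j] has bounded support since the noise is bounded,
    which allows translating the noise along [e j]. *)
Lemma noise_shift_stable j (rho : R -> R) : J j -> b j != 0 ->
  (forall x, 0 <= rho x) -> lipschitz rho ->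
  (forall A : set R, measurable A -> distribution P (xi j) A =
     (\int[lebesgue_measure]_(x in A) (rho x)%:E)%E) ->
  exists C c, 0 < c /\ shift_stable l (e j) C c.
Proof.
move=> Jj bj rho0 /lipschitz_constant[K rhoK] mrho.
have [B etaB] := noise_bounded.
exists (K * 2 * (`|B / `|b j| | + 1) / `|b j|), `|b j|.
split; first by rewrite normr_gt0.
move=> phi chi M D s cphi cchi phiM chi1 chiD sb.
have bF (t : R) : bmfun ((fun z => phi (z + t *: e j) * chi z) : borel E -> R).
  split; last first.
    exists M => z; rewrite normrM -[leRHS]mulr1 ler_pM//.
  apply: continuous_borelR => z; apply: cvgM; last exact: cchi.
  apply: (@continuous_comp _ _ _ (fun z => z + t *: e j) phi); last exact: cphi.
  by apply: cvgD; [exact: cvg_id | exact: cvg_cst].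
have bF0 : bmfun ((fun z => phi z * chi z) : borel E -> R).
  have := bF 0; rewrite (_ : (fun z => _) = (fun z => phi z * chi z))//.
  by apply/funext => z; rewrite scale0r addr0.
rewrite (Ex_law (bF s)) (Ex_law bF0).
exact: (Ex_shift_coord normE sepE ortho indep eta_sum Jj bj rho0 rhoK mrho etaB).
Qed.

End NoiseShift.

Theorem theorem1p1 (R : realType)
  (H E V : completeNormedModType R)
  (ipH : {dot H for idfun}) (ipE : {dot E for idfun}) (ipV : {dot V for idfun})
  (normH : induces_norm ipH) (normE : induces_norm ipE)
  (normV : induces_norm ipV)
  (sepH : separable H) (sepE : separable E)
  (iota : {linear V -> H}) (iotaP : compact_embedding iota)
  (S : H * E -> H) (S_cont : continuous S)
  (d : measure_display) (Omega : measurableType d) (P : probability Omega R)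
  (eta : nat -> {RV P >-> borel E})
  (l : probability (borel E) R)
  (eta_indep : mutually_independent P [set: nat] eta)
  (eta_law : forall k (Gamma : set (borel E)), measurable Gamma ->
     distribution P (eta k) Gamma = l Gamma)
  (K_compact : compact (msupport l))
  (X : set H) (X_compact : compact X)
  (X_inv : forall u z, X u -> msupport l z -> X (S (u, z)))
  (H1 : (exists SV : H * E -> V,
           (forall p, S p = iota (SV p)) /\ C2_bounded SV) /\
        partially_analytic S)
  (H2 : exists uhat, X uhat /\
     forall eps : R, 0 < eps -> exists m : nat, (1 <= m)%N /\
       forall u, X u -> exists zeta : nat -> E,
         (forall k, (k < m)%N -> msupport l (zeta k)) /\
         `|traj S zeta u m - uhat| < eps)
  (H3 : forall u, X u ->
     {ae l, forall z : borel E,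
        dense (range ('d (fun y : E => S (u, y)) (z : E)))})
  (H4 : exists (J : set nat) (e : nat -> E)
            (xi : nat -> nat -> {RV P >-> R}) (b : nat -> R)
            (rho : nat -> R -> R),
     [/\ orthonormal_basis ipE J e,
         mutually_independent P [set p : nat * nat | J p.1]
           (fun p => xi p.1 p.2),
         (forall j, J j -> b j != 0) /\
         cvgn (fun n => \sum_(j < n | (j : nat) \in J) b j ^+ 2),
         forall k, {ae P, forall w,
           (fun n => \sum_(j < n | (j : nat) \in J) (b j * xi j k w) *: e j)
             @ \oo --> (eta k w : E)}
       & forall j, J j ->
         [/\ forall x, 0 <= rho j x, lipschitz (rho j)
           & forall k (A : set R), measurable A ->
               distribution P (xi j k) A =
               (\int[lebesgue_measure]_(x in A) (rho j x)%:E)%E]]) :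
  exists mu : probability (borel H) R,
    [/\ mu X = 1%E,
        stationary P S eta X mu,
        forall nu : probability (borel H) R,
          nu X = 1%E -> stationary P S eta X nu ->
          forall Gamma : set (borel H), measurable Gamma -> nu Gamma = mu Gamma
      & exists gamma : nat -> R,
          [/\ forall k, 0 < gamma k,
              gamma @ \oo --> (0 : R)
            & forall k (lambda : probability (borel H) R), lambda X = 1%E ->
                (dual_lip_dist X (markov_op P S eta X k lambda) mu
                   <= (gamma k)%:E)%E]].
Proof.
have [uhat [Xuhat control]] := H2.
have [[SV [SE C2]] _] := H1.
have [J [e [xi [b [rho [[ortho span] indep [b0 _] eta_sum xi_law]]]]]] := H4.
(* All noises have the same law, so it is enough to decompose the first one. *)
have indep0 : mutually_independent P J (xi ^~ 0%N).
  have inj0 : injective (fun j : nat => (j, 0%N)) by move=> i j [].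
  exact: mutually_independent_comp inj0 indep.
have shiftP j : J j -> exists C c, 0 < c /\ shift_stable l (e j) C c.
  move=> Jj; have [rho0 rhoL mrho] := xi_law j Jj.
  exact: (noise_shift_stable normE sepE (eta_law 0) K_compact ortho indep0
    (eta_sum 0%N) Jj (b0 j Jj) rho0 rhoL (mrho 0%N)).
have e1 j : J j -> `|e j| <= 1.
  move=> Jj; rewrite -(ler_pXn2r (n := 2))// ?nnegrE// normE ortho// eqxx.
  by rewrite expr1n.
have lin := smooth_strict_linearization iotaP SE C2.
have strictP p : exists L : {linear (H * E)%type -> H}, strict_linearization S p L.
  by have [L HL _] := lin p; exists L.
have denseP u : X u -> {ae l, forall z : borel E,
    exists2 L : {linear (H * E)%type -> H}, strict_linearization S (u, z : E) L &
      dense (range (fun w : E => L (0, w)))}.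
  move=> Xu.
  refine (@filterS _ _ (ae_filter_ringOfSetsType l) _ _ _ (H3 u Xu)) => z dz.
  have [L HL LE] := lin (u, z); exists L => //.
  by rewrite (_ : (fun w : E => _) = 'd (fun y : E => S (u, y)) (z : E))//; exact/funext.
have [C [C0 LY]] := lasota_yorke sepE S_cont K_compact X_compact e1 span shiftP strictP denseP.
exact: (unique_ergodicity sepH sepE S_cont eta_indep eta_law X_inv X_compact C0 LY Xuhat control).
Qed.
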